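(* Let $K$ be a field with $\operatorname{char} K \neq 2$, let $a,c \in K^\times$, $\varepsilon_1,\varepsilon_2 \in \{1,-1\}$, and let $x_1,x_2,x_3$ be independent indeterminates over $K$. Let $G$ be the group of $K$-automorphisms of $K(x_1,x_2,x_3)$ generated by $$\sigma_1: x_1 \mapsto \frac{a}{x_2},\ x_2 \mapsto x_1,\ x_3 \mapsto \frac{c}{x_3},\qquad \sigma_2: x_1 \mapsto \varepsilon_1 x_1,\ x_2 \mapsto \varepsilon_1 x_2,\ x_3 \mapsto \frac{\varepsilon_2 c}{x_3}.$$ If $\varepsilon_1=1$ or $\varepsilon_2=1$, then $K(x_1,x_2,x_3)^G$ is rational over $K$. If $\varepsilon_1=\varepsilon_2=-1$, then $K(x_1,x_2,x_3)^G$ is rational over $K$ if and only if $K(x_1,x_2,x_3)^{\langle\tau\rangle}$ is rational over $K$, where $\tau: x_1\mapsto -x_1,\ x_2\mapsto \frac{a}{x_2},\ x_3 \mapsto \frac{ax_1^2-c}{x_3}$; and this holds if and only if at least one of $-1,\pm a,\pm ac,-c$ belongs to $K^{\times 2}$.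
   Context: Rational over $K$ means purely transcendental over $K$. $K^{\times 2}$ is the set of nonzero squares of $K$. For a group $H$ of automorphisms of a field $F$, $F^H$ is the fixed subfield. (The group $G$ is isomorphic to $C_4\times C_2$.) *)

(* Defs.v *)
From HB Require Import structures.
From mathcomp Require Import all_boot all_order all_algebra generic_quotient.
From mathcomp.multinomials Require Import mpoly.

Set Implicit Arguments.
Unset Strict Implicit.
Unset Printing Implicit Defensive.

Import GRing.Theory.
Local Open Scope ring_scope.

Section FieldExtensions.

Variables (K L : fieldType) (iota : {rmorphism K -> L}).

Definition alg_independent (B : L -> Prop) : Prop :=
  forall (n : nat) (y : 'I_n -> L),
    injective y -> (forall i, B (y i)) ->
    forall p : {mpoly K[n]}, mmap iota y p = 0 -> p = 0.

Definition is_subfield (M : L -> Prop) : Prop :=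
  [/\ M 1, forall x y, M x -> M y -> M (x - y)
         & forall x y, M x -> M y -> M (x / y)].

Definition adjoin (B : L -> Prop) (x : L) : Prop :=
  forall M : L -> Prop, is_subfield M ->
    (forall k, M (iota k)) -> (forall b, B b -> M b) -> M x.

Definition purely_transcendental (M : L -> Prop) : Prop :=
  exists B : L -> Prop,
    alg_independent B /\ (forall x, M x <-> adjoin B x).

Definition is_aut_over (s : {rmorphism L -> L}) : Prop :=
  bijective s /\ (forall k, s (iota k) = iota k).

Inductive group_gen (S : (L -> L) -> Prop) : (L -> L) -> Prop :=
| group_gen_in s of S s : group_gen S s
| group_gen_id : group_gen S id
| group_gen_comp s t of group_gen S s & group_gen S t : group_gen S (s \o t)
| group_gen_inv s t of group_gen S s & cancel s t & cancel t s :
    group_gen S t.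

Definition fixed_field (H : (L -> L) -> Prop) (x : L) : Prop :=
  forall s, H s -> s x = x.

End FieldExtensions.

Definition nonzero_square (K : fieldType) (x : K) : Prop :=
  exists2 y : K, y != 0 & x = y ^+ 2.

Notation ratfun K n := {fraction {mpoly K[n]}}.

Section RationalFunctions.

Variables (K : fieldType) (n : nat).

Definition rfC : {rmorphism K -> ratfun K n} :=
  [the {rmorphism K -> ratfun K n} of
    @FracField.tofrac {mpoly K[n]} \o @mpolyC n K].

Definition rfX (i : 'I_n) : ratfun K n := FracField.tofrac ('X_i : {mpoly K[n]}).

End RationalFunctions.

Definition x1 (K : fieldType) : ratfun K 3 := rfX K (@Ordinal 3 0 isT).
Definition x2 (K : fieldType) : ratfun K 3 := rfX K (@Ordinal 3 1 isT).
Definition x3 (K : fieldType) : ratfun K 3 := rfX K (@Ordinal 3 2 isT).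

Definition sigma1_spec (K : fieldType) (a c : K)
    (s : {rmorphism ratfun K 3 -> ratfun K 3}) : Prop :=
  [/\ is_aut_over (rfC K 3) s, s (x1 K) = rfC K 3 a / x2 K,
      s (x2 K) = x1 K & s (x3 K) = rfC K 3 c / x3 K].

Definition sigma2_spec (K : fieldType) (c e1 e2 : K)
    (s : {rmorphism ratfun K 3 -> ratfun K 3}) : Prop :=
  [/\ is_aut_over (rfC K 3) s, s (x1 K) = rfC K 3 e1 * x1 K,
      s (x2 K) = rfC K 3 e1 * x2 K & s (x3 K) = rfC K 3 (e2 * c) / x3 K].

Definition tau_spec (K : fieldType) (a c : K)
    (s : {rmorphism ratfun K 3 -> ratfun K 3}) : Prop :=
  [/\ is_aut_over (rfC K 3) s, s (x1 K) = - x1 K, s (x2 K) = rfC K 3 a / x2 K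
    & s (x3 K) = (rfC K 3 a * x1 K ^+ 2 - rfC K 3 c) / x3 K].

(* For ring morphisms j, e from R to L, with j injective, the partial map    *)
(* j p / j q |-> e p / e q of L, defined where e q != 0.                     *)
Section PartialMap.

Variables (R : idomainType) (L : fieldType) (j e : {rmorphism R -> L}).
Hypothesis j_inj : injective j.

Definition pmap_rel (f g : L) : Prop :=
  exists p q, [/\ e q != 0, f = j p / j q & g = e p / e q].

Lemma pmap_rel_neq0 q : e q != 0 -> j q != 0.
Proof.
apply: contraNneq => jq0.
by rewrite (j_inj (etrans jq0 (esym (rmorph0 j)))) rmorph0.
Qed.

Lemma pmap_rel_uniq f g g' : pmap_rel f g -> pmap_rel f g' -> g = g'.
Proof.
move=> [p [q [q0 -> ->]]] [p' [q' [q0' /eqP + ->]]].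
rewrite eqr_div ?pmap_rel_neq0 // -!rmorphM => /eqP/j_inj E.
by apply/eqP; rewrite eqr_div // -!rmorphM E.
Qed.

Lemma pmap_rel_im p : pmap_rel (j p) (e p).
Proof. by exists p, 1; rewrite !rmorph1 !divr1 oner_neq0. Qed.

Lemma pmap_relD f g f' g' :
  pmap_rel f g -> pmap_rel f' g' -> pmap_rel (f + f') (g + g').
Proof.
move=> [p [q [q0 -> ->]]] [p' [q' [q0' -> ->]]].
exists (p * q' + p' * q), (q * q').
by rewrite !rmorphM !rmorphD !rmorphM mulf_neq0 // !addf_div ?pmap_rel_neq0.
Qed.

Lemma pmap_relM f g f' g' :
  pmap_rel f g -> pmap_rel f' g' -> pmap_rel (f * f') (g * g').
Proof.
move=> [p [q [q0 -> ->]]] [p' [q' [q0' -> ->]]].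
by exists (p * p'), (q * q'); rewrite !rmorphM mulf_neq0 // !mulf_div.
Qed.

Lemma pmap_relN f g : pmap_rel f g -> pmap_rel (- f) (- g).
Proof.
by move=> [p [q [q0 -> ->]]]; exists (- p), q; rewrite !rmorphN !mulNr.
Qed.

Lemma pmap_rel1 : pmap_rel 1 1.
Proof. by have := pmap_rel_im 1; rewrite !rmorph1. Qed.

Lemma pmap_rel0 : pmap_rel 0 0.
Proof. by have := pmap_rel_im 0; rewrite !rmorph0. Qed.

Lemma pmap_relV f g : g != 0 -> pmap_rel f g -> pmap_rel f^-1 g^-1.
Proof.
move=> g0 [p [q [q0 ef eg]]]; exists q, p; rewrite ef eg !invf_div; split=> //.
by apply: contraNneq g0; rewrite eg => ->; rewrite mul0r.
Qed.

Lemma pmap_rel_div f f' g g' : g' != 0 ->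
  pmap_rel f f' -> pmap_rel g g' -> pmap_rel (f / g) (f' / g').
Proof. by move=> g0 ff gg; apply: pmap_relM => //; apply: pmap_relV. Qed.

(* a / b |-> a' / (a' / b') = b' for a |-> a' and b |-> a' / b'.             *)
Lemma pmap_rel_divdiv f f' g g' : f' != 0 -> g' != 0 ->
  pmap_rel f f' -> pmap_rel g (f' / g') -> pmap_rel (f / g) g'.
Proof.
move=> f0 g0 ff gg; rewrite -(divKf f0 g'); apply: pmap_rel_div => //.
by rewrite mulf_neq0 ?invr_eq0.
Qed.

Lemma pmap_relX f g k : pmap_rel f g -> pmap_rel (f ^+ k) (g ^+ k).
Proof.
move=> fg; elim: k => [|k IH]; first by rewrite !expr0; apply: pmap_rel1.
by rewrite !exprS; apply: pmap_relM.
Qed.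

Lemma pmap_rel_total (E : L -> L) : (forall f, pmap_rel f (E f)) ->
  exists s : {rmorphism L -> L}, forall f g, pmap_rel f g -> s f = g.
Proof.
move=> ext.
have addE : zmod_morphism E.
  move=> f g; apply: pmap_rel_uniq (ext _) _; apply: pmap_relD => //.
  exact: pmap_relN.
have mulE : monoid_morphism E.
  split=> [|f g]; first by apply: pmap_rel_uniq (ext _) pmap_rel1.
  by apply: pmap_rel_uniq (ext _) _; apply: pmap_relM.
pose za := GRing.isZmodMorphism.Build _ _ E addE.
pose ma := GRing.isMonoidMorphism.Build _ _ E mulE.
pose s : {rmorphism L -> L} := HB.pack E za ma.
by exists s => f g; apply: pmap_rel_uniq.
Qed.

Lemma pmap_relE (t : {rmorphism L -> L}) f f' :
  (forall p, t (j p) = e p) -> pmap_rel f f' -> t f = f'.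
Proof. by move=> tE [p [q [_ -> ->]]]; rewrite fmorph_div !tE. Qed.

End PartialMap.

Section Substitution.

Variables (K : fieldType) (n : nat).
Local Notation P := {mpoly K[n]}.
Local Notation F := (ratfun K n).
Local Notation tofrac := (@FracField.tofrac P).
Local Notation C := (rfC K n).
Local Notation X := (rfX K).
Implicit Types (h : 'I_n -> F) (p q : P).

Lemma frac_repr (f : F) : f = tofrac \n_(repr f) / tofrac \d_(repr f).
Proof.
set r := repr f.
have dr0 : tofrac \d_r != 0 by rewrite tofrac_eq0 denom_ratioP.
apply: (mulIf dr0); rewrite divfK // -[f]reprK -/r.
unlock FracField.tofrac; rewrite -[LHS]FracField.pi_mul; apply/eqmodP.
rewrite /= FracField.equivfE /FracField.mulf.
by rewrite !numden_Ratio ?mulr1 ?oner_neq0 ?denom_ratioP // mulrC.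
Qed.

Lemma rmorph_ratfun_eq (s t : {rmorphism F -> F}) :
  (forall k, s (C k) = t (C k)) -> (forall i, s (X i) = t (X i)) -> s =1 t.
Proof.
move=> eqC eqX.
have eqP p : s (tofrac p) = t (tofrac p).
  elim/mpolyind: p => [|k m p _ _ IH]; first by rewrite !rmorph0.
  rewrite !rmorphD /= IH; congr (_ + _).
  rewrite -mul_mpolyC mpolyXE_id !rmorphM /=; congr (_ * _); first exact: eqC.
  rewrite !rmorph_prod /=; apply: eq_bigr => i _.
  by rewrite !rmorphXn /=; congr (_ ^+ _); apply: eqX.
by move=> f; rewrite (frac_repr f) !fmorph_div !eqP.
Qed.

Definition rf_eval h : {rmorphism P -> F} :=
  [the {rmorphism P -> F} of mmap C h].

Lemma rf_evalC h k : rf_eval h (k%:MP) = C k. Proof. exact: mmapC. Qed.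

Lemma rf_evalX h i : rf_eval h 'X_i = h i.
Proof. by rewrite /rf_eval /= mmapX mmap1U. Qed.

Lemma rf_eval_id p : rf_eval (fun i => X i) p = tofrac p.
Proof.
elim/mpolyind: p => [|k m p _ _ IH]; first by rewrite !rmorph0.
rewrite !rmorphD /= -mul_mpolyC !rmorphM /= IH; congr (_ * _ + _).
  exact: mmapC.
by rewrite mpolyXE_id !rmorph_prod /=; apply: eq_bigr => i _;
   rewrite !rmorphXn /= mmapX mmap1U.
Qed.

Definition rf_subst h : F -> F -> Prop :=
  pmap_rel [the {rmorphism P -> F} of tofrac] (rf_eval h).

Lemma tofrac_inj : injective tofrac.
Proof. by move=> p q /eqP; rewrite tofrac_eq => /eqP. Qed.

Lemma rf_substC h k : rf_subst h (C k) (C k).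
Proof.
by have := pmap_rel_im [the {rmorphism P -> F} of tofrac] (rf_eval h)
  k%:MP; rewrite rf_evalC.
Qed.

Lemma rf_substX h i : rf_subst h (X i) (h i).
Proof.
by have := pmap_rel_im [the {rmorphism P -> F} of tofrac] (rf_eval h)
  'X_i; rewrite rf_evalX.
Qed.

Lemma rf_subst_eval h (f g : 'I_n -> F) p :
    (forall i, rf_subst h (f i) (g i)) ->
  rf_subst h (rf_eval f p) (rf_eval g p).
Proof.
move=> fg; elim/mpolyind: p => [|k m p _ _ IH].
  by rewrite !rmorph0; apply: pmap_rel0.
rewrite !rmorphD; apply: (pmap_relD tofrac_inj) => //.
rewrite -mul_mpolyC !rmorphM !rf_evalC; apply: pmap_relM; first exact: rf_substC.
rewrite mpolyXE_id !rmorph_prod; apply: (big_ind2 (rf_subst h)).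
- exact: pmap_rel1.
- by move=> *; apply: pmap_relM.
- by move=> i _; rewrite !rmorphXn !rf_evalX; apply: pmap_relX; apply: fg.
Qed.

Lemma rf_eval_step h (g : 'I_n -> F) p : (forall i, rf_subst h (h i) (g i)) ->
  rf_eval h p = 0 -> rf_eval g p = 0.
Proof.
move=> hg hp; have := rf_subst_eval p hg; rewrite hp => H.
exact: (pmap_rel_uniq tofrac_inj H (pmap_rel0 _ _)).
Qed.

Lemma rf_extend h : (forall p, rf_eval h p = 0 -> p = 0) ->
  exists s : {rmorphism F -> F}, forall f g, rf_subst h f g -> s f = g.
Proof.
move=> inj.
apply: (pmap_rel_total tofrac_inj (E := fun f =>
  rf_eval h \n_(repr f) / rf_eval h \d_(repr f))) => f.
exists \n_(repr f), \d_(repr f); split=> //; last exact: frac_repr.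
by apply/eqP=> /inj/eqP; apply/negP; apply: denom_ratioP.
Qed.

Lemma rf_bijective (s : {rmorphism F -> F}) :
    (forall k, s (C k) = C k) -> (forall i, s (s (s (s (X i)))) = X i) ->
  bijective s.
Proof.
move=> sC sX.
have s4 f : s (s (s (s f))) = f.
  rewrite -[RHS]/([the {rmorphism F -> F} of idfun] f).
  apply: (@rmorph_ratfun_eq [the {rmorphism F -> F} of s \o (s \o (s \o s))]).
    by move=> k; rewrite /= !sC.
  by move=> i; rewrite /= !sX.
by exists (s \o (s \o s)) => f; rewrite /= s4.
Qed.

Lemma rf_substE (t : {rmorphism F -> F}) h f f' :
    (forall k, t (C k) = C k) -> (forall i, t (X i) = h i) ->
  rf_subst h f f' -> t f = f'.
Proof.
move=> tC tX.
have tE p : t (tofrac p) = rf_eval h p.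
  elim/mpolyind: p => [|k m p _ _ IH]; first by rewrite !rmorph0.
  rewrite -mul_mpolyC mpolyXE_id !rmorphD !rmorphM !rmorph_prod IH rf_evalC.
  congr (_ * _ + _); first exact: tC.
  by apply: eq_bigr => i _; rewrite !rmorphXn rf_evalX; congr (_ ^+ _); apply: tX.
exact: (pmap_relE tE).
Qed.

(* Substitutions h of order dividing 4, with square g.                       *)
Lemma rf_aut4 h (g : 'I_n -> F) :
    (forall i, rf_subst h (h i) (g i)) -> (forall i, rf_subst g (g i) (X i)) ->
  exists s : {rmorphism F -> F}, is_aut_over C s /\ forall i, s (X i) = h i.
Proof.
move=> hg gX.
have inj p : rf_eval h p = 0 -> p = 0.
  move=> /(rf_eval_step hg)/(rf_eval_step gX)/eqP.
  by rewrite rf_eval_id tofrac_eq0 => /eqP.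
have [s sE] := rf_extend inj.
have sC k : s (C k) = C k by apply: sE; apply: rf_substC.
have sX i : s (X i) = h i by apply: sE; apply: rf_substX.
exists s; split=> //; split=> //; apply: rf_bijective => // i.
rewrite sX (sE _ _ (hg i)).
apply: (@rf_substE [the {rmorphism F -> F} of s \o s] _ _ _ _ _ (gX i)).
  by move=> k; rewrite /= !sC.
by move=> j; rewrite /= sX (sE _ _ (hg j)).
Qed.

End Substitution.

(* The automorphisms assumed by sigma1_spec, sigma2_spec and tau_spec exist. *)
Section Existence.

Variables (K : fieldType) (a c : K).
Hypotheses (a0 : a != 0) (c0 : c != 0).
Local Notation F := (ratfun K 3).
Local Notation C := (rfC K 3).

Let i1 : 'I_3 := @Ordinal 3 0 isT.
Let i2 : 'I_3 := @Ordinal 3 1 isT.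
Let i3 : 'I_3 := @Ordinal 3 2 isT.

Definition rf_fun3 (u v w : F) (i : 'I_3) : F := nth 0 [:: u; v; w] i.

Lemma forall_ord3 (Q : 'I_3 -> Prop) : Q i1 -> Q i2 -> Q i3 -> forall i, Q i.
Proof.
move=> Q1 Q2 Q3 [[|[|[|//]]] lti].
- by rewrite (_ : Ordinal lti = i1) //; apply: val_inj.
- by rewrite (_ : Ordinal lti = i2) //; apply: val_inj.
- by rewrite (_ : Ordinal lti = i3) //; apply: val_inj.
Qed.

Lemma rfX_neq0 (i : 'I_3) : rfX K i != 0.
Proof. by rewrite tofrac_eq0 -msize_poly_eq0 msizeX. Qed.

Lemma rfC_neq0 k : k != 0 -> C k != 0. Proof. by rewrite fmorph_eq0. Qed.

Lemma sigma1_exists : exists s, sigma1_spec a c s.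
Proof.
pose h := rf_fun3 (C a / x2 K) (x1 K) (C c / x3 K).
pose g := rf_fun3 (C a / x1 K) (C a / x2 K) (x3 K).
have [Ca Cc] := (rfC_neq0 a0, rfC_neq0 c0).
have hg : forall i, rf_subst h (h i) (g i).
  apply: forall_ord3.
  - by apply: pmap_rel_div; [exact: (rfX_neq0 i1) | exact: rf_substC
      | exact: (rf_substX h i2)].
  - exact: (rf_substX h i1).
  - by apply: (pmap_rel_divdiv Cc (rfX_neq0 i3)); [exact: rf_substC
      | exact: (rf_substX h i3)].
have gX : forall i, rf_subst g (g i) (rfX K i).
  apply: forall_ord3.
  - by apply: (pmap_rel_divdiv Ca (rfX_neq0 i1)); [exact: rf_substC
      | exact: (rf_substX g i1)].
  - by apply: (pmap_rel_divdiv Ca (rfX_neq0 i2)); [exact: rf_substC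
      | exact: (rf_substX g i2)].
  - exact: (rf_substX g i3).
have [s [sK sX]] := rf_aut4 hg gX.
by exists s; split=> //; [exact: (sX i1) | exact: (sX i2) | exact: (sX i3)].
Qed.

Lemma sigma2_exists e1 e2 : e1 ^+ 2 = 1 -> e2 ^+ 2 = 1 ->
  exists s, sigma2_spec c e1 e2 s.
Proof.
move=> e1sq e2sq.
pose h := rf_fun3 (C e1 * x1 K) (C e1 * x2 K) (C (e2 * c) / x3 K).
have e20 : e2 != 0.
  by apply/eqP=> e; move: e2sq; rewrite e expr0n => /esym/eqP; rewrite oner_eq0.
have Cd : C (e2 * c) != 0 by rewrite rfC_neq0 // mulf_neq0.
have Ce f : f = C e1 * (C e1 * f).
  by rewrite mulrA -rmorphM -expr2 e1sq rmorph1 mul1r.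
have hX : forall i, rf_subst h (h i) (rfX K i).
  apply: forall_ord3.
  - rewrite (Ce (rfX K i1)).
    by apply: pmap_relM; [exact: rf_substC | exact: (rf_substX h i1)].
  - rewrite (Ce (rfX K i2)).
    by apply: pmap_relM; [exact: rf_substC | exact: (rf_substX h i2)].
  - by apply: (pmap_rel_divdiv Cd (rfX_neq0 i3)); [exact: rf_substC
      | exact: (rf_substX h i3)].
have [s [sK sX]] := rf_aut4 hX (fun i => rf_substX _ i).
by exists s; split=> //; [exact: (sX i1) | exact: (sX i2) | exact: (sX i3)].
Qed.

Lemma tau_exists : exists s, tau_spec a c s.
Proof.
pose d := C a * x1 K ^+ 2 - C c.
pose h := rf_fun3 (- x1 K) (C a / x2 K) (d / x3 K).
have Ca := rfC_neq0 a0.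
have d0 : d != 0.
  rewrite subr_eq0; apply/eqP=> e.
  have : C a * x1 K ^+ 2 = FracField.tofrac (a%:MP * 'X_i1 ^+ 2).
    by rewrite rmorphM rmorphXn.
  rewrite e => /tofrac_inj /(congr1 (mcoeff 0%MM)).
  rewrite mcoeffC eqxx mulr1 mcoeffCM mpolyXn mcoeffX.
  case: eqP => [/(congr1 (fun m : 'X_{1..3} => m i1))|_].
    by rewrite mulmnE mnmE eqxx mnm0E.
  by rewrite mulr0 => /eqP; apply/negP.
have hd : rf_subst h d d.
  rewrite {2}/d -sqrrN; apply: (pmap_relD (@tofrac_inj K 3)); last first.
    by apply: pmap_relN; apply: rf_substC.
  apply: pmap_relM; first exact: rf_substC.
  by apply: pmap_relX; apply: (rf_substX h i1).
have hX : forall i, rf_subst h (h i) (rfX K i).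
  apply: forall_ord3.
  - by rewrite -[rfX K i1]opprK; apply: pmap_relN; exact: (rf_substX h i1).
  - by apply: (pmap_rel_divdiv Ca (rfX_neq0 i2)); [exact: rf_substC
      | exact: (rf_substX h i2)].
  - by apply: (pmap_rel_divdiv d0 (rfX_neq0 i3)); [exact: hd
      | exact: (rf_substX h i3)].
have [s [sK sX]] := rf_aut4 hX (fun i => rf_substX _ i).
by exists s; split=> //; [exact: (sX i1) | exact: (sX i2) | exact: (sX i3)].
Qed.

End Existence.

(* Main.v *)
(** Over K(x1^2) the fixed field of tau is the function field of a product of two
    conics, which makes it the function field of the threefold
      W^2 + c v^2 = (u^2 - a) (z^2 + a),
    and for e1 = e2 = -1 the fixed field of G has the same presentation.  When one of
    -1, a, -a, ac, -ac, -c is a square, the threefold is parametrised explicitly.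

    Otherwise adjoin a square root of c, so that -1, a, -a remain non-squares and the
    left-hand side becomes a sum of two squares.  In a rational function field a prime
    dividing both u^2 - a and z^2 + a has a square root of -1 in its residue field, so
    u^2 - a is a constant times a sum of two squares (the quaternion algebra
    (u^2 - a, -1) is unramified, hence constant).  On the other hand
    u^2 - a = (x1 v)^2 with x1 v anti-invariant under tau, so -1 would be a norm for
    tau; comparing divisors in x3 and in x2 this gives
      -1 = (a x1^2 - c)^j a^m h(x1) h(-x1),
    which is contradicted by the values at x1 = 0 and at infinity. *)

(* The constant in u^2 - a = lam (A^2 + B^2) has to be controlled, and [L = K(x1, x2, x3)] is what
   makes this possible. There u^2 - a is the square of D = x1 v, so lam = D^2 / (A^2 + B^2) is a sum
   of two squares in L, and then in K by setting the variables to 0 one at a time, which is allowed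
   because -1 is not a square. Composition of sums of two squares gives D^2 = P^2 + Q^2 with P and Q
   fixed by tau, and (D - P) / Q has norm -1. The six classes come from the adjunction of sqrt c: an
   element of K becomes a square in K(sqrt c) exactly when it is a square or c times a square in K.
   So -1, a, -a stay non-squares exactly when none of -1, a, -a, -c, ac, -ac is a square of K.
   Rationality provides an arbitrary set of generators. The induction that proves u^2 - a unramified
   adjoins one variable at a time, so a finite independent sublist whose field contains u, z, v, W
   is extracted first. *)
Require Import Defs.
From HB Require Import structures.
From mathcomp Require Import all_boot all_order all_algebra all_field generic_quotient.
From mathcomp.multinomials Require Import mpoly.
From mathcomp Require Import ring.
From Stdlib Require Import ClassicalEpsilon.

Set Implicit Arguments.
Unset Strict Implicit.
Unset Printing Implicit Defensive.

Import GRing.Theory.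
Local Open Scope ring_scope.

(** * Subfields given by predicates *)

Section SubfieldClosure.

Variables (L : fieldType) (M : L -> Prop).
Hypothesis M_sf : is_subfield M.

Lemma sf1 : M 1. Proof. by case: M_sf. Qed.
Lemma sfB x y : M x -> M y -> M (x - y). Proof. by case: M_sf => _ /(_ x y). Qed.
Lemma sf_div x y : M x -> M y -> M (x / y).
Proof. by case: M_sf => _ _ /(_ x y). Qed.
Lemma sf0 : M 0. Proof. by rewrite -(subrr 1); apply: sfB sf1 sf1. Qed.
Lemma sfN x : M x -> M (- x). Proof. by rewrite -sub0r; apply: sfB sf0. Qed.
Lemma sfD x y : M x -> M y -> M (x + y).
Proof. by move=> Mx My; rewrite -[y]opprK; apply/sfB/sfN. Qed.
Lemma sfV x : M x -> M x^-1. Proof. by rewrite -div1r; apply: sf_div sf1. Qed.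
Lemma sfM x y : M x -> M y -> M (x * y).
Proof. by move=> Mx My; rewrite -[y]invrK; apply/sf_div/sfV. Qed.
Lemma sfX x n : M x -> M (x ^+ n).
Proof.
move=> Mx; elim: n => [|n IH]; first by rewrite expr0; apply: sf1.
by rewrite exprS; apply: sfM.
Qed.
Lemma sfMn x n : M x -> M (x *+ n).
Proof.
move=> Mx; elim: n => [|n IH]; first by rewrite mulr0n; apply: sf0.
by rewrite mulrS; apply: sfD.
Qed.

End SubfieldClosure.

Ltac sf_step H :=
  lazymatch goal with
  | |- _ (_ + _) => apply: (sfD H)
  | |- _ (- _) => apply: (sfN H)
  | |- _ (_ * _) => apply: (sfM H)
  | |- _ (_^-1) => apply: (sfV H)
  | |- _ (_ ^+ _) => apply: (sfX H)
  | |- _ (_ *+ _) => apply: (sfMn H)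
  | |- _ 0 => exact: (sf0 H)
  | |- _ 1 => exact: (sf1 H)
  end.

Ltac sf_tac H := repeat (first [assumption | sf_step H]).

Section SubfieldType.

Variables (L : fieldType) (M : L -> Prop).

(** Excluded middle turns the [Prop] predicate into a boolean one, so that the subtype constructions
    can make a subfield into a [fieldType]. *)
Definition sf_pred : {pred L} :=
  fun x => if excluded_middle_informative (M x) then true else false.

Lemma sf_predP x : reflect (M x) (x \in sf_pred).
Proof.
by rewrite unfold_in; case: excluded_middle_informative; constructor.
Qed.

Hypothesis M_sf : is_subfield M.

Lemma sf_pred_divring : divring_closed sf_pred.
Proof.
split; first by apply/sf_predP; apply: sf1.
  by move=> x y /sf_predP Mx /sf_predP My; apply/sf_predP; apply: sfB.
by move=> x y /sf_predP Mx /sf_predP My; apply/sf_predP; apply: sf_div.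
Qed.

HB.instance Definition _ :=
  GRing.isDivringClosed.Build L sf_pred sf_pred_divring.

(** The proof [H] is a parameter of the type because the field instances attached to it depend on
    that proof. *)
Record sf_type (H : is_subfield M) :=
  SfType { sf_val : L; _ : sf_val \in sf_pred }.

HB.instance Definition _ := [isSub for @sf_val M_sf].
HB.instance Definition _ := [Choice of sf_type M_sf by <:].
HB.instance Definition _ := [SubChoice_isSubComUnitRing of sf_type M_sf by <:].
HB.instance Definition _ := [SubComUnitRing_isSubIntegralDomain of sf_type M_sf by <:].
HB.instance Definition _ := [SubIntegralDomain_isSubField of sf_type M_sf by <:].

End SubfieldType.

(** Presents a subfield as the image of an abstract field, over which gcds, coprimality and sizes of
    polynomials are available. *)
Definition image_of (F L : fieldType) (e : {rmorphism F -> L}) (M : L -> Prop) :=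
  forall x, M x <-> exists y, x = e y.

Lemma subfield_type (L : fieldType) (M : L -> Prop) : is_subfield M ->
  exists (F : fieldType) (e : {rmorphism F -> L}), image_of e M.
Proof.
move=> M_sf.
exists (sf_type M_sf), [the {rmorphism sf_type M_sf -> L} of (val : sf_type M_sf -> L)].
move=> x; split=> [/sf_predP Mx|[y ->]]; first by exists (SfType M_sf Mx).
by case: y => y /= /sf_predP.
Qed.

Section SubfieldPoly.

Variables (L F : fieldType) (e : {rmorphism F -> L}) (M : L -> Prop).
Hypothesis eM : image_of e M.

Lemma sf_poly_ex (p : {poly L}) : (forall i, M p`_i) ->
  exists q, p = map_poly e q.
Proof.
elim/poly_ind: p => [|p c IH] Mp; first by exists 0; rewrite rmorph0.
have [|q ->] := IH.
  by move=> i; have := Mp i.+1; rewrite coefD coefMX coefC addr0.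
have [|d ->] := (eM c).1.
  by have := Mp 0%N; rewrite coefD coefMX coefC add0r.
by exists (q * 'X + d%:P); rewrite rmorphD rmorphM /= map_polyX map_polyC.
Qed.

End SubfieldPoly.

Section FractionImage.

Variables (R : comNzRingType) (L : fieldType) (e : {rmorphism R -> L}).

Definition frac_img (y : L) := exists p q, e q != 0 /\ y = e p / e q.

Lemma frac_img_sf : is_subfield frac_img.
Proof.
split; first by exists 1, 1; rewrite rmorph1 divr1 oner_eq0.
  move=> _ _ [p [q [q0 ->]]] [r [s [s0 ->]]].
  exists (p * s - r * q), (q * s); rewrite !rmorphB !rmorphM mulf_neq0 //.
  by split=> //; field; rewrite q0 s0.
move=> _ _ [p [q [q0 ->]]] [r [s [s0 ->]]].
have [er0|er0] := eqVneq (e r) 0.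
  by exists 0, 1; rewrite er0 mul0r invr0 mulr0 rmorph1 rmorph0 mul0r oner_eq0.
exists (p * s), (q * r); rewrite !rmorphM mulf_neq0 //; split=> //.
by rewrite invf_div mulf_div.
Qed.

Lemma frac_img_im p : frac_img (e p).
Proof. by exists p, 1; rewrite rmorph1 divr1 oner_eq0. Qed.

Lemma clear_denominators (p : {poly L}) : (forall i, frac_img p`_i) ->
  exists D (Q : {poly R}), e D != 0 /\ map_poly e Q = e D *: p.
Proof.
elim/poly_ind: p => [|p c IH] Mp.
  by exists 1, 0; rewrite rmorph1 rmorph0 oner_eq0 scaler0.
have [|D [Q [D0 QE]]] := IH.
  by move=> i; have := Mp i.+1; rewrite coefD coefMX coefC addr0.
have [u [v [v0 cE]]] : frac_img c.
  by have := Mp 0%N; rewrite coefD coefMX coefC add0r.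
exists (D * v), (v%:P * Q * 'X + (D * u)%:P); split.
  by rewrite rmorphM mulf_neq0.
rewrite rmorphD !rmorphM /= map_polyX !map_polyC /= QE cE !rmorphM.
rewrite scalerDr -!mul_polyC !polyCM; congr (_ + _); first by ring.
by rewrite -!polyCM; congr (_%:P); field.
Qed.

End FractionImage.

Definition poly_ev (R L : comNzRingType) (e : {rmorphism R -> L})
    (x : L) : {rmorphism {poly R} -> L} :=
  [the {rmorphism {poly R} -> L} of
    horner_morph (fun r : R => mulrC x (e r) : GRing.comm x (e r))].

Arguments poly_ev {R L} e x : simpl never.

Lemma poly_evE (R L : comNzRingType) (e : {rmorphism R -> L}) x p :
  poly_ev e x p = (map_poly e p).[x].
Proof. by []. Qed.

Lemma poly_evC (R L : comNzRingType) (e : {rmorphism R -> L}) x r :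
  poly_ev e x r%:P = e r.
Proof. by rewrite poly_evE map_polyC hornerC. Qed.

Lemma poly_evX (R L : comNzRingType) (e : {rmorphism R -> L}) x :
  poly_ev e x 'X = x.
Proof. by rewrite poly_evE map_polyX hornerX. Qed.

(** * Algebraic elements over a subfield *)

Section Algebraic.

Variable L : fieldType.
Implicit Types (M N : L -> Prop) (x y : L).

Definition alg_over M x :=
  exists p : {poly L}, [/\ p != 0, forall i, M p`_i & root p x].

Lemma alg_overP (F : fieldType) (e : {rmorphism F -> L}) M x :
    image_of e M ->
  alg_over M x <-> integralOver e x.
Proof.
move=> eM; split=> [[p [p0 Mp px]]|/integral_algebraic [p p0 px]].
  have [q pE] := sf_poly_ex eM Mp; apply/integral_algebraic.
  by exists q; rewrite -?pE //; apply: contraNneq p0; rewrite pE => ->; rewrite rmorph0.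
exists (map_poly e p); split=> //; first by rewrite map_poly_eq0.
by move=> i; rewrite coef_map; apply/eM; exists p`_i.
Qed.

Lemma alg_over_sub M N x : (forall y, M y -> N y) -> alg_over M x -> alg_over N x.
Proof. by move=> MN [p [p0 Mp px]]; exists p; split=> // i; apply: MN. Qed.

Lemma alg_over_in M x : is_subfield M -> M x -> alg_over M x.
Proof.
move=> /subfield_type[F [e eM]] /eM[y ->]; apply/(alg_overP _ eM).
exact: integral_id.
Qed.

Lemma alg_over_sf M : is_subfield M -> is_subfield (alg_over M).
Proof.
move=> M_sf; have [F [e eM]] := subfield_type M_sf.
split; first by apply: alg_over_in (sf1 M_sf).
  by move=> x y /(alg_overP _ eM) Mx /(alg_overP _ eM) My;
     apply/(alg_overP _ eM)/integral_sub.
by move=> x y /(alg_overP _ eM) Mx /(alg_overP _ eM) My;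
   apply/(alg_overP _ eM)/integral_div.
Qed.

Lemma alg_over_idem M x : is_subfield M ->
  alg_over (alg_over M) x -> alg_over M x.
Proof.
move=> /subfield_type[F [e eM]] [p [p0 Mp px]]; apply/(alg_overP _ eM).
apply: integral_root p0 px _ => _ /(nthP 0)[i _ <-].
exact/(alg_overP _ eM).
Qed.

(** All the field towers below are towers of square roots, so this is the one algebraicity criterion
    that they need. *)
Lemma alg_over_sqrt M x : is_subfield M -> alg_over M (x ^+ 2) -> alg_over M x.
Proof.
move=> M_sf Mx2; apply: (alg_over_idem M_sf).
exists ('X^2 - (x ^+ 2)%:P); split.
- by rewrite -size_poly_gt0 size_XnsubC.
- have A_sf := alg_over_sf M_sf.
  by move=> i; rewrite coefB coefXn coefC; case: eqP => _; case: eqP => _; sf_tac A_sf.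
- by rewrite rootE !hornerE subrr.
Qed.

Lemma transc_poly_ev (F : fieldType) (e : {rmorphism F -> L}) M x p :
    image_of e M ->
  ~ alg_over M x -> poly_ev e x p = 0 -> p = 0.
Proof.
move=> eM ntr px; apply/eqP/negPn/negP=> p0; apply: ntr.
apply/(alg_overP _ eM)/integral_algebraic.
by exists p => //; rewrite rootE -poly_evE px.
Qed.

End Algebraic.

(** * Transcendence bases: the exchange property *)

Section Exchange.

Variables (K L : fieldType) (iota : {rmorphism K -> L}).
Implicit Types (B : L -> Prop) (s : seq L).

Lemma adjoin_sf B : is_subfield (adjoin iota B).
Proof.
split; first by move=> M M_sf *; apply: sf1.
  by move=> x y Bx By M M_sf MK MB; apply: sfB => //; [apply: Bx | apply: By].
by move=> x y Bx By M M_sf MK MB; apply: sf_div => //; [apply: Bx | apply: By].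
Qed.

Lemma adjoinC B k : adjoin iota B (iota k). Proof. by move=> M _ MK _. Qed.

Lemma adjoin_in B b : B b -> adjoin iota B b.
Proof. by move=> Bb M _ _ MB; apply: MB. Qed.

Lemma adjoin_trans B B' x : (forall b, B b -> adjoin iota B' b) ->
  adjoin iota B x -> adjoin iota B' x.
Proof. by move=> BB'; apply=> //; [exact: adjoin_sf | exact: adjoinC]. Qed.

Definition adj s := adjoin iota (fun z => z \in s).
(** This is the closure operator of the algebraic matroid of L over K. [acl_trans] and
    [acl_exchange] are its axioms, and statements on transcendence degree are derived from them. *)
Definition acl s := alg_over (adj s).

Lemma adj_sf s : is_subfield (adj s). Proof. exact: adjoin_sf. Qed.
Lemma acl_sf s : is_subfield (acl s). Proof. exact: alg_over_sf (adj_sf s). Qed.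
Lemma acl_adj s x : adj s x -> acl s x. Proof. exact: alg_over_in (adj_sf s). Qed.
Lemma adjC s k : adj s (iota k). Proof. exact: adjoinC. Qed.
Lemma aclC s k : acl s (iota k). Proof. by apply: acl_adj; apply: adjC. Qed.
Lemma adj_mem s x : x \in s -> adj s x. Proof. exact: adjoin_in. Qed.
Lemma acl_mem s x : x \in s -> acl s x. Proof. by move=> /adj_mem/acl_adj. Qed.
Lemma acl_sqrt s x : acl s (x ^+ 2) -> acl s x.
Proof. exact: alg_over_sqrt (adj_sf s). Qed.

Lemma adj_trans s t x : {in s, forall z, adj t z} -> adj s x -> adj t x.
Proof. exact: adjoin_trans. Qed.

Lemma acl_trans s t x : {in s, forall z, acl t z} -> acl s x -> acl t x.
Proof.
move=> st sx; apply: (alg_over_idem (adj_sf t)); apply: alg_over_sub sx => y.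
by apply=> //; [exact: acl_sf | exact: aclC].
Qed.

Section AdjoinOne.

Variables (F : fieldType) (e : {rmorphism F -> L}) (s : seq L).
Hypothesis eM : image_of e (adj s).

Lemma adj_cons_frac x y : adj (x :: s) y -> frac_img (poly_ev e x) y.
Proof.
apply; first exact: frac_img_sf.
  move=> k; have /eM[z ->] : adj s (iota k) by apply: adjC.
  by rewrite -(poly_evC _ x); apply: frac_img_im.
move=> b; rewrite inE => /orP[/eqP->|/adj_mem/eM[z ->]].
  by rewrite -[in X in frac_img _ X](poly_evX e x); apply: frac_img_im.
by rewrite -(poly_evC _ x); apply: frac_img_im.
Qed.

Lemma adj_poly_ev x p : adj (x :: s) (poly_ev e x p).
Proof.
rewrite poly_evE horner_coef; apply: (big_ind (adj (x :: s))).
- exact: sf0 (adj_sf _).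
- by move=> *; apply: (sfD (adj_sf _)).
move=> i _; apply: (sfM (adj_sf _)); last first.
  by apply: (sfX (adj_sf _)); apply: adj_mem; rewrite mem_head.
rewrite coef_map; apply: (adj_trans (s := s)); last by apply/eM; exists p`_i.
by move=> z zs; apply: adj_mem; rewrite inE zs orbT.
Qed.

End AdjoinOne.

Lemma poly_ev_swapXY (R : comNzRingType) (e : {rmorphism R -> L}) q u v :
  (map_poly (poly_ev e u) q).[v] = (map_poly (poly_ev e v) (swapXY q)).[u].
Proof.
elim/poly_ind: q => [|q c IH]; first by rewrite !rmorph0 !horner0.
rewrite !rmorphD !rmorphM /= swapXY_X swapXY_polyC !map_polyX !map_polyC.
rewrite !(hornerD, hornerM, hornerX, hornerC) IH /= horner_morphX.
congr (_ * _ + _).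
rewrite -map_poly_comp (eq_map_poly (g := e)) // => z.
by rewrite /= horner_morphC.
Qed.

(** Cleared of denominators, the equation of y is a bivariate polynomial in x and y over K(s), which
    can be read as a polynomial in x with coefficients evaluated at y. These do not all vanish,
    since y is transcendental over K(s). *)
Lemma acl_exchange s x y : acl (x :: s) y -> ~ acl s y -> acl (y :: s) x.
Proof.
move=> [p [p0 Mp py]] ny; have [F [e eM]] := subfield_type (adj_sf s).
have [D [Q [D0 QE]]] := clear_denominators (fun i => adj_cons_frac eM (Mp i)).
pose R := swapXY Q.
have R0 : R != 0.
  rewrite swapXY_eq0; apply: contraTneq p0 => Q0; rewrite negbK.
  by move/esym/eqP: QE; rewrite Q0 rmorph0 scaler_eq0 (negPf D0).
exists (map_poly (poly_ev e y) R); split.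
- apply/eqP=> /polyP RE; have/eqP := R0; apply; apply/polyP => i.
  rewrite coef0; apply: (transc_poly_ev eM ny).
  by have := RE i; rewrite coef_map coef0.
- by move=> i; rewrite coef_map; apply: adj_poly_ev.
- by apply/rootP; rewrite -poly_ev_swapXY QE hornerZ (rootP py) mulr0.
Qed.

End Exchange.

(** * Evaluation morphisms of multivariate polynomials *)

Section MPolyMorphisms.

Variables (K : fieldType) (n : nat).

Lemma mpoly_rmorph_ext (S : comNzRingType) (f g : {rmorphism {mpoly K[n]} -> S}) :
  (forall k, f k%:MP = g k%:MP) -> (forall i, f 'X_i = g 'X_i) -> f =1 g.
Proof.
move=> eqC eqX; elim/mpolyind=> [|k m p _ _ IH]; first by rewrite !rmorph0.
rewrite -mul_mpolyC mpolyXE_id !rmorphD !rmorphM !rmorph_prod IH eqC.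
by congr (_ * _ + _); apply: eq_bigr => i _; rewrite !rmorphXn eqX.
Qed.

Definition mev (S : comNzRingType) (f : {rmorphism K -> S}) (h : 'I_n -> S) :
    {rmorphism {mpoly K[n]} -> S} :=
  [the {rmorphism {mpoly K[n]} -> S} of mmap f h].

Lemma mevE (S : comNzRingType) (f : {rmorphism K -> S}) h p :
  mev f h p = mmap f h p.
Proof. by []. Qed.

Lemma mevC (S : comNzRingType) (f : {rmorphism K -> S}) h k :
  mev f h k%:MP = f k.
Proof. exact: mmapC. Qed.

Lemma mevX (S : comNzRingType) (f : {rmorphism K -> S}) h i :
  mev f h 'X_i = h i.
Proof. by rewrite mevE mmapX mmap1U. Qed.

Lemma eq_mev (S : comNzRingType) (f : {rmorphism K -> S}) h h' p :
  (forall i, h i = h' i) -> mev f h p = mev f h' p.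
Proof.
by move=> hh'; apply: mpoly_rmorph_ext => [k|i]; rewrite ?mevC ?mevX.
Qed.

Lemma mev_rmorph (S S' : comNzRingType) (f : {rmorphism K -> S})
    (g : {rmorphism S -> S'}) (f' : {rmorphism K -> S'}) h p :
    (forall k, g (f k) = f' k) ->
  g (mev f h p) = mev f' (fun i => g (h i)) p.
Proof.
move=> gf; apply: (mpoly_rmorph_ext (f := [the {rmorphism _ -> _} of g \o mev f h])).
  by move=> k /=; rewrite !mmapC gf.
by move=> i /=; rewrite !mmapX !mmap1U.
Qed.

Lemma mev_id p : mev (@mpolyC n K) (fun i => 'X_i) p = p.
Proof.
apply: (mpoly_rmorph_ext (g := [the {rmorphism _ -> _} of idfun])) => [k|i] /=.
  by rewrite mmapC.
by rewrite mmapX mmap1U.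
Qed.

End MPolyMorphisms.

Section Muni.

Variables (K : fieldType) (n : nat).

Let wd := @widen_ord n n.+1 (leqnSn n).

Lemma muniX_widen (i : 'I_n) : muni ('X_(wd i) : {mpoly K[n.+1]}) = ('X_i)%:P.
Proof.
rewrite muniE msuppX big_seq1 mcoeffX eqxx scale1r mnmE.
case: eqP => [/(congr1 val)/= e|_]; first by have := ltn_ord i; rewrite e ltnn.
rewrite expr0 alg_polyC; congr (_%:P); congr 'X_[_]; apply/mnmP=> j.
by rewrite !mnmE.
Qed.

Lemma muniX_max : muni ('X_ord_max : {mpoly K[n.+1]}) = 'X.
Proof.
rewrite muniE msuppX big_seq1 mcoeffX eqxx scale1r mnmE eqxx expr1.
rewrite (_ : [multinom _ | _ < _] = 0%MM) ?mpolyX0 ?scale1r //.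
apply/mnmP=> j; rewrite !mnmE; case: eqP => // /(congr1 val)/= e.
by have := ltn_ord j; rewrite -e ltnn.
Qed.

Lemma ord_wd_max (Q : 'I_n.+1 -> Prop) :
  (forall i, Q (wd i)) -> Q ord_max -> forall i, Q i.
Proof.
move=> Qw Qm i; have [lt_in|ge_in] := ltnP i n.
  by rewrite (_ : i = wd (Ordinal lt_in)) //; apply: val_inj.
rewrite (_ : i = ord_max) //; apply: val_inj; apply/eqP.
by rewrite eqn_leq ge_in -ltnS ltn_ord.
Qed.

Lemma mev_muni (S : comNzRingType) (f : {rmorphism K -> S}) h p :
  mev f h p = poly_ev (mev f (h \o wd)) (h ord_max) (muni p).
Proof.
apply: (mpoly_rmorph_ext (g := [the {rmorphism _ -> _} of
  poly_ev (mev f (h \o wd)) (h ord_max) \o @muni n K])) => [k|].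
  by rewrite mevC -[RHS]/(poly_ev _ _ (muni _)) muniC poly_evC mevC.
apply: ord_wd_max => [i|]; rewrite mevX -[RHS]/(poly_ev _ _ (muni _)).
  by rewrite muniX_widen poly_evC mevX.
by rewrite muniX_max poly_evX.
Qed.

Lemma muni_inj : injective (@muni n K).
Proof.
move=> p q e; rewrite -[p]mev_id -[q]mev_id.
by rewrite (mev_muni _ _ p) (mev_muni _ _ q) e.
Qed.

Lemma muni_surj q : exists p, muni p = q :> {poly {mpoly K[n]}}.
Proof.
have muni_widen (c : {mpoly K[n]}) : muni (mwiden c) = c%:P.
  apply: (mpoly_rmorph_ext (f := [the {rmorphism _ -> _} of @muni n K \o @mwiden n K])
    (g := [the {rmorphism _ -> _} of @polyC {mpoly K[n]}])) => [k|i] /=.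
    by rewrite mwidenC muniC.
  by rewrite mwidenX mnmwiden1 muniX_widen.
elim/poly_ind: q => [|q c [p pE]]; first by exists 0; rewrite muni0.
exists (p * 'X_ord_max + mwiden c).
by rewrite muniD muniM pE muniX_max muni_widen.
Qed.

End Muni.

(** * Algebraic independence of lists, and transcendence degree three *)

Section Independence.

Variables (K L : fieldType) (iota : {rmorphism K -> L}).
Implicit Types s : seq L.

Definition sev n s : {rmorphism {mpoly K[n]} -> L} :=
  mev iota (fun i : 'I_n => nth 0 s i).

(** The length [n] is an argument of its own, equated with [size s] only by hypotheses, because the
    type of [p] depends on it. *)
Definition mindep n s := forall p : {mpoly K[n]}, sev n s p = 0 -> p = 0.

Lemma adj_frac_sev n s y : size s = n -> adj iota s y -> frac_img (sev n s) y.
Proof.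
move=> sz; apply; first exact: frac_img_sf.
  by move=> k; rewrite -[iota k](mevC iota (fun i : 'I_n => nth 0 s i)); apply: frac_img_im.
move=> b /(nthP 0)[i]; rewrite sz => lti <-.
by rewrite -[s`_i](mevX iota (fun i : 'I_n => nth 0 s i) (Ordinal lti)); apply: frac_img_im.
Qed.

Lemma adj_sev n s p : size s = n -> adj iota s (sev n s p).
Proof.
move=> sz; elim/mpolyind: p => [|k m p _ _ IH].
  by rewrite rmorph0; apply: sf0 (adj_sf _ _).
have A_sf := adj_sf iota s.
rewrite rmorphD -mul_mpolyC rmorphM mpolyXE_id rmorph_prod.
apply: (sfD A_sf) => //; apply: (sfM A_sf); first by rewrite mevC; apply: adjC.
apply: (big_ind (adj iota s)); first exact: sf1.
  by move=> *; apply: (sfM A_sf).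
move=> i _; rewrite rmorphXn mevX; apply: (sfX A_sf); apply: adj_mem.
by rewrite mem_nth ?sz.
Qed.

Lemma sev_rcons n s x (p : {mpoly K[n.+1]}) : size s = n ->
  sev n.+1 (rcons s x) p = poly_ev (sev n s) x (muni p).
Proof.
move=> sz; rewrite /sev mev_muni nth_rcons sz ltnn eqxx !poly_evE.
congr (_.[_]); apply: eq_map_poly => q.
by apply: eq_mev => // i /=; rewrite nth_rcons sz ltn_ord.
Qed.

(** Through [muni], a polynomial in n + 1 variables is a polynomial in the last one whose
    coefficients are polynomials in the others; a relation for [rcons s x] is then an algebraic
    equation for x over K(s), up to clearing denominators. *)
Lemma mindep_rconsP n s x : size s = n ->
  mindep n.+1 (rcons s x) <-> mindep n s /\ ~ acl iota s x.
Proof.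
move=> sz; split=> [ind|[ind ntr] p].
  have ind' q : poly_ev (sev n s) x q = 0 -> q = 0.
    have [p <-] := muni_surj q; rewrite -sev_rcons // => /ind ->.
    by rewrite muni0.
  split=> [p p0|[p [p0 Mp px]]].
    have /eqP : p%:P = 0 by apply: ind'; rewrite poly_evC.
    by rewrite polyC_eq0 => /eqP.
  have [D [Q [D0 QE]]] := clear_denominators (fun i => adj_frac_sev sz (Mp i)).
  have Q0 : Q = 0 by apply: ind'; rewrite poly_evE QE hornerZ (rootP px) mulr0.
  move/esym/eqP: QE; rewrite Q0 rmorph0 scaler_eq0 (negPf D0) /=.
  by rewrite (negPf p0).
rewrite sev_rcons // => px; apply: muni_inj; rewrite muni0.
apply/eqP/negPn/negP => q0; apply: ntr.
exists (map_poly (sev n s) (muni p)); split.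
- apply: contra q0 => /eqP/polyP e; apply/eqP/polyP => i.
  by rewrite coef0; apply: ind; have := e i; rewrite coef_map coef0.
- by move=> i; rewrite coef_map; apply: adj_sev.
- by apply/rootP; rewrite -poly_evE.
Qed.

Lemma mindep_nil : mindep 0 [::].
Proof.
move=> p; have -> : p = (p@_0)%:MP.
  apply/mpolyP=> m; rewrite mcoeffC (_ : m = 0%MM) ?eqxx ?mulr1 //.
  by apply/mnmP=> -[].
by rewrite mevC => /eqP; rewrite fmorph_eq0 => /eqP ->; rewrite mpolyC0.
Qed.

Lemma mindep_alg_independent n s : size s = n -> mindep n s ->
  alg_independent iota (fun z => z \in s).
Proof.
move=> sz ind m y y_inj ys p; rewrite -mevE => py.
have lt_ix i : (index (y i) s < n)%N by rewrite -sz index_mem.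
pose sg i := Ordinal (lt_ix i).
have sg_inj : injective sg.
  move=> i j /(congr1 val)/= e; apply: y_inj.
  by rewrite -(nth_index 0 (ys i)) e nth_index.
pose q := mev (@mpolyC n K) (fun i => 'X_(sg i)) p.
have q0 : q = 0.
  apply: ind; rewrite -[RHS]py (mev_rmorph (f' := iota)) => [|k]; last exact: mevC.
  apply: eq_mev => i; rewrite mevX.
  by rewrite nth_index.
(* [g] renames the variables back along the injection [sg], which recovers [p] from [q]; variables
   outside the image of [sg] do not occur in [q], so 0 is a harmless value for them. *)
pose g (j : 'I_n) : {mpoly K[m]} := if [pick i | sg i == j] is Some i then 'X_i else 0.
have : mev (@mpolyC m K) g q = p.
  rewrite (mev_rmorph (f' := @mpolyC m K)) => [|k]; last exact: mevC.
  rewrite -[RHS]mev_id; apply: eq_mev => i; rewrite mevX /g.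
  case: pickP => [j /eqP/sg_inj -> //|/(_ i)]; by rewrite eqxx.
by rewrite q0 rmorph0.
Qed.

Lemma alg_independent_mindep B n s : alg_independent iota B ->
  size s = n -> uniq s -> {in s, forall z, B z} -> mindep n s.
Proof.
move=> ind sz us sB p; rewrite mevE; apply: ind.
  move=> i j /eqP; rewrite nth_uniq ?sz // => /eqP; exact: val_inj.
by move=> i; apply: sB; rewrite mem_nth ?sz.
Qed.

End Independence.

Section RankThree.

Variables (K L : fieldType) (iota : {rmorphism K -> L}) (X1 X2 X3 : L).
Hypothesis indX : mindep iota 3 [:: X1; X2; X3].

Local Notation adj := (adj iota).
Local Notation acl := (acl iota).

Definition acl_full s := [/\ acl s X1, acl s X2 & acl s X3].

Lemma transc_X : [/\ ~ acl [::] X1, ~ acl [:: X1] X2 & ~ acl [:: X1; X2] X3].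
Proof.
have [ind2 n3] := (@mindep_rconsP _ _ iota 2 [:: X1; X2] X3 erefl).1 indX.
have [ind1 n2] := (@mindep_rconsP _ _ iota 1 [:: X1] X2 erefl).1 ind2.
by have [_ n1] := (@mindep_rconsP _ _ iota 0 [::] X1 erefl).1 ind1.
Qed.

Lemma acl_full_trans s t : {in s, forall z, acl t z} -> acl_full s -> acl_full t.
Proof. by move=> st [? ? ?]; split; apply: acl_trans st _. Qed.

Lemma acl2 p q z : acl [:: p; q] z -> acl [:: q; p] z.
Proof.
apply: acl_trans => w; rewrite !inE => /orP[]/eqP->; apply: acl_mem.
  by rewrite !inE eqxx orbT.
by rewrite mem_head.
Qed.

(** Steinitz exchange, done twice: one of p, q is exchanged for X1 and the other for X2, which would
    make X3 algebraic over K(X1, X2). *)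
Lemma acl_full_gt2 p q : ~ acl_full [:: p; q].
Proof.
have [n1 n2 n3] := transc_X => full.
have [r [r2 r3]] : exists r, acl [:: X1; r] X2 /\ acl [:: X1; r] X3.
  have [a1 a2 a3] := full; have [p1|np1] := excluded_middle_informative (acl [:: q] X1).
    have /acl_trans sub : {in [:: p; q], forall z, acl [:: X1; p] z}.
      move=> z; rewrite !inE => /orP[]/eqP->; first by apply: acl_mem; rewrite !inE eqxx orbT.
      apply: acl_trans (acl_exchange p1 n1) => w; rewrite inE => /eqP->.
      by apply: acl_mem; rewrite mem_head.
    by exists p; split; apply: sub.
  have /acl_trans sub : {in [:: p; q], forall z, acl [:: X1; q] z}.
    move=> z; rewrite !inE => /orP[]/eqP->; first exact: acl_exchange a1 np1.
    by apply: acl_mem; rewrite !inE eqxx orbT.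
  by exists q; split; apply: sub.
apply: n3; have r12 := acl_exchange (acl2 r2) n2.
apply: acl_trans r3 => z; rewrite !inE => /orP[]/eqP->; last exact: acl2.
by apply: acl_mem; rewrite mem_head.
Qed.

(** A dependent entry could be dropped, leaving two elements over which everything is algebraic.
    Independence of new generators is obtained in this way throughout: it is enough to recover X1,
    X2, X3 up to square roots. *)
Lemma acl_full_mindep y1 y2 y3 :
  acl_full [:: y1; y2; y3] -> mindep iota 3 [:: y1; y2; y3].
Proof.
move=> full; apply/(@mindep_rconsP _ _ iota 2 [:: y1; y2] y3) => //; split; last first.
  move=> d; apply: (@acl_full_gt2 y1 y2); apply: acl_full_trans full => z.
  by rewrite !inE => /or3P[]/eqP-> //; apply: acl_mem; rewrite !inE eqxx ?orbT.
apply/(@mindep_rconsP _ _ iota 1 [:: y1] y2) => //; split; last first.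
  move=> d; apply: (@acl_full_gt2 y1 y3); apply: acl_full_trans full => z.
  rewrite !inE => /or3P[]/eqP->; try by apply: acl_mem; rewrite !inE eqxx ?orbT.
  apply: acl_trans d => w; rewrite inE => /eqP->; apply: acl_mem.
  by rewrite !inE eqxx.
apply/(@mindep_rconsP _ _ iota 0 [::] y1) => //; split; first exact: mindep_nil.
move=> d; apply: (@acl_full_gt2 y2 y3); apply: acl_full_trans full => z.
rewrite !inE => /or3P[]/eqP->; try by apply: acl_mem; rewrite !inE eqxx ?orbT.
exact: acl_trans d.
Qed.

Lemma acl_full_transc y1 y2 y3 : acl_full [:: y1; y2; y3] -> ~ acl [:: y1; y2] y3.
Proof.
move=> /acl_full_mindep ind.
by have [] := (@mindep_rconsP _ _ iota 2 [:: y1; y2] y3 erefl).1 ind.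
Qed.

Lemma acl_full_purely (M : L -> Prop) y1 y2 y3 :
    acl_full [:: y1; y2; y3] -> (forall x, M x <-> adj [:: y1; y2; y3] x) ->
  purely_transcendental iota M.
Proof.
move=> full ME; exists (fun z => z \in [:: y1; y2; y3]); split=> //.
exact: mindep_alg_independent (acl_full_mindep full).
Qed.

End RankThree.

Lemma adj_sub (K L : fieldType) (iota : {rmorphism K -> L}) s (M : L -> Prop) x :
    is_subfield M -> (forall k, M (iota k)) -> {in s, forall z, M z} ->
  adj iota s x -> M x.
Proof. by move=> M_sf MK Ms; apply. Qed.

Lemma forall_in_seq (L : eqType) (P : L -> Prop) s :
  foldr (fun z Q => P z /\ Q) True s -> {in s, forall z, P z}.
Proof.
elim: s => // z s IH [Pz /IH Ps] w; rewrite inE => /orP[/eqP->//|]; exact: Ps.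
Qed.

(** A certificate for consequences of one relation: with the cofactor [k] given, [ring] or [field]
    checks what remains. *)
Lemma lin_eq (R : pzRingType) (k P Q X Y : R) :
  P = Q -> X - Y = k * (P - Q) -> X = Y.
Proof. by move=> -> /eqP; rewrite subrr mulr0 subr_eq0 => /eqP. Qed.

Lemma adj3 (K L : fieldType) (iota : {rmorphism K -> L}) (y1 y2 y3 : L) :
  [/\ adj iota [:: y1; y2; y3] y1, adj iota [:: y1; y2; y3] y2
    & adj iota [:: y1; y2; y3] y3].
Proof. by split; apply: adj_mem; rewrite !inE eqxx ?orbT. Qed.

Ltac adj_tac H := repeat (first [assumption | exact: adjC | sf_step H]).

(* [quad N d] is the subfield N(d), when d ^+ 2 lies in N. *)
Section Quadratic.

Variables (L : fieldType) (N : L -> Prop) (d : L).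
Hypotheses (N_sf : is_subfield N) (Nd2 : N (d ^+ 2)).

Definition quad x := exists p q, [/\ N p, N q & x = p + q * d].

Lemma quad_in x : N x -> quad x.
Proof. by move=> Nx; exists x, 0; split=> //; [exact: sf0 | rewrite mul0r addr0]. Qed.

Lemma quad_root : quad d.
Proof. by exists 0, 1; split; [exact: sf0 | exact: sf1 | rewrite mul1r add0r]. Qed.

Lemma quad_sf : is_subfield quad.
Proof.
have quadB x y : quad x -> quad y -> quad (x - y).
  move=> [p [q [Np Nq ->]]] [r [s [Nr Ns ->]]].
  by exists (p - r), (q - s); split; [exact: sfB | exact: sfB | ring].
have quadM x y : quad x -> quad y -> quad (x * y).
  move=> [p [q [Np Nq ->]]] [r [s [Nr Ns ->]]].
  by exists (p * r + q * s * d ^+ 2), (p * s + q * r); split; [sf_tac N_sf.. | ring].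
have quadV x : quad x -> quad x^-1.
  (* The element d may already lie in N, so the norm of x can vanish; then x = 0 or q d = p, and x
     is in N. *)
  move=> [p [q [Np Nq ->]]]; have [n0|n0] := eqVneq (p ^+ 2 - q ^+ 2 * d ^+ 2) 0.
    apply: quad_in; apply: (sfV N_sf).
    have /eqP : (p + q * d) * (p - q * d) = 0 by rewrite -n0; ring.
    rewrite mulf_eq0 => /orP[/eqP->|]; first exact: sf0.
    by rewrite subr_eq0 => /eqP <-; apply: sfD.
  exists (p / (p ^+ 2 - q ^+ 2 * d ^+ 2)), (- q / (p ^+ 2 - q ^+ 2 * d ^+ 2)).
  split; [sf_tac N_sf.. | ].
  have nE : p ^+ 2 - q ^+ 2 * d ^+ 2 = (p + q * d) * (p - q * d) by ring.
  move: n0; rewrite nE mulf_eq0 negb_or => /andP[n1 n2].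
  by field; rewrite n1 n2.
split=> //; first by apply: quad_in; apply: sf1.
by move=> x y qx qy; apply: quadM => //; apply: quadV.
Qed.

(** Invariance of p + q d under d -> -d says 2 q d = 0. All fixed fields below are computed by steps
    of this form, in place of a count of degrees. *)
Lemma quad_fixed (s : {rmorphism L -> L}) x : (2%:R : L) != 0 -> d != 0 ->
  (forall y, N y -> s y = y) -> s d = - d -> quad x -> s x = x -> N x.
Proof.
move=> n2 d0 sN sd [p [q [Np Nq ->]]].
rewrite rmorphD rmorphM (sN p) // (sN q) // sd => e.
have /eqP : 2%:R * q * d = (p + q * d) - (p + q * - d) by ring.
by rewrite e subrr !mulf_eq0 (negPf n2) (negPf d0) orbF /= => /eqP->; rewrite mul0r addr0.
Qed.

End Quadratic.

(** * Rational cases of the threefold W^2 + c v^2 = (u^2 - a)(z^2 + a) *)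

Section Threefold.

Variables (K L : fieldType) (iota : {rmorphism K -> L}) (X1 X2 X3 : L).
Hypothesis indX : mindep iota 3 [:: X1; X2; X3].
Hypothesis two_neq0 : (2%:R : L) != 0.

Local Notation adj := (adj iota).
Local Notation acl := (acl iota).
Local Notation acl_full := (acl_full iota X1 X2 X3).

Variables (a c : K) (u z v W : L).
Hypotheses (a0 : a != 0) (c0 : c != 0).
Hypothesis full : acl_full [:: u; z; v].
Hypothesis relW : W ^+ 2 + iota c * v ^+ 2 =
  (u ^+ 2 - iota a) * (z ^+ 2 + iota a).

Let M := adj [:: u; z; v; W].

Let iota_neq0 k : k != 0 -> iota k != 0. Proof. by rewrite fmorph_eq0. Qed.

Lemma threefold_criterion y1 y2 y3 (A := adj [:: y1; y2; y3]) :
    [/\ M y1, M y2 & M y3] -> [/\ A u, A z, A v & A W] ->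
  purely_transcendental iota M.
Proof.
move=> [M1 M2 M3] [Au Az Av AW]; apply: (acl_full_purely indX (y1 := y1) (y2 := y2) (y3 := y3)).
  apply: acl_full_trans full; apply: forall_in_seq; split; first exact: acl_adj.
  by split; [exact: acl_adj | split; [exact: acl_adj |]].
by move=> x; split; apply: adj_trans; apply: forall_in_seq.
Qed.

Let Mu : M u. Proof. by apply: adj_mem; rewrite !inE eqxx. Qed.
Let Mz : M z. Proof. by apply: adj_mem; rewrite !inE eqxx ?orbT. Qed.
Let Mv : M v. Proof. by apply: adj_mem; rewrite !inE eqxx ?orbT. Qed.
Let MW : M W. Proof. by apply: adj_mem; rewrite !inE eqxx ?orbT. Qed.
Let MC k : M (iota k). Proof. exact: adjC. Qed.
Let M_sf : is_subfield M. Proof. exact: adj_sf. Qed.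

Let v_transc : ~ acl [:: u; z] v. Proof. exact: acl_full_transc full. Qed.

Let z_transc : ~ acl [:: u] z.
Proof.
move=> d; apply: (acl_full_gt2 indX (p := u) (q := v)).
apply: acl_full_trans full; apply: forall_in_seq; split; first by apply: acl_mem; rewrite mem_head.
split; last by split=> //; apply: acl_mem; rewrite !inE eqxx orbT.
by apply: acl_trans d; apply: forall_in_seq; split=> //; apply: acl_mem; rewrite mem_head.
Qed.

Let u_transc : ~ acl [::] u.
Proof.
move=> d; apply: (acl_full_gt2 indX (p := z) (q := v)).
apply: acl_full_trans full; apply: forall_in_seq; split; first by apply: acl_trans d.
by split; [|split=> //]; apply: acl_mem; rewrite !inE eqxx ?orbT.
Qed.

Lemma threefold_u_neq k : u ^+ 2 != iota k.
Proof.
by apply/eqP=> e; apply: u_transc; apply: acl_sqrt; rewrite e; apply: aclC.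
Qed.

Lemma threefold_z_neq k : z ^+ 2 != iota k.
Proof.
by apply/eqP=> e; apply: z_transc; apply: acl_sqrt; rewrite e; apply: aclC.
Qed.

Let ua : u ^+ 2 - iota a != 0.
Proof. by rewrite subr_eq0; apply: threefold_u_neq. Qed.

Let za : z ^+ 2 + iota a != 0.
Proof. by rewrite addr_eq0 -rmorphN; apply: threefold_z_neq. Qed.

(** Here u^2 - a = (u - b)(u + b). Once W and v are divided by u - b, the relation becomes linear in
    u, so u is rational in z and the two quotients. *)
Lemma threefold_sqr_a b : a = b ^+ 2 -> purely_transcendental iota M.
Proof.
move=> ab; have := ua; rewrite ab rmorphXn subr_sqr mulf_eq0 negb_or => /andP[ub ub'].
apply: (@threefold_criterion z (W / (u - iota b)) (v / (u - iota b))).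
  by split; adj_tac M_sf.
have [A1 A2 A3] := adj3 iota z (W / (u - iota b)) (v / (u - iota b)).
have A_sf := adj_sf iota [:: z; W / (u - iota b); v / (u - iota b)].
set A := adj _ in A1 A2 A3 A_sf *.
pose n := (W / (u - iota b)) ^+ 2 + iota c * (v / (u - iota b)) ^+ 2.
have An : A n by rewrite /n; adj_tac A_sf.
have nE : n * (u - iota b) = (u + iota b) * (z ^+ 2 + iota a).
  by apply: (lin_eq (k := (u - iota b)^-1) relW); rewrite /n ab rmorphXn; field.
have dn : n - (z ^+ 2 + iota a) != 0.
  rewrite subr_eq0; apply: contraTneq (iota_neq0 a0) => e.
  have/eqP : (z ^+ 2 + iota a) * (2%:R * iota b) = 0.
    by apply: (lin_eq (k := -1) nE); rewrite e; ring.
  rewrite !mulf_eq0 (negPf za) (negPf two_neq0) /= ab => /eqP.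
  by rewrite rmorphXn => ->; rewrite expr0n eqxx.
have uE : u = iota b * (z ^+ 2 + iota a + n) / (n - (z ^+ 2 + iota a)).
  by apply: (lin_eq (k := (n - (z ^+ 2 + iota a))^-1) nE); field.
have Au : A u by rewrite uE; adj_tac A_sf.
by split=> //; [rewrite -[v](divfK ub) | rewrite -[W](divfK ub)]; adj_tac A_sf.
Qed.

(** The roles of u and z are exchanged: now z^2 + a = (z - b)(z + b), and the relation is made
    linear in z. *)
Lemma threefold_sqr_Na b : - a = b ^+ 2 -> purely_transcendental iota M.
Proof.
move=> ab; have aE : iota a = - iota b ^+ 2 by rewrite -rmorphXn -ab rmorphN opprK.
have := za; rewrite aE subr_sqr mulf_eq0 negb_or => /andP[zb zb'].
apply: (@threefold_criterion u (W / (z - iota b)) (v / (z - iota b))).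
  by split; adj_tac M_sf.
have [A1 A2 A3] := adj3 iota u (W / (z - iota b)) (v / (z - iota b)).
have A_sf := adj_sf iota [:: u; W / (z - iota b); v / (z - iota b)].
set A := adj _ in A1 A2 A3 A_sf *.
pose n := (W / (z - iota b)) ^+ 2 + iota c * (v / (z - iota b)) ^+ 2.
have An : A n by rewrite /n; adj_tac A_sf.
have nE : n * (z - iota b) = (z + iota b) * (u ^+ 2 - iota a).
  by apply: (lin_eq (k := (z - iota b)^-1) relW); rewrite /n aE; field.
have dn : n - (u ^+ 2 - iota a) != 0.
  rewrite subr_eq0; apply: contraTneq (iota_neq0 a0) => e.
  have/eqP : (u ^+ 2 - iota a) * (2%:R * iota b) = 0.
    by apply: (lin_eq (k := -1) nE); rewrite e; ring.
  rewrite !mulf_eq0 (negPf ua) (negPf two_neq0) /= aE => /eqP ->.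
  by rewrite expr0n oppr0 eqxx.
have zE : z = iota b * (u ^+ 2 - iota a + n) / (n - (u ^+ 2 - iota a)).
  by apply: (lin_eq (k := (n - (u ^+ 2 - iota a))^-1) nE); field.
have Az : A z by rewrite zE; adj_tac A_sf.
by split=> //; [rewrite -[v](divfK zb) | rewrite -[W](divfK zb)]; adj_tac A_sf.
Qed.

(** The left-hand side factors as (W + d v)(W - d v), and one factor determines the other over K(u,
    z). *)
Lemma threefold_sqr_Nc d : - c = d ^+ 2 -> purely_transcendental iota M.
Proof.
move=> cd; have cE : iota c = - iota d ^+ 2 by rewrite -rmorphXn -cd rmorphN opprK.
have d0 : iota d != 0.
  by apply: contraTneq (iota_neq0 c0); rewrite cE => ->; rewrite expr0n oppr0 eqxx.
have rel : (W + iota d * v) * (W - iota d * v) = (u ^+ 2 - iota a) * (z ^+ 2 + iota a).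
  by rewrite -relW cE; ring.
have y0 : W + iota d * v != 0.
  by apply: contraNneq (mulf_neq0 ua za); rewrite -rel => ->; rewrite mul0r.
apply: (@threefold_criterion u z (W + iota d * v)); first by split; adj_tac M_sf.
have [A1 A2 A3] := adj3 iota u z (W + iota d * v).
have A_sf := adj_sf iota [:: u; z; W + iota d * v].
set A := adj _ in A1 A2 A3 A_sf *.
pose y' := (u ^+ 2 - iota a) * (z ^+ 2 + iota a) / (W + iota d * v).
have y'E : y' = W - iota d * v by rewrite /y' -rel mulrC mulKf.
have Ay' : A y' by rewrite /y'; adj_tac A_sf.
split=> //.
  rewrite (_ : v = (W + iota d * v - y') / (2%:R * iota d)); first by adj_tac A_sf.
  by rewrite y'E; field; rewrite two_neq0 d0.
rewrite (_ : W = (W + iota d * v + y') / 2%:R); first by adj_tac A_sf.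
by rewrite y'E; field.
Qed.

(** With V = (e / a) v the left-hand side is W^2 + a V^2, a norm from the extension by sqrt(-a), and
    so is z^2 + a. Dividing W + sqrt(-a) V by z + sqrt(-a) gives W' + sqrt(-a) V' of norm u^2 - a,
    that is (u + W')(u - W') = a (1 + V'^2), which is parametrised by V' and u + W'. *)
Lemma threefold_sqr_ac e : a * c = e ^+ 2 -> purely_transcendental iota M.
Proof.
move=> ace; have a0' := iota_neq0 a0.
have cE : iota c = iota e ^+ 2 / iota a by rewrite -rmorphXn -ace rmorphM mulrAC mulfV ?mul1r.
have e0 : iota e != 0.
  by apply: contraTneq (iota_neq0 c0); rewrite cE => ->; rewrite expr0n mul0r eqxx.
pose V := iota e / iota a * v.
pose W' := (z * W + iota a * V) / (z ^+ 2 + iota a).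
pose V' := (z * V - W) / (z ^+ 2 + iota a).
have WE : W = z * W' - iota a * V' by rewrite /W' /V'; field.
have VE : V = z * V' + W' by rewrite /W' /V'; field.
have rel : (u + W') * (u - W') = iota a * (1 + V' ^+ 2).
  apply: (lin_eq (k := - (z ^+ 2 + iota a)^-1) relW).
  by rewrite cE /W' /V' /V; field; rewrite za a0'.
have vE : v = iota a / iota e * V by rewrite /V; field; rewrite a0' e0.
have MV : M V by rewrite /V; adj_tac M_sf.
have [MW' MV'] : M W' /\ M V' by split; rewrite /W' /V'; adj_tac M_sf.
(* Otherwise V'^2 = -1 and W' = -u, and v would be algebraic over K(u, z). *)
have y0 : u + W' != 0.
  apply/eqP=> y0; apply: v_transc; rewrite vE VE.
  have B_sf := acl_sf iota [:: u; z].
  have Bu : acl [:: u; z] u by apply: acl_mem; rewrite mem_head.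
  have Bz : acl [:: u; z] z by apply: acl_mem; rewrite !inE eqxx orbT.
  have BV' : acl [:: u; z] V'.
    apply: acl_sqrt; rewrite (_ : V' ^+ 2 = - 1); first by sf_tac B_sf.
    move/eqP: rel; rewrite y0 mul0r eq_sym mulf_eq0 (negPf a0') /= addrC addr_eq0.
    by move/eqP.
  have BW' : acl [:: u; z] W' by rewrite -[W'](addKr u) y0 addr0; sf_tac B_sf.
  by have BC k := aclC iota [:: u; z] k; repeat first [exact: BC | assumption | sf_step B_sf].
apply: (@threefold_criterion z V' (u + W')); first by split; adj_tac M_sf.
have [A1 A2 A3] := adj3 iota z V' (u + W').
have A_sf := adj_sf iota [:: z; V'; u + W'].
set A := adj _ in A1 A2 A3 A_sf *.
pose y' := iota a * (1 + V' ^+ 2) / (u + W').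
have y'E : y' = u - W' by rewrite /y' -rel mulrC mulKf.
have Ay' : A y' by rewrite /y'; adj_tac A_sf.
have AW' : A W'.
  rewrite (_ : W' = (u + W' - y') / 2%:R); first by adj_tac A_sf.
  by rewrite y'E; field.
split=> //.
- rewrite (_ : u = (u + W' + y') / 2%:R); first by adj_tac A_sf.
  by rewrite y'E; field.
- by rewrite vE VE; adj_tac A_sf.
- by rewrite WE; adj_tac A_sf.
Qed.

(** Now the left-hand side W^2 - a V^2 and the factor u^2 - a are both norms from the extension by
    sqrt a. Dividing W + sqrt a V by u + sqrt a leaves (W' + z)(W' - z) = a (1 + V'^2). *)
Lemma threefold_sqr_Nac e : - (a * c) = e ^+ 2 -> purely_transcendental iota M.
Proof.
move=> ace; have a0' := iota_neq0 a0.
have cE : iota c = - iota e ^+ 2 / iota a.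
  by rewrite -rmorphXn -ace rmorphN rmorphM opprK mulrAC mulfV ?mul1r.
have e0 : iota e != 0.
  by apply: contraTneq (iota_neq0 c0); rewrite cE => ->; rewrite expr0n oppr0 mul0r eqxx.
pose V := iota e / iota a * v.
pose W' := (u * W - iota a * V) / (u ^+ 2 - iota a).
pose V' := (u * V - W) / (u ^+ 2 - iota a).
have WE : W = u * W' + iota a * V' by rewrite /W' /V'; field.
have VE : V = u * V' + W' by rewrite /W' /V'; field.
have rel : (W' + z) * (W' - z) = iota a * (1 + V' ^+ 2).
  apply: (lin_eq (k := (u ^+ 2 - iota a)^-1) relW).
  by rewrite cE /W' /V' /V; field; rewrite ua a0'.
have vE : v = iota a / iota e * V by rewrite /V; field; rewrite a0' e0.
have MV : M V by rewrite /V; adj_tac M_sf.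
have [MW' MV'] : M W' /\ M V' by split; rewrite /W' /V'; adj_tac M_sf.
have y0 : W' + z != 0.
  apply/eqP=> y0; apply: v_transc; rewrite vE VE.
  have B_sf := acl_sf iota [:: u; z].
  have Bu : acl [:: u; z] u by apply: acl_mem; rewrite mem_head.
  have Bz : acl [:: u; z] z by apply: acl_mem; rewrite !inE eqxx orbT.
  have BV' : acl [:: u; z] V'.
    apply: acl_sqrt; rewrite (_ : V' ^+ 2 = - 1); first by sf_tac B_sf.
    move/eqP: rel; rewrite y0 mul0r eq_sym mulf_eq0 (negPf a0') /= addrC addr_eq0.
    by move/eqP.
  have BW' : acl [:: u; z] W' by rewrite -[W'](addrK z) y0 add0r; sf_tac B_sf.
  by have BC k := aclC iota [:: u; z] k; repeat first [exact: BC | assumption | sf_step B_sf].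
apply: (@threefold_criterion u V' (W' + z)); first by split; adj_tac M_sf.
have [A1 A2 A3] := adj3 iota u V' (W' + z).
have A_sf := adj_sf iota [:: u; V'; W' + z].
set A := adj _ in A1 A2 A3 A_sf *.
pose y' := iota a * (1 + V' ^+ 2) / (W' + z).
have y'E : y' = W' - z by rewrite /y' -rel mulrC mulKf.
have Ay' : A y' by rewrite /y'; adj_tac A_sf.
have AW' : A W'.
  rewrite (_ : W' = (W' + z + y') / 2%:R); first by adj_tac A_sf.
  by rewrite y'E; field.
split=> //.
- rewrite (_ : z = (W' + z - y') / 2%:R); first by adj_tac A_sf.
  by rewrite y'E; field.
- by rewrite vE VE; adj_tac A_sf.
- by rewrite WE; adj_tac A_sf.
Qed.

(** With z = j z', j^2 = -1, the right-hand side is -(u^2 - a)(z'^2 - a), and composition of norms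
    gives (u^2 - a)(z'^2 - a) = P^2 - a B^2 for P = u z' + a, B = u + z'. The relation becomes W^2 +
    P^2 = a B^2 - c v^2, whose left-hand side factors. After division by B^2, one factor [al] and
    [nu] determine the other; z' is recovered from P / B, a homography in z' over K(u). *)
Lemma threefold_sqr_N1 (i : K) : - 1 = i ^+ 2 -> purely_transcendental iota M.
Proof.
move=> i2; have a0' := iota_neq0 a0.
have j2 : iota i ^+ 2 = - 1 by rewrite -rmorphXn -i2 rmorphN1.
set j := iota i in j2.
have j0 : j != 0.
  by apply/eqP=> j0; move/eqP: j2; rewrite j0 expr0n eq_sym oppr_eq0 oner_eq0.
pose z' := - j * z.
have zE : z = j * z' by rewrite /z' mulrA mulrN -expr2 j2 opprK mul1r.
pose P := u * z' + iota a; pose B := u + z'.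
have Mj : M j by apply: MC.
have Mz' : M z' by rewrite /z'; adj_tac M_sf.
have B0 : B != 0.
  apply/eqP=> B0; apply: z_transc; have B_sf := acl_sf iota [:: u].
  have Bu : acl [:: u] u by apply: acl_mem; rewrite mem_head.
  have Bj : acl [:: u] j by apply: aclC.
  by rewrite zE -[z'](addKr u) -/B B0 addr0; sf_tac B_sf.
have rel : ((W + j * P) / B) * ((W - j * P) / B) = iota a - iota c * (v / B) ^+ 2.
  have rel1 : (W + j * P) * (W - j * P) = W ^+ 2 + P ^+ 2.
    by apply: (lin_eq (k := - P ^+ 2) j2); ring.
  have rel2 : W ^+ 2 + P ^+ 2 = iota a * B ^+ 2 - iota c * v ^+ 2.
    have z2 : z ^+ 2 = - z' ^+ 2 by rewrite zE exprMn j2 mulN1r.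
    by apply: (lin_eq (k := 1) relW); rewrite z2 /P /B; ring.
  rewrite mulf_div rel1 rel2; by field.
pose al := (W + j * P) / B; pose nu := v / B.
have MB : M B by rewrite /B; adj_tac M_sf.
have MP : M P by rewrite /P; adj_tac M_sf.
have al0 : al != 0.
  apply/eqP=> al0; apply: v_transc; apply: acl_sqrt.
  have B_sf := acl_sf iota [:: u; z].
  have Bu : acl [:: u; z] u by apply: acl_mem; rewrite mem_head.
  have Bz : acl [:: u; z] z by apply: acl_mem; rewrite !inE eqxx orbT.
  have Bj : acl [:: u; z] j by apply: aclC.
  rewrite (_ : v ^+ 2 = iota a / iota c * B ^+ 2).
    rewrite /B /z'; repeat first [exact: aclC | assumption | sf_step B_sf].
  move: rel; rewrite -/al al0 mul0r => /esym rel.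
  by apply: (lin_eq (k := - B ^+ 2 / iota c) rel); field; rewrite B0 iota_neq0.
apply: (@threefold_criterion u al nu); first by split; rewrite /al /nu; adj_tac M_sf.
have [A1 A2 A3] := adj3 iota u al nu.
have A_sf := adj_sf iota [:: u; al; nu].
set A := adj _ in A1 A2 A3 A_sf *.
have Aj : A j by apply: adjC.
pose al' := (iota a - iota c * nu ^+ 2) / al.
have al'E : al' = (W - j * P) / B by rewrite /al' -rel -/al mulrC mulKf.
have Aal' : A al' by rewrite /al'; adj_tac A_sf.
pose mu := (al - al') / (2%:R * j).
have muE : mu = P / B by rewrite /mu al'E /al; field; rewrite two_neq0 B0 j0.
have Amu : A mu by rewrite /mu; adj_tac A_sf.
have umu : u - mu != 0.
  have -> : u - mu = (u ^+ 2 - iota a) / B by rewrite muE /P /B; field; exact: B0.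
  by rewrite mulf_neq0 ?invr_eq0.
have z'E : z' = (mu * u - iota a) / (u - mu).
  apply: (mulIf umu); rewrite divfK // muE; rewrite /P /B; field.
  exact: B0.
have Az' : A z' by rewrite z'E; adj_tac A_sf.
have AB : A B by rewrite /B; adj_tac A_sf.
split=> //; first by rewrite zE; adj_tac A_sf.
  by rewrite -[v](divfK B0) -/nu; adj_tac A_sf.
rewrite (_ : W = (al + al') / 2%:R * B); first by adj_tac A_sf.
by rewrite al'E /al; field; rewrite two_neq0 B0.
Qed.

End Threefold.

(** * Generators of the fixed fields of tau and of G *)

Ltac fld := by field; rewrite ?(oppr_eq0, oner_eq0); repeat (apply/andP; split=> //).

Lemma fix_sf (L : fieldType) (s : {rmorphism L -> L}) :
  is_subfield (fun x => s x = x).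
Proof.
split=> [|x y sx sy|x y sx sy]; first exact: rmorph1.
  by rewrite rmorphB sx sy.
by rewrite fmorph_div sx sy.
Qed.

Section FixedFields.

Variables (K L : fieldType) (iota : {rmorphism K -> L}) (X1 X2 X3 : L).
Hypothesis indX : mindep iota 3 [:: X1; X2; X3].
Hypothesis genX : forall x, adj iota [:: X1; X2; X3] x.
Hypothesis two_neq0 : (2%:R : L) != 0.

Local Notation adj := (adj iota).
Local Notation acl := (acl iota).
Local Notation acl_full := (acl_full iota X1 X2 X3).

Variables (a c : K).
Hypotheses (a_neq0 : a != 0) (c_neq0 : c != 0).
Local Notation ia := (iota a).
Local Notation ic := (iota c).

Let ia0 : ia != 0. Proof. by rewrite fmorph_eq0. Qed.
Let ic0 : ic != 0. Proof. by rewrite fmorph_eq0. Qed.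

Lemma subfield_full M : is_subfield M -> (forall k, M (iota k)) ->
  M X1 -> M X2 -> M X3 -> forall x, M x.
Proof. by move=> M_sf MK M1 M2 M3 x; apply: adj_sub (genX x) => //; apply: forall_in_seq. Qed.

Lemma transc_sqr_neq s x k : ~ acl s x -> x ^+ 2 != iota k.
Proof. by move=> tr; apply/eqP=> e; apply: tr; apply: acl_sqrt; rewrite e; apply: aclC. Qed.

Lemma transc_neq0 s x : ~ acl s x -> x != 0.
Proof. by move=> tr; apply/eqP=> e; apply: tr; rewrite e; apply: sf0 (acl_sf _ _). Qed.

Let tr1 : ~ acl [::] X1. Proof. by case: (transc_X indX). Qed.
Let tr2 : ~ acl [:: X1] X2. Proof. by case: (transc_X indX). Qed.
Let tr3 : ~ acl [:: X1; X2] X3. Proof. by case: (transc_X indX). Qed.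
Let X1_0 : X1 != 0. Proof. exact: transc_neq0 tr1. Qed.
Let X2_0 : X2 != 0. Proof. exact: transc_neq0 tr2. Qed.
Let X3_0 : X3 != 0. Proof. exact: transc_neq0 tr3. Qed.

Section Tau.

Variable tau : {rmorphism L -> L}.
Hypothesis tauC : forall k, tau (iota k) = iota k.
Hypotheses (tau1 : tau X1 = - X1) (tau2 : tau X2 = ia / X2)
  (tau3 : tau X3 = (ia * X1 ^+ 2 - ic) / X3).

(** Since tau negates X1, write X2 = u + v X1 and X3 = w + z X1 with fixed coefficients. The norms
    of X2 and X3 give the two conics u^2 - X1^2 v^2 = a and w^2 - X1^2 z^2 = a X1^2 - c over
    K(X1^2). Eliminating X1^2 = (u^2 - a) / v^2 and setting W = v w yields the threefold. *)
Definition tau_u := (X2 + ia / X2) / 2%:R.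
Definition tau_v := (X2 - ia / X2) / (2%:R * X1).
Definition tau_w := (X3 + (ia * X1 ^+ 2 - ic) / X3) / 2%:R.
Definition tau_z := (X3 - (ia * X1 ^+ 2 - ic) / X3) / (2%:R * X1).
Definition tau_W := tau_v * tau_w.

Let v0 : tau_v != 0.
Proof.
rewrite /tau_v (_ : X2 - ia / X2 = (X2 ^+ 2 - ia) / X2); last by field.
rewrite !mulf_neq0 ?invr_eq0 ?mulf_neq0 // subr_eq0.
exact: transc_sqr_neq tr2.
Qed.

Let f0 : ia * X1 ^+ 2 - ic != 0.
Proof.
rewrite subr_eq0; apply: contraNneq (transc_sqr_neq (c / a) tr1) => e.
by rewrite fmorph_div -e mulrAC mulfV ?mul1r.
Qed.

Lemma tau_fixed_gens : [/\ tau tau_u = tau_u, tau tau_z = tau_z,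
  tau tau_v = tau_v & tau tau_W = tau_W].
Proof.
have tau2n : tau 2%:R = 2%:R by rewrite rmorph_nat.
have tv : tau tau_v = tau_v.
  rewrite /tau_v fmorph_div rmorphM rmorphB fmorph_div tauC tau2 tau1 tau2n.
  fld.
have tf : tau (ia * X1 ^+ 2 - ic) = ia * X1 ^+ 2 - ic.
  by rewrite rmorphB rmorphM rmorphXn !tauC tau1 sqrrN.
split=> //.
- rewrite /tau_u fmorph_div rmorphD fmorph_div tauC tau2 tau2n.
  fld.
- rewrite /tau_z fmorph_div rmorphM rmorphB fmorph_div tf tau3 tau1 tau2n.
  fld.
- rewrite /tau_W rmorphM tv; congr (_ * _).
  rewrite /tau_w fmorph_div rmorphD fmorph_div tf tau3 tau2n.
  fld.
Qed.

Let X1E : X1 ^+ 2 = (tau_u ^+ 2 - ia) / tau_v ^+ 2.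
Proof.
have h : tau_v ^+ 2 * X1 ^+ 2 = tau_u ^+ 2 - ia.
  rewrite /tau_v /tau_u; fld.
by rewrite -h mulrAC mulfV ?mul1r // expf_neq0.
Qed.

Let X2E : X2 = tau_u + tau_v * X1.
Proof. rewrite /tau_u /tau_v; fld. Qed.

Let X3E : X3 = tau_w + tau_z * X1.
Proof. rewrite /tau_w /tau_z; fld. Qed.

Lemma tau_rel : tau_W ^+ 2 + ic * tau_v ^+ 2 =
  (tau_u ^+ 2 - ia) * (tau_z ^+ 2 + ia).
Proof.
rewrite /tau_W /tau_v /tau_w /tau_u /tau_z.
fld.
Qed.

Lemma tau_full : acl_full [:: tau_u; tau_z; tau_v].
Proof.
set s := [:: _; _; _]; have B_sf := acl_sf iota s.
have Bu : acl s tau_u by apply: acl_mem; rewrite mem_head.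
have Bz : acl s tau_z by apply: acl_mem; rewrite !inE eqxx orbT.
have Bv : acl s tau_v by apply: acl_mem; rewrite !inE eqxx !orbT.
have BC k : acl s (iota k) by apply: aclC.
have [Ba Bc] := (BC a, BC c).
have B1 : acl s X1 by apply: acl_sqrt; rewrite X1E; sf_tac B_sf.
have Bw : acl s tau_w.
  apply: acl_sqrt; rewrite (_ : _ ^+ 2 = ia * X1 ^+ 2 - ic + tau_z ^+ 2 * X1 ^+ 2).
    by sf_tac B_sf.
  rewrite /tau_w /tau_z; fld.
by split=> //; [rewrite X2E | rewrite X3E]; sf_tac B_sf.
Qed.

Lemma tau_fixedP x : tau x = x <-> adj [:: tau_u; tau_z; tau_v; tau_W] x.
Proof.
have [tu tz tv tW] := tau_fixed_gens; set s := [:: _; _; _; _].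
have fix_adj y : adj s y -> tau y = y.
  by apply: (@adj_sub _ _ _ _ (fun y => tau y = y));
    [exact: fix_sf | exact: tauC | apply: forall_in_seq].
split; last exact: fix_adj.
have N_sf := adj_sf iota s.
have Nu : adj s tau_u by apply: adj_mem; rewrite mem_head.
have Nz : adj s tau_z by apply: adj_mem; rewrite !inE eqxx orbT.
have Nv : adj s tau_v by apply: adj_mem; rewrite !inE eqxx !orbT.
have NW : adj s tau_W by apply: adj_mem; rewrite !inE eqxx !orbT.
have Nw : adj s tau_w by rewrite -(mulKf v0 tau_w) -/tau_W; sf_tac N_sf.
have N1 : adj s (X1 ^+ 2) by rewrite X1E; adj_tac N_sf.
apply: (quad_fixed two_neq0 X1_0 fix_adj tau1).
have Q_sf := quad_sf N_sf N1.
have Qin := fun y => @quad_in _ _ X1 N_sf y; have Q1 := quad_root X1 N_sf.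
apply: subfield_full => //.
- by move=> k; apply: Qin; apply: adjC.
- by rewrite X2E; apply: (sfD Q_sf); [|apply: (sfM Q_sf)]; auto.
- by rewrite X3E; apply: (sfD Q_sf); [|apply: (sfM Q_sf)]; auto.
Qed.

End Tau.

Section Sigma.

Variables s1 s2 : {rmorphism L -> L}.
Hypothesis s1C : forall k, s1 (iota k) = iota k.
Hypothesis s2C : forall k, s2 (iota k) = iota k.
Hypotheses (s11 : s1 X1 = ia / X2) (s12 : s1 X2 = X1) (s13 : s1 X3 = ic / X3).

Let n2 (s : {rmorphism L -> L}) : s 2%:R = 2%:R. Proof. exact: rmorph_nat. Qed.

(** The square of s1 maps X1, X2, X3 to a / X1, a / X2, X3. With X3, the functions al and be
    generate its fixed field, and s1 acts there by al -> a / al and be -> -a / be, as [s1_al] and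
    [s1_be] show. *)
Definition sg_al := (X1 * X2 + ia) / (X1 + X2).
Definition sg_be := (X1 * X2 - ia) / (X1 - X2).
Local Notation al := sg_al.
Local Notation be := sg_be.

Lemma X12_neq p q r t : [:: p; q; r; t] != [:: 0; 0; 0; 0] ->
  iota p * (X1 * X2) + iota q * X1 + iota r * X2 + iota t != 0.
Proof.
move=> nz; apply/eqP=> e; have B_sf := acl_sf iota [:: X1].
have B1 : acl [:: X1] X1 by apply: acl_mem; rewrite mem_head.
have [d0|d0] := eqVneq (iota p * X1 + iota r) 0; last first.
  apply: tr2; rewrite (_ : X2 = - (iota q * X1 + iota t) / (iota p * X1 + iota r)).
    by repeat (first [assumption | exact: aclC | sf_step B_sf]).
  by apply: (lin_eq (k := (iota p * X1 + iota r)^-1) e); field.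
have lin0 k l : iota k * X1 + iota l = 0 -> k = 0 /\ l = 0.
  move=> kl; have [k0|k0] := eqVneq k 0.
    by move: kl; rewrite k0 rmorph0 mul0r add0r => /eqP; rewrite fmorph_eq0 => /eqP.
  case: tr1; rewrite (_ : X1 = iota (- (l / k))); first exact: aclC.
  apply: (lin_eq (k := (iota k)^-1) kl); rewrite rmorphN fmorph_div.
  by field; rewrite fmorph_eq0.
have [p0 r0] := lin0 _ _ d0.
have [|q0 t0] := lin0 q t; last by rewrite p0 q0 r0 t0 eqxx in nz.
by rewrite -[RHS]e p0 r0 rmorph0; ring.
Qed.

Let nz_p : X1 + X2 != 0.
Proof.
have := @X12_neq 0 1 1 0; rewrite !rmorph0 !rmorph1 mul0r add0r addr0 !mul1r; apply.
by rewrite !eqseq_cons oner_eq0 andbF.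
Qed.

Let nz_m : X1 - X2 != 0.
Proof.
have := @X12_neq 0 1 (-1) 0; rewrite !rmorph0 rmorphN !rmorph1 mul0r add0r addr0 mulN1r mul1r;
  apply.
by rewrite !eqseq_cons oner_eq0 andbF.
Qed.

Let nz_ap : X1 * X2 + ia != 0.
Proof.
have := @X12_neq 1 0 0 a; rewrite !rmorph0 !rmorph1 !mul0r !addr0 !mul1r; apply.
by rewrite !eqseq_cons oner_eq0.
Qed.

Let nz_am : X1 * X2 - ia != 0.
Proof.
have := @X12_neq 1 0 0 (- a); rewrite !rmorph0 rmorphN !rmorph1 !mul0r !addr0 !mul1r; apply.
by rewrite !eqseq_cons oner_eq0.
Qed.

Let sq1 : X1 ^+ 2 - ia != 0. Proof. by rewrite subr_eq0; apply: transc_sqr_neq tr1. Qed.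
Let sq2 : X2 ^+ 2 - ia != 0. Proof. by rewrite subr_eq0; apply: transc_sqr_neq tr2. Qed.

Let al0 : al != 0. Proof. by rewrite mulf_neq0 ?invr_eq0. Qed.
Let be0 : be != 0. Proof. by rewrite mulf_neq0 ?invr_eq0. Qed.

Lemma s1_al : s1 al = ia / al.
Proof.
rewrite /al fmorph_div !rmorphD rmorphM s1C s11 s12.
have -> : ia / X2 * X1 + ia = ia * (X1 + X2) / X2 by fld.
have -> : ia / X2 + X1 = (X1 * X2 + ia) / X2 by fld.
fld.
Qed.

Lemma s1_be : s1 be = - ia / be.
Proof.
rewrite /be fmorph_div !rmorphB rmorphM s1C s11 s12.
have -> : ia / X2 * X1 - ia = ia * (X1 - X2) / X2 by fld.
have -> : ia / X2 - X1 = - (X1 * X2 - ia) / X2 by fld.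
fld.
Qed.

Let al_be : al - be != 0.
Proof.
rewrite (_ : al - be = - (2%:R * X1 * (X2 ^+ 2 - ia)) / ((X1 + X2) * (X1 - X2))).
  by rewrite !(mulf_neq0, invr_eq0, oppr_eq0).
rewrite /al /be; fld.
Qed.

Let trace1 : X1 + ia / X1 = 2%:R * (ia - al * be) / (al - be).
Proof.
apply: (mulIf al_be); rewrite divfK // /al /be; fld.
Qed.

Let X1_al : X1 - al != 0.
Proof.
rewrite (_ : X1 - al = (X1 ^+ 2 - ia) / (X1 + X2)); last by rewrite /al; fld.
by rewrite mulf_neq0 ?invr_eq0.
Qed.

Let X2E : X2 = (al * X1 - ia) / (X1 - al).
Proof. apply: (mulIf X1_al); rewrite divfK // /al; fld. Qed.

(** The square of s1 negates d1, while X1 + a / X1 lies in K(al, be) by [trace1]; so d1 generates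
    the whole field over K(al, be, X3), quadratically. *)
Let d1 := X1 - ia / X1.

Let X1E : X1 = (2%:R * (ia - al * be) / (al - be) + d1) / 2%:R.
Proof. rewrite -trace1 /d1; fld. Qed.

Let d1_sqr : d1 ^+ 2 = (2%:R * (ia - al * be) / (al - be)) ^+ 2 - 4%:R * ia.
Proof. rewrite -trace1 /d1; fld. Qed.

Lemma acl_full_sigma s : acl s al -> acl s be -> acl s X3 -> acl_full s.
Proof.
move=> Ba Bb B3; have B_sf := acl_sf iota s; have Bia := aclC iota s a.
have Bd : acl s d1 by apply: acl_sqrt; rewrite d1_sqr; sf_tac B_sf.
have B1 : acl s X1 by rewrite X1E; sf_tac B_sf.
by split=> //; rewrite X2E; sf_tac B_sf.
Qed.

Lemma fixed_sigma1_sqr x : s1 (s1 x) = x -> adj [:: al; be; X3] x.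
Proof.
have [Na Nb N3] := adj3 iota al be X3; have N_sf := adj_sf iota [:: al; be; X3].
set N := adj _ in Na Nb N3 N_sf *.
have Nd : N (d1 ^+ 2) by rewrite d1_sqr; adj_tac N_sf.
pose ss := [the {rmorphism L -> L} of s1 \o s1].
have d10 : d1 != 0.
  rewrite /d1 (_ : X1 - ia / X1 = (X1 ^+ 2 - ia) / X1); last by fld.
  by rewrite mulf_neq0 ?invr_eq0.
have fixN y : N y -> ss y = y.
  apply: (@adj_sub _ _ _ _ (fun y => ss y = y)); first exact: fix_sf.
    by move=> k /=; rewrite !s1C.
  apply: forall_in_seq; split; first by rewrite /= s1_al fmorph_div s1C s1_al; fld.
  split; first by rewrite /= s1_be fmorph_div rmorphN s1C s1_be; fld.
  by split=> //=; rewrite s13 fmorph_div s1C s13; fld.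
have sd : ss d1 = - d1.
  by rewrite /d1 /= !rmorphB !fmorph_div !s1C s11 !fmorph_div !s1C s12; fld.
apply: (quad_fixed two_neq0 d10 fixN sd).
have Q_sf := quad_sf N_sf Nd.
have Qin := fun y => @quad_in _ _ d1 N_sf y; have Qd := quad_root d1 N_sf.
have [Qa Qb Q3 Qia] : [/\ quad N d1 al, quad N d1 be, quad N d1 X3 & quad N d1 ia].
  by split; apply: Qin => //; apply: adjC.
have Q1 : quad N d1 X1 by rewrite X1E; sf_tac Q_sf.
apply: subfield_full => //; first by move=> k; apply: Qin; apply: adjC.
by rewrite X2E; sf_tac Q_sf.
Qed.

Let full0 : acl_full [:: al; be; X3].
Proof. by apply: acl_full_sigma; apply: acl_mem; rewrite !inE eqxx ?orbT. Qed.

(* The fixed field of s1^2 is K(al, be, X3); the lists t and s generate its subfields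
   fixed by s2, and by both s1 and s2, each step being quadratic. *)
Lemma fixed_sigma_tower t (s : seq L) d2 d3 x :
    (forall y, adj t y -> s2 y = y) -> (forall y, adj s y -> s1 y = y) ->
    adj t (d2 ^+ 2) -> adj s (d3 ^+ 2) -> d2 != 0 -> d3 != 0 ->
    s2 d2 = - d2 -> s1 d3 = - d3 ->
    quad (adj t) d2 al -> quad (adj t) d2 be -> quad (adj t) d2 X3 ->
    {in t, forall z, quad (adj s) d3 z} ->
  s1 x = x -> s2 x = x -> adj s x.
Proof.
move=> fix2 fix1 N2 N3 d20 d30 sd2 sd3 Qa Qb Q3 Qt s1x s2x.
apply: (quad_fixed two_neq0 d30 fix1 sd3) => //.
apply: (@adj_sub _ _ iota t); [exact: quad_sf (adj_sf _ _) N3 | | exact: Qt |].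
  by move=> k; apply: (quad_in _ (adj_sf _ _)); apply: adjC.
apply: (quad_fixed two_neq0 d20 fix2 sd2) => //.
apply: (@adj_sub _ _ iota [:: al; be; X3]); [exact: quad_sf (adj_sf _ _) N2 | | |].
- by move=> k; apply: (quad_in _ (adj_sf _ _)); apply: adjC.
- exact: forall_in_seq.
- by apply: fixed_sigma1_sqr; rewrite s1x.
Qed.

Let tr_be : ~ acl [:: al; X3] be.
Proof.
apply: (acl_full_transc indX); apply: acl_full_trans full0; apply: forall_in_seq.
by split; [|split; [|split]] => //; apply: acl_mem; rewrite !inE eqxx ?orbT.
Qed.

Let tr_al : ~ acl [:: be; X3] al.
Proof.
apply: (acl_full_transc indX); apply: acl_full_trans full0; apply: forall_in_seq.
by split; [|split; [|split]] => //; apply: acl_mem; rewrite !inE eqxx ?orbT.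
Qed.

Let tr_X3 : ~ acl [:: al; be] X3. Proof. exact: acl_full_transc full0. Qed.

Let X3c k : X3 ^+ 2 != iota k. Proof. exact: transc_sqr_neq tr_X3. Qed.

Let d3m : X3 - ic / X3 != 0.
Proof.
rewrite (_ : _ - _ = (X3 ^+ 2 - ic) / X3); last by fld.
by rewrite mulf_neq0 ?invr_eq0 // subr_eq0.
Qed.

Let d3p : X3 + ic / X3 != 0.
Proof.
rewrite (_ : _ + _ = (X3 ^+ 2 + ic) / X3); last by fld.
by rewrite mulf_neq0 ?invr_eq0 // addr_eq0 -rmorphN.
Qed.

Let X3m : X3 * X3 - ic != 0. Proof. by rewrite -expr2 subr_eq0. Qed.
Let X3p : X3 * X3 + ic != 0. Proof. by rewrite -expr2 addr_eq0 -rmorphN. Qed.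

Section FirstSignPositive.

Hypotheses (s21 : s2 X1 = X1) (s22 : s2 X2 = X2).

Let s2_al : s2 al = al.
Proof. by rewrite /al fmorph_div !rmorphD rmorphM s21 s22 s2C. Qed.

Let s2_be : s2 be = be.
Proof. by rewrite /be fmorph_div !rmorphB rmorphM s21 s22 s2C. Qed.

(** P, R are the even and Q, S the odd parts of al, be under s1, so P^2 - Q^2 = a and R^2 - S^2 =
    -a. With the invariant m = S / Q this becomes the conic R^2 - m^2 P^2 = -a (1 + m^2) over K(m).
    Its left-hand side factors, so n = R + m P parametrises it. *)
Let P := (al + ia / al) / 2%:R.
Let Q := (al - ia / al) / 2%:R.
Let R := (be - ia / be) / 2%:R.
Let S := (be + ia / be) / 2%:R.
Let m := S / Q.
Let n := R + m * P.

Let Q0 : Q != 0.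
Proof.
rewrite /Q (_ : al - ia / al = (al ^+ 2 - ia) / al); last by fld.
by rewrite !mulf_neq0 ?invr_eq0 // subr_eq0; apply: transc_sqr_neq tr_al.
Qed.

Let S0 : S != 0.
Proof.
rewrite /S (_ : be + ia / be = (be ^+ 2 + ia) / be); last by fld.
rewrite !mulf_neq0 ?invr_eq0 // addr_eq0 -rmorphN.
exact: transc_sqr_neq tr_be.
Qed.

Let m0 : m != 0. Proof. by rewrite mulf_neq0 ?invr_eq0. Qed.

Let SE : S = m * Q. Proof. by rewrite divfK. Qed.

Let PQ : Q ^+ 2 = P ^+ 2 - ia. Proof. rewrite /P /Q; fld. Qed.
Let RS : S ^+ 2 = R ^+ 2 + ia. Proof. rewrite /R /S; fld. Qed.

Let nE : n * (R - m * P) = - ia * (1 + m ^+ 2).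
Proof.
have e : R ^+ 2 + ia = m ^+ 2 * (P ^+ 2 - ia) by rewrite -RS -PQ SE exprMn.
by apply: (lin_eq (k := 1) e); rewrite /n; ring.
Qed.

Let m1 : 1 + m ^+ 2 != 0.
Proof.
apply/eqP=> e; apply: tr_be.
have B_sf := acl_sf iota [:: al; X3]; have Bia := aclC iota [:: al; X3] a.
have Ba : acl [:: al; X3] al by apply: acl_mem; rewrite mem_head.
have BS : acl [:: al; X3] S.
  apply: acl_sqrt; rewrite SE exprMn (_ : m ^+ 2 = -1).
    by rewrite /Q; sf_tac B_sf.
  by apply: (lin_eq (k := 1) e); ring.
have BR : acl [:: al; X3] R.
  apply: acl_sqrt; rewrite (_ : R ^+ 2 = S ^+ 2 - ia); first by sf_tac B_sf.
  by rewrite RS addrK.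
by rewrite (_ : be = R + S); [sf_tac B_sf | rewrite /R /S; fld].
Qed.

Let n0 : n != 0.
Proof.
have : - ia * (1 + m ^+ 2) != 0 by rewrite mulf_neq0 ?oppr_eq0.
by rewrite -nE mulf_eq0 negb_or => /andP[].
Qed.

Let PR_in B : is_subfield B -> (forall k, B (iota k)) -> B m -> B n -> B P /\ B R.
Proof.
move=> B_sf BC Bm Bn; pose n' := - ia * (1 + m ^+ 2) / n.
have n'E : n' = R - m * P by rewrite /n' -nE mulrC mulKf.
have Bia := BC a.
have Bn' : B n' by rewrite /n'; sf_tac B_sf.
split.
  by rewrite (_ : P = (n - n') / (2%:R * m)); [sf_tac B_sf | rewrite n'E /n; fld].
by rewrite (_ : R = (n + n') / 2%:R); [sf_tac B_sf | rewrite n'E /n; fld].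
Qed.

Let alE : al = P + Q. Proof. rewrite /P /Q; fld. Qed.
Let beE : be = R + m * Q. Proof. rewrite -SE /R /S; fld. Qed.

Let s1Q : s1 Q = - Q.
Proof. rewrite /Q fmorph_div n2 rmorphB (fmorph_div s1 ia) s1C s1_al; fld. Qed.

Let s1m : s1 m = m.
Proof.
have s1S : s1 S = - S by rewrite /S fmorph_div n2 rmorphD (fmorph_div s1 ia) s1C s1_be; fld.
rewrite /m fmorph_div s1Q s1S; fld.
Qed.

Let s1n : s1 n = n.
Proof.
have s1P : s1 P = P by rewrite /P fmorph_div n2 rmorphD (fmorph_div s1 ia) s1C s1_al; fld.
have s1R : s1 R = R by rewrite /R fmorph_div n2 rmorphB (fmorph_div s1 ia) s1C s1_be; fld.
by rewrite /n rmorphD rmorphM s1m s1P s1R.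
Qed.

Let s2m : s2 m = m.
Proof.
by rewrite /m /S /Q !fmorph_div !n2 rmorphD rmorphB !(fmorph_div s2 ia) !s2C s2_al s2_be.
Qed.

Let s2n : s2 n = n.
Proof.
have s2P : s2 P = P by rewrite /P fmorph_div n2 rmorphD (fmorph_div s2 ia) s2C s2_al.
have s2R : s2 R = R by rewrite /R fmorph_div n2 rmorphB (fmorph_div s2 ia) s2C s2_be.
by rewrite /n rmorphD rmorphM s2m s2P s2R.
Qed.

(* [y] generates the fixed field of [s2] in K(X3), and the third generator
   [y3] is [y] or [y * Q]. *)
Let purely_first_positive y d y3 :
    X3 = (y + d) / 2%:R -> (d ^+ 2 = y ^+ 2 - iota 4%:R * ic \/ d ^+ 2 = y ^+ 2 + iota 4%:R * ic) ->
    d != 0 -> s2 y = y -> s2 d = - d ->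
    (y3 = y \/ y3 = y * Q) -> s1 y3 = y3 -> s2 Q = Q ->
  purely_transcendental iota (fun x => s1 x = x /\ s2 x = x).
Proof.
move=> X3E dE d0 s2y s2d y3E s1y3 s2Q.
have [Am An Ay] := adj3 iota m n y3; have A_sf := adj_sf iota [:: m; n; y3].
set s := [:: m; n; y3] in Am An Ay A_sf.
have y_in B : is_subfield B -> B Q -> B y3 -> B y.
  move=> B_sf BQ; case: y3E => -> // ByQ.
  by rewrite -(mulfK Q0 y); sf_tac B_sf.
have d_in B : is_subfield B -> (forall k, B (iota k)) -> B y -> B (d ^+ 2).
  by move=> B_sf BC By; have [Bc B4] := (BC c, BC 4%:R); case: dE => ->; sf_tac B_sf.
apply: (acl_full_purely indX (y1 := m) (y2 := n) (y3 := y3)).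
  have B_sf := acl_sf iota s; have BC := aclC iota s.
  have Bm := acl_adj Am; have Bn := acl_adj An; have By3 := acl_adj Ay.
  have [BP BR] := PR_in B_sf BC Bm Bn; have Bia := BC a.
  have BQ : acl s Q by apply: acl_sqrt; rewrite PQ; sf_tac B_sf.
  have By := y_in _ B_sf BQ By3.
  have Bd : acl s d by apply: acl_sqrt; apply: d_in.
  by apply: acl_full_sigma; rewrite ?alE ?beE ?X3E; sf_tac B_sf.
move=> x; split=> [[s1x s2x]|]; last first.
  move=> sx; split; move: sx.
    apply: (@adj_sub _ _ _ _ (fun y => s1 y = y)); [exact: fix_sf | exact: s1C |].
    exact: forall_in_seq.
  apply: (@adj_sub _ _ _ _ (fun y => s2 y = y)); [exact: fix_sf | exact: s2C |].
  apply: forall_in_seq; split=> //; split=> //; split=> //.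
  by case: y3E => -> //; rewrite rmorphM s2y s2Q.
have [Ta Tb Ty] := adj3 iota al be y; have T_sf := adj_sf iota [:: al; be; y].
have Td : adj [:: al; be; y] (d ^+ 2) by apply: d_in => // k; apply: adjC.
have AC k : adj s (iota k) by apply: adjC.
have [AP AR] := PR_in A_sf AC Am An.
have AQ : adj s (Q ^+ 2) by rewrite PQ; adj_tac A_sf.
have Q_sf := quad_sf A_sf AQ; have Qin := fun z => @quad_in _ _ Q A_sf z.
have QQ := quad_root Q A_sf; have QP := Qin _ AP; have QR := Qin _ AR; have Qm := Qin _ Am.
apply: (fixed_sigma_tower (t := [:: al; be; y]) (d2 := d) (d3 := Q)) => //.
- move=> z; apply: (@adj_sub _ _ _ _ (fun y => s2 y = y)); [exact: fix_sf | exact: s2C |].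
  exact: forall_in_seq.
- move=> z; apply: (@adj_sub _ _ _ _ (fun y => s1 y = y)); [exact: fix_sf | exact: s1C |].
  exact: forall_in_seq.
- exact: quad_in.
- exact: quad_in.
- have D_sf := quad_sf T_sf Td; have Dd := quad_root d T_sf.
  have Dy : quad (adj [:: al; be; y]) d y by apply: quad_in.
  by rewrite X3E; sf_tac D_sf.
- apply: forall_in_seq; split; first by rewrite alE; sf_tac Q_sf.
  split; first by rewrite beE; sf_tac Q_sf.
  by split=> //; apply: y_in => //; apply: Qin.
Qed.

Let s2Q : s2 Q = Q.
Proof. by rewrite /Q fmorph_div n2 rmorphB (fmorph_div s2 ia) s2C s2_al. Qed.

Lemma purely_positive_positive : s2 X3 = ic / X3 ->
  purely_transcendental iota (fun x => s1 x = x /\ s2 x = x).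
Proof.
move=> s23; pose y := X3 + ic / X3.
apply: (@purely_first_positive y (X3 - ic / X3) y) => //.
- rewrite /y; fld.
- left; rewrite rmorph_nat /y; fld.
- rewrite /y rmorphD fmorph_div s2C s23; fld.
- rewrite rmorphB fmorph_div s2C s23; fld.
- by left.
- rewrite /y rmorphD fmorph_div s1C s13; fld.
Qed.

(** Here s1 negates the s2-invariant y = X3 - c / X3; the factor Q, negated as well, makes it
    invariant under both. *)
Lemma purely_positive_negative : s2 X3 = - ic / X3 ->
  purely_transcendental iota (fun x => s1 x = x /\ s2 x = x).
Proof.
move=> s23; pose y := X3 - ic / X3.
apply: (@purely_first_positive y (X3 + ic / X3) (y * Q)) => //.
- rewrite /y; fld.
- right; rewrite rmorph_nat /y; fld.
- rewrite /y rmorphB fmorph_div s2C s23; fld.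
- rewrite rmorphD fmorph_div s2C s23; fld.
- by right.
- rewrite rmorphM s1Q /y rmorphB fmorph_div s1C s13; fld.
Qed.

End FirstSignPositive.

Section FirstSignNegative.

Hypotheses (s21 : s2 X1 = - X1) (s22 : s2 X2 = - X2).

Let s2_al : s2 al = - al.
Proof. rewrite /al fmorph_div !rmorphD rmorphM s21 s22 s2C mulrNN -opprD; fld. Qed.

Let s2_be : s2 be = - be.
Proof.
rewrite /be fmorph_div !rmorphB rmorphM s21 s22 s2C mulrNN.
by rewrite -[in X in _ / X]opprD invrN mulrN.
Qed.

(** s2 negates both al and be, so their ratio is s2-invariant; s1 maps it to -1 / ga. *)
Definition sg_ga := be / al.
Local Notation ga := sg_ga.

Let ga0 : ga != 0. Proof. by rewrite mulf_neq0 ?invr_eq0. Qed.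
Let beE : be = ga * al. Proof. by rewrite divfK. Qed.

Let s2_ga : s2 ga = ga.
Proof. by rewrite /ga fmorph_div s2_al s2_be invrN mulrNN. Qed.

Let s1_ga : s1 ga = - ga^-1.
Proof. rewrite /ga fmorph_div s1_al s1_be; fld. Qed.

Section SecondSignPositive.

Hypothesis s23 : s2 X3 = ic / X3.

(** X3 = y + z al splits X3 into parts even and odd under s2, with al as the odd element. The
    invariants of s2 in K(al, be, X3) are then K(ga, y, z), because al^2 = (y^2 - c) / z^2, and s1
    acts there by ga -> -1 / ga, y -> y, z -> g / z. *)
Let y := (X3 + ic / X3) / 2%:R.
Let z := (X3 - ic / X3) / (2%:R * al).
Let g := - (y ^+ 2 - ic) / ia.

Let z0 : z != 0.
Proof. by apply: mulf_neq0 => //; rewrite invr_eq0; apply: mulf_neq0. Qed.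

Let alz : al ^+ 2 * z ^+ 2 = y ^+ 2 - ic. Proof. rewrite /z /y; fld. Qed.

Let yc : y ^+ 2 - ic != 0. Proof. by rewrite -alz mulf_neq0 ?expf_neq0. Qed.

Let g0 : g != 0. Proof. by rewrite mulf_neq0 ?invr_eq0 ?oppr_eq0. Qed.

Let alE : al ^+ 2 = (y ^+ 2 - ic) / z ^+ 2.
Proof. by rewrite -alz mulfK // expf_neq0. Qed.

Let X3E : X3 = y + z * al. Proof. rewrite /z /y; fld. Qed.

Let s2y : s2 y = y. Proof. rewrite /y fmorph_div n2 rmorphD fmorph_div s2C s23; fld. Qed.
Let s1y : s1 y = y. Proof. rewrite /y fmorph_div n2 rmorphD fmorph_div s1C s13; fld. Qed.

Let s2z : s2 z = z.
Proof. rewrite /z fmorph_div rmorphM n2 rmorphB (fmorph_div s2 ic) s2C s23 s2_al; fld. Qed.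

Let s1z : s1 z = g / z.
Proof.
rewrite /g -alz {1}/z fmorph_div rmorphM n2 rmorphB (fmorph_div s1 ic) s1C s13 s1_al.
rewrite /z; fld.
Qed.

Let s1g : s1 g = g.
Proof. by rewrite /g fmorph_div rmorphN rmorphB rmorphXn !s1C s1y. Qed.

Let full1 : acl_full [:: y; ga; z].
Proof.
set s := [:: _; _; _]; have B_sf := acl_sf iota s; have Bic := aclC iota s c.
have [Ay Aga Az] := adj3 iota y ga z.
have By : acl s y by apply: acl_adj. have Bga : acl s ga by apply: acl_adj.
have Bz : acl s z by apply: acl_adj.
have Bal : acl s al by apply: acl_sqrt; rewrite alE; sf_tac B_sf.
by apply: acl_full_sigma; rewrite ?beE ?X3E; sf_tac B_sf.
Qed.

Let tr_z : ~ acl [:: y; ga] z. Proof. exact: acl_full_transc full1. Qed.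

Let tr_ga : ~ acl [:: y; z] ga.
Proof.
apply: (acl_full_transc indX); apply: acl_full_trans full1; apply: forall_in_seq.
by split; [|split; [|split]] => //; apply: acl_mem; rewrite !inE eqxx ?orbT.
Qed.

(** Even parts P, R and odd parts Q, S of ga, z under s1, as in the case of the first sign positive:
    P^2 - Q^2 = -1 and R^2 - S^2 = g give R^2 - m^2 P^2 = g + m^2. As y, hence g, is invariant, this
    is again a split conic, now over K(y, m). *)
Let P := (ga - ga^-1) / 2%:R.
Let Q := (ga + ga^-1) / 2%:R.
Let R := (z + g / z) / 2%:R.
Let S := (z - g / z) / 2%:R.
Let m := S / Q.
Let n := R + m * P.

Let Q0 : Q != 0.
Proof.
rewrite /Q (_ : ga + ga^-1 = (ga ^+ 2 + 1) / ga); last by fld.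
rewrite !mulf_neq0 ?invr_eq0 // addr_eq0 -(rmorph1 iota) -rmorphN.
exact: transc_sqr_neq tr_ga.
Qed.

Let B_sf := acl_sf iota [:: y; ga].
Let By : acl [:: y; ga] y. Proof. by apply: acl_mem; rewrite mem_head. Qed.
Let Bga : acl [:: y; ga] ga. Proof. by apply: acl_mem; rewrite !inE eqxx orbT. Qed.
Let Bg : acl [:: y; ga] g.
Proof. by rewrite /g; repeat (first [assumption | exact: aclC | sf_step B_sf]). Qed.

Let z_S : acl [:: y; ga] S -> acl [:: y; ga] z.
Proof.
move=> BS; have BR : acl [:: y; ga] R.
  apply: acl_sqrt; rewrite (_ : R ^+ 2 = S ^+ 2 + g); first by sf_tac B_sf.
  rewrite /R /S; fld.
by rewrite (_ : z = R + S); [sf_tac B_sf | rewrite /R /S; fld].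
Qed.

Let m0 : m != 0.
Proof.
rewrite mulf_neq0 ?invr_eq0 //; apply/eqP=> S0; apply: tr_z; apply: z_S.
by rewrite S0; sf_tac B_sf.
Qed.

Let SE : S = m * Q. Proof. by rewrite divfK. Qed.
Let PQ : Q ^+ 2 = P ^+ 2 + 1. Proof. rewrite /P /Q; fld. Qed.
Let RS : S ^+ 2 = R ^+ 2 - g. Proof. rewrite /R /S; fld. Qed.

Let nE : n * (R - m * P) = g + m ^+ 2.
Proof.
have e : R ^+ 2 - g = m ^+ 2 * (P ^+ 2 + 1) by rewrite -RS -PQ SE exprMn.
by apply: (lin_eq (k := 1) e); rewrite /n; ring.
Qed.

Let n0 : n != 0.
Proof.
apply/eqP=> n_0; apply: tr_z; apply: z_S; apply: acl_sqrt; rewrite SE exprMn.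
rewrite (_ : m ^+ 2 = - g); first by rewrite /Q; sf_tac B_sf.
by move/eqP: nE; rewrite n_0 mul0r eq_sym addrC addr_eq0 => /eqP.
Qed.

Let g_in B : is_subfield B -> (forall k, B (iota k)) -> B y -> B g.
Proof. by move=> H BC Hy; have [Ba Bc] := (BC a, BC c); rewrite /g; sf_tac H. Qed.

Let PR_in B : is_subfield B -> (forall k, B (iota k)) -> B y -> B m -> B n -> B P /\ B R.
Proof.
move=> H BC Hy Hm Hn; pose n' := (g + m ^+ 2) / n.
have n'E : n' = R - m * P by rewrite /n' -nE mulrC mulKf.
have Hg := g_in H BC Hy.
have Hn' : B n' by rewrite /n'; sf_tac H.
split.
  by rewrite (_ : P = (n - n') / (2%:R * m)); [sf_tac H | rewrite n'E /n; fld].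
by rewrite (_ : R = (n + n') / 2%:R); [sf_tac H | rewrite n'E /n; fld].
Qed.

Let gaE : ga = P + Q. Proof. rewrite /P /Q; fld. Qed.
Let zE : z = R + m * Q. Proof. rewrite -SE /R /S; fld. Qed.

Let s1Q : s1 Q = - Q.
Proof. rewrite /Q fmorph_div n2 rmorphD fmorphV s1_ga; fld. Qed.

Let s1m : s1 m = m.
Proof.
have s1S : s1 S = - S by rewrite /S fmorph_div n2 rmorphB (fmorph_div s1 g) s1g s1z; fld.
rewrite /m fmorph_div s1Q s1S; fld.
Qed.

Let s1n : s1 n = n.
Proof.
have s1P : s1 P = P by rewrite /P fmorph_div n2 rmorphB fmorphV s1_ga; fld.
have s1R : s1 R = R by rewrite /R fmorph_div n2 rmorphD (fmorph_div s1 g) s1g s1z; fld.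
by rewrite /n rmorphD rmorphM s1m s1P s1R.
Qed.

Lemma purely_negative_positive :
  purely_transcendental iota (fun x => s1 x = x /\ s2 x = x).
Proof.
have [Ay Am An] := adj3 iota y m n; have A_sf := adj_sf iota [:: y; m; n].
set s := [:: y; m; n] in Am An Ay A_sf.
have [Tga Ty Tz] := adj3 iota ga y z; have T_sf := adj_sf iota [:: ga; y; z].
have fix2 x : adj [:: ga; y; z] x -> s2 x = x.
  apply: (@adj_sub _ _ _ _ (fun y => s2 y = y)); [exact: fix_sf | exact: s2C |].
  exact: forall_in_seq.
have s2g : s2 g = g by rewrite /g fmorph_div rmorphN rmorphB rmorphXn !s2C s2y.
have Tg : adj [:: ga; y; z] g by rewrite /g; adj_tac T_sf.
apply: (acl_full_purely indX (y1 := y) (y2 := m) (y3 := n)).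
  have D_sf := acl_sf iota s; have DC := aclC iota s.
  have Dm := acl_adj Am; have Dn := acl_adj An; have Dy := acl_adj Ay.
  have [DP DR] := PR_in D_sf DC Dy Dm Dn.
  have DQ : acl s Q by apply: acl_sqrt; rewrite PQ; sf_tac D_sf.
  apply: acl_full_trans full1; apply: forall_in_seq; split=> //.
  by split; [rewrite gaE | split=> //; rewrite zE]; sf_tac D_sf.
move=> x; split=> [[s1x s2x]|sx]; last first.
  split; first move: sx.
    apply: (@adj_sub _ _ _ _ (fun y => s1 y = y)); [exact: fix_sf | exact: s1C |].
    exact: forall_in_seq.
  apply: fix2; apply: adj_trans sx; apply: forall_in_seq; split=> //.
  have Tm : adj [:: ga; y; z] m by rewrite /m /S /Q; sf_tac T_sf.
  by split=> //; split=> //; rewrite /n /R /P; sf_tac T_sf.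
have AC k : adj s (iota k) by apply: adjC.
have [AP AR] := PR_in A_sf AC Ay Am An.
have AQ : adj s (Q ^+ 2) by rewrite PQ; adj_tac A_sf.
have Q_sf := quad_sf A_sf AQ; have Qin := fun z => @quad_in _ _ Q A_sf z.
have QQ := quad_root Q A_sf.
have QP := Qin _ AP; have QR := Qin _ AR; have Qm := Qin _ Am.
have Tal : adj [:: ga; y; z] (al ^+ 2) by rewrite alE; adj_tac T_sf.
have D_sf := quad_sf T_sf Tal; have Dal := quad_root al T_sf.
have Din := fun z => @quad_in _ _ al T_sf z.
have Dga := Din _ Tga; have Dy := Din _ Ty; have Dz := Din _ Tz.
apply: (fixed_sigma_tower (t := [:: ga; y; z]) (d2 := al) (d3 := Q)) => //.
- move=> w; apply: (@adj_sub _ _ _ _ (fun y => s1 y = y)); [exact: fix_sf | exact: s1C |].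
  exact: forall_in_seq.
- by rewrite beE; sf_tac D_sf.
- by rewrite X3E; sf_tac D_sf.
- apply: forall_in_seq; split; first by rewrite gaE; sf_tac Q_sf.
  split; first exact: Qin.
  by split=> //; rewrite zE; sf_tac Q_sf.
Qed.

End SecondSignPositive.

Section SecondSignNegative.

Hypothesis s23 : s2 X3 = - ic / X3.

(** The decomposition X3 = y + z al is as for the other sign of [e2], but s1 now negates y, and only
    y^2 is invariant. Odd parts are therefore divided by y, and the invariants are described by two
    conics over K(y^2), P^2 - y^2 Q^2 = -1 and R^2 - y^2 S^2 = (y^2 + c) / a, which do not split in
    general. *)
Let y := (X3 - ic / X3) / 2%:R.
Let z := (X3 + ic / X3) / (2%:R * al).
Let g := (y ^+ 2 + ic) / ia.

Let y0 : y != 0. Proof. by rewrite mulf_neq0 ?invr_eq0. Qed.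
Let z0 : z != 0.
Proof. by apply: mulf_neq0 => //; rewrite invr_eq0; apply: mulf_neq0. Qed.

Let alz : al ^+ 2 * z ^+ 2 = y ^+ 2 + ic. Proof. rewrite /z /y; fld. Qed.

Let yc : y ^+ 2 + ic != 0. Proof. by rewrite -alz mulf_neq0 ?expf_neq0. Qed.

Let g0 : g != 0. Proof. by rewrite mulf_neq0 ?invr_eq0. Qed.

Let alE : al ^+ 2 = (y ^+ 2 + ic) / z ^+ 2.
Proof. by rewrite -alz mulfK // expf_neq0. Qed.

Let X3E : X3 = y + z * al. Proof. rewrite /z /y; fld. Qed.

Let s2y : s2 y = y. Proof. rewrite /y fmorph_div n2 rmorphB fmorph_div s2C s23; fld. Qed.
Let s1y : s1 y = - y. Proof. rewrite /y fmorph_div n2 rmorphB fmorph_div s1C s13; fld. Qed.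

Let s2z : s2 z = z.
Proof. rewrite /z fmorph_div rmorphM n2 rmorphD (fmorph_div s2 ic) s2C s23 s2_al; fld. Qed.

Let s1z : s1 z = g / z.
Proof.
rewrite /g -alz {1}/z fmorph_div rmorphM n2 rmorphD (fmorph_div s1 ic) s1C s13 s1_al.
rewrite /z; fld.
Qed.

Let s1g : s1 g = g.
Proof. by rewrite /g fmorph_div rmorphD rmorphXn !s1C s1y sqrrN. Qed.

Let P := (ga - ga^-1) / 2%:R.
Let Q := (ga + ga^-1) / (2%:R * y).
Let R := (z + g / z) / 2%:R.
Let S := (z - g / z) / (2%:R * y).

Let full1 : acl_full [:: y; z; ga].
Proof.
set s := [:: _; _; _]; have B_sf := acl_sf iota s; have Bic := aclC iota s c.
have [Ay Az Aga] := adj3 iota y z ga.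
have By : acl s y by apply: acl_adj. have Bga : acl s ga by apply: acl_adj.
have Bz : acl s z by apply: acl_adj.
have Bal : acl s al by apply: acl_sqrt; rewrite alE; sf_tac B_sf.
by apply: acl_full_sigma; rewrite ?beE ?X3E; sf_tac B_sf.
Qed.

Let Q0 : Q != 0.
Proof.
rewrite /Q (_ : ga + ga^-1 = (ga ^+ 2 + 1) / ga); last by fld.
apply: mulf_neq0; last by rewrite invr_eq0; apply: mulf_neq0.
apply: mulf_neq0; last by rewrite invr_eq0.
rewrite addr_eq0 -(rmorph1 iota) -rmorphN.
exact: transc_sqr_neq (acl_full_transc indX full1).
Qed.

Let yE : y ^+ 2 = (P ^+ 2 + 1) / Q ^+ 2.
Proof.
have -> : P ^+ 2 + 1 = y ^+ 2 * Q ^+ 2 by rewrite /P /Q; fld.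
by rewrite mulfK // expf_neq0.
Qed.

Let gaE : ga = P + Q * y. Proof. rewrite /P /Q; fld. Qed.
Let zE : z = R + S * y. Proof. rewrite /R /S; fld. Qed.

(* With z = ia * S, these solve W1 = z W + (z^2 + a) u and u1 = W + z u, the change of
   variables that turns W1^2 - a c v1^2 = (P^2 + 1) (z^2 + a), up to scaling, into the
   equation of the threefold. *)
Definition sg_z := ia * S.
Definition sg_u := ia * (Q * R - S * P).
Definition sg_v := ia * Q.
Definition sg_W := ia * P - sg_z * sg_u.

Lemma sg_rel : sg_W ^+ 2 + ic * sg_v ^+ 2 = (sg_u ^+ 2 - ia) * (sg_z ^+ 2 + ia).
Proof.
have e1 : R ^+ 2 - y ^+ 2 * S ^+ 2 = (y ^+ 2 + ic) / ia by rewrite -/g /R /S; fld.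
have e2 : P ^+ 2 = y ^+ 2 * Q ^+ 2 - 1 by rewrite /P /Q; fld.
rewrite /sg_W /sg_u /sg_z /sg_v.
apply: (lin_eq (k := - ia ^+ 3 * Q ^+ 2) e1).
transitivity (ia ^+ 2 * (P ^+ 2 * (1 + ia * S ^+ 2)) - ia ^+ 3 * Q ^+ 2 * R ^+ 2 +
  ic * (ia * Q) ^+ 2 + ia * ((ia * S) ^+ 2 + ia)); first by ring.
rewrite e2; fld.
Qed.

Let SE : S = sg_z / ia. Proof. rewrite /sg_z; fld. Qed.
Let QE : Q = sg_v / ia. Proof. rewrite /sg_v; fld. Qed.
Let PE : P = (sg_W + sg_z * sg_u) / ia. Proof. rewrite /sg_W; fld. Qed.
Let RE : R = (sg_u / ia + S * P) / Q. Proof. rewrite /sg_u; fld. Qed.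

Let PQRS_in B : is_subfield B -> (forall k, B (iota k)) ->
  B sg_u -> B sg_z -> B sg_v -> B sg_W -> [/\ B P, B Q, B R & B S].
Proof.
move=> H HC Hu Hz Hv HW; have Ha := HC a.
have HP : B P by rewrite PE; sf_tac H.
have HQ : B Q by rewrite QE; sf_tac H.
have HS : B S by rewrite SE; sf_tac H.
by split=> //; rewrite RE; sf_tac H.
Qed.

Lemma sg_full : acl_full [:: sg_u; sg_z; sg_v].
Proof.
have [Au Az Av] := adj3 iota sg_u sg_z sg_v.
set s := [:: sg_u; sg_z; sg_v] in Au Az Av *.
have B_sf := acl_sf iota s; have BC := aclC iota s; have [Ba Bc] := (BC a, BC c).
have Bu := acl_adj Au; have Bz := acl_adj Az; have Bv := acl_adj Av.
have BW : acl s sg_W.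
  apply: acl_sqrt; rewrite (_ : sg_W ^+ 2 =
    (sg_u ^+ 2 - ia) * (sg_z ^+ 2 + ia) - ic * sg_v ^+ 2); first by sf_tac B_sf.
  by rewrite -sg_rel addrK.
have [BP BQ BR BS] := PQRS_in B_sf BC Bu Bz Bv BW.
have By : acl s y by apply: acl_sqrt; rewrite yE; sf_tac B_sf.
apply: acl_full_trans full1; apply: forall_in_seq; split=> //.
by split; [rewrite zE | split=> //; rewrite gaE]; sf_tac B_sf.
Qed.

Lemma sg_fixedP x : (s1 x = x /\ s2 x = x) <-> adj [:: sg_u; sg_z; sg_v; sg_W] x.
Proof.
set s := [:: _; _; _; _]; have A_sf := adj_sf iota s.
have Au : adj s sg_u by apply: adj_mem; rewrite mem_head.
have Az : adj s sg_z by apply: adj_mem; rewrite !inE eqxx orbT.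
have Av : adj s sg_v by apply: adj_mem; rewrite !inE eqxx !orbT.
have AW : adj s sg_W by apply: adj_mem; rewrite !inE eqxx !orbT.
have [Tga Ty Tz] := adj3 iota ga y z; have T_sf := adj_sf iota [:: ga; y; z].
have Tg : adj [:: ga; y; z] g by rewrite /g; adj_tac T_sf.
have fix2 w : adj [:: ga; y; z] w -> s2 w = w.
  apply: (@adj_sub _ _ _ _ (fun y => s2 y = y)); [exact: fix_sf | exact: s2C |].
  exact: forall_in_seq.
have s1P : s1 P = P by rewrite /P fmorph_div n2 rmorphB fmorphV s1_ga; fld.
have s1Q : s1 Q = Q by rewrite /Q fmorph_div rmorphM n2 s1y rmorphD fmorphV s1_ga; fld.
have s1R : s1 R = R by rewrite /R fmorph_div n2 rmorphD (fmorph_div s1 g) s1g s1z; fld.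
have s1S : s1 S = S.
  by rewrite /S fmorph_div rmorphM n2 s1y rmorphB (fmorph_div s1 g) s1g s1z; fld.
have fix1 w : adj s w -> s1 w = w.
  have F_sf := fix_sf s1; have Fa := s1C a.
  apply: (@adj_sub _ _ _ _ (fun y => s1 y = y)) => //; apply: forall_in_seq.
  have Fz : s1 sg_z = sg_z by rewrite /sg_z rmorphM s1C s1S.
  have Fu : s1 sg_u = sg_u by rewrite /sg_u rmorphM rmorphB (rmorphM s1 Q R) (rmorphM s1 S P) s1C
    s1P s1Q s1R s1S.
  split=> //; split=> //; split; first by rewrite /sg_v rmorphM s1C s1Q.
  by split=> //; rewrite /sg_W rmorphB (rmorphM s1 ia) (rmorphM s1 sg_z) s1C s1P Fz Fu.
split=> [[s1x s2x]|sx]; last first.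
  split; first exact: fix1.
  apply: fix2; apply: adj_trans sx; apply: forall_in_seq.
  have Tia : adj [:: ga; y; z] ia by apply: adjC.
  have TP : adj [:: ga; y; z] P by rewrite /P; sf_tac T_sf.
  have TQ : adj [:: ga; y; z] Q by rewrite /Q; sf_tac T_sf.
  have TR : adj [:: ga; y; z] R by rewrite /R; sf_tac T_sf.
  have TS : adj [:: ga; y; z] S by rewrite /S; sf_tac T_sf.
  have Tsz : adj [:: ga; y; z] sg_z by rewrite /sg_z; sf_tac T_sf.
  have Tsu : adj [:: ga; y; z] sg_u by rewrite /sg_u; sf_tac T_sf.
  split=> //; split=> //; split; first by rewrite /sg_v; sf_tac T_sf.
  by split=> //; rewrite /sg_W; sf_tac T_sf.
have AC k : adj s (iota k) by apply: adjC.
have [AP AQ AR AS] := PQRS_in A_sf AC Au Az Av AW.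
have Ay : adj s (y ^+ 2) by rewrite yE; sf_tac A_sf.
have Q_sf := quad_sf A_sf Ay; have Qin := fun z => @quad_in _ _ y A_sf z.
have Qy := quad_root y A_sf; have QP := Qin _ AP; have QR := Qin _ AR.
have QQ := Qin _ AQ; have QS := Qin _ AS.
have Tal : adj [:: ga; y; z] (al ^+ 2) by rewrite alE; adj_tac T_sf.
have D_sf := quad_sf T_sf Tal; have Dal := quad_root al T_sf.
have Din := fun z => @quad_in _ _ al T_sf z.
have Dga := Din _ Tga; have Dy := Din _ Ty; have Dz := Din _ Tz.
apply: (fixed_sigma_tower (t := [:: ga; y; z]) (d2 := al) (d3 := y)) => //.
- by rewrite beE; sf_tac D_sf.
- by rewrite X3E; sf_tac D_sf.
- apply: forall_in_seq; split; first by rewrite gaE; sf_tac Q_sf.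
  by split=> //; split=> //; rewrite zE; sf_tac Q_sf.
Qed.

End SecondSignNegative.

End FirstSignNegative.

End Sigma.

End FixedFields.

(** * Lowest terms, and the discriminant of the threefold over K(u, z, v) *)

Section CoprimeFractions.

Variables (K L : fieldType) (iota : {rmorphism K -> L}).
Variables (F : fieldType) (e : {rmorphism F -> L}) (s : seq L).
Hypothesis eM : image_of e (adj iota s).

Lemma adj_cons_coprime x y : adj iota (x :: s) y -> exists P Q,
  [/\ coprimep P Q, poly_ev e x Q != 0 & y = poly_ev e x P / poly_ev e x Q].
Proof.
move=> /(adj_cons_frac eM)[P [Q [Q0 ->]]].
have Qn0 : Q != 0 by apply: contraNneq Q0 => ->; rewrite rmorph0.
pose G := gcdp P Q.
have G0 : G != 0 by rewrite gcdp_eq0 negb_and Qn0 orbT.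
have PE : P = P %/ G * G by rewrite divpK // dvdp_gcdl.
have QE : Q = Q %/ G * G by rewrite divpK // dvdp_gcdr.
have eG : poly_ev e x G != 0.
  by apply: contraNneq Q0 => G1; rewrite QE rmorphM G1 mulr0.
have eQ : poly_ev e x (Q %/ G) != 0.
  by apply: contraNneq Q0 => G1; rewrite QE rmorphM G1 mul0r.
exists (P %/ G), (Q %/ G); split=> //.
  by rewrite coprimep_div_gcd // Qn0 orbT.
by rewrite {1}PE {1}QE !rmorphM -mulf_div divff // mulr1.
Qed.

Lemma transc_poly_inj x P Q : ~ acl iota s x ->
  poly_ev e x P = poly_ev e x Q -> P = Q.
Proof.
move=> tr /eqP; rewrite -subr_eq0 -rmorphB => /eqP/(transc_poly_ev eM tr)/eqP.
by rewrite subr_eq0 => /eqP.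
Qed.

End CoprimeFractions.

Section DiscriminantNotSquare.

Variables (K L : fieldType) (iota : {rmorphism K -> L}) (X1 X2 X3 : L).
Hypothesis indX : mindep iota 3 [:: X1; X2; X3].
Hypothesis genX : forall x, adj iota [:: X1; X2; X3] x.
Hypothesis two_neq0 : (2%:R : L) != 0.
Variables (a c : K).
Hypothesis c_neq0 : c != 0.

(** As a polynomial in X3 this is E - c X3^2, without linear term. In lowest terms a square root
    would be a polynomial of degree at most one; the vanishing of its cross term contradicts E != 0
    or c != 0. Hence W is truly quadratic over K(u, z, v), and the equation determines the field. *)
Lemma threefold_disc_nsqr g : g ^+ 2 !=
  (X1 ^+ 2 - iota a) * (X2 ^+ 2 + iota a) - iota c * X3 ^+ 2.
Proof.
have [tr1 tr2 tr3] := transc_X indX; apply/eqP=> gE.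
have [F [e eM]] := subfield_type (adj_sf iota [:: X1; X2]).
have Ag : adj iota [:: X3; X1; X2] g.
  apply: adj_trans (genX g); apply: forall_in_seq.
  by split; [|split; [|split]] => //; apply: adj_mem; rewrite !inE eqxx ?orbT.
have A_sf := adj_sf iota [:: X1; X2].
have A1 : adj iota [:: X1; X2] X1 by apply: adj_mem; rewrite mem_head.
have A2 : adj iota [:: X1; X2] X2 by apply: adj_mem; rewrite !inE eqxx orbT.
have /eM[E EE] : adj iota [:: X1; X2] ((X1 ^+ 2 - iota a) * (X2 ^+ 2 + iota a)).
  by adj_tac A_sf.
have /eM[d dE] : adj iota [:: X1; X2] (iota c) by apply: adjC.
have d0 : d != 0 by rewrite -(fmorph_eq0 e) -dE fmorph_eq0.
have E0 : E != 0.
  rewrite -(fmorph_eq0 e) -EE mulf_neq0 //.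
    by rewrite subr_eq0; apply: transc_sqr_neq tr1.
  by rewrite addr_eq0 -rmorphN; apply: transc_sqr_neq tr2.
have t0 : (2%:R : F) != 0 by rewrite -(fmorph_eq0 e) rmorph_nat.
have [P [Q [PQ Q0 gPQ]]] := adj_cons_coprime eM Ag.
have PE : P ^+ 2 = (E%:P - d%:P * 'X^2) * Q ^+ 2.
  apply: (transc_poly_inj eM tr3); move: gE; rewrite gPQ.
  rewrite !(rmorphXn (poly_ev e X3)) (rmorphM _ (_ - _)) rmorphB (rmorphM _ d%:P).
  rewrite !(rmorphXn (poly_ev e X3)) !poly_evC poly_evX -EE -dE => <-.
  by rewrite exprMn exprVn divfK ?expf_neq0.
have sQ : size Q = 1%N.
  apply/eqP; rewrite -coprimepp; rewrite -(coprimep_pexpl _ _ (isT : (0 < 2)%N)).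
  rewrite -(coprimep_pexpr _ _ (isT : (0 < 2)%N)).
  have : coprimep (P ^+ 2) (Q ^+ 2) by rewrite coprimep_pexpl // coprimep_pexpr.
  by rewrite PE coprimepMl => /andP[].
have [q q0 QE] := size_poly1P _ (introT eqP sQ).
have sP : (size P <= 2)%N.
  have : (size (P ^+ 2) <= 3)%N.
    rewrite PE QE -polyC_exp (mulrC (_ - _)) (mul_polyC (q ^+ 2)).
    apply: (leq_trans (size_scale_leq _ _)); apply: (leq_trans (size_polyD _ _)).
    rewrite geq_max size_polyN mul_polyC (leq_trans (size_polyC_leq1 _)) //.
    by rewrite (leq_trans (size_scale_leq _ _)) // size_polyXn.
  have [->|Pn0] := eqVneq P 0; first by rewrite size_poly0.
  rewrite expr2 size_mul //; case: (size P) => [|[|[|k]]] //.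
  by rewrite !addSn !addnS.
have PC : P = (P`_0)%:P + (P`_1)%:P * 'X.
  apply/polyP=> i; rewrite coefD coefC coefCM coefX.
  case: i => [|[|i]] /=; rewrite ?mulr0 ?addr0 ?mulr1 ?add0r //.
  by rewrite nth_default // (leq_trans sP).
have PE2 : P ^+ 2 = (P`_0 ^+ 2)%:P + (2%:R * P`_0 * P`_1)%:P * 'X + (P`_1 ^+ 2)%:P * 'X^2.
  by rewrite {1}PC !polyCM !polyCMn; ring.
have co i : (P ^+ 2)`_i = ((E%:P - d%:P * 'X^2) * Q ^+ 2)`_i by rewrite PE.
have c0 : P`_0 ^+ 2 = E * q ^+ 2.
  have := co 0%N; rewrite PE2 QE -polyC_exp coefMC !coefD coefN !coefC !coefCM coefX coefXn /=.
  by rewrite !mulr0 subr0 !addr0.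
have c1 : 2%:R * P`_0 * P`_1 = 0.
  have := co 1%N; rewrite PE2 QE -polyC_exp coefMC !coefD coefN !coefC !coefCM coefX coefXn /=.
  by rewrite !mulr0 subr0 !addr0 mulr1 add0r mul0r.
have c2 : P`_1 ^+ 2 = - d * q ^+ 2.
  have := co 2%N; rewrite PE2 QE -polyC_exp coefMC !coefD coefN !coefC !coefCM coefX coefXn /=.
  by rewrite !mulr0 !add0r !mulr1.
move/eqP: c1; rewrite !mulf_eq0 (negPf t0) /= => /orP[]/eqP z.
  by move/eqP: c0; rewrite z expr0n eq_sym mulf_eq0 (negPf E0) expf_eq0 (negPf q0).
move/eqP: c2; rewrite z expr0n eq_sym mulf_eq0 oppr_eq0 (negPf d0) expf_eq0.
by rewrite (negPf q0).
Qed.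

End DiscriminantNotSquare.

(** * Fields with the same presentation are simultaneously rational *)

Section Transfer.

Variables (K L : fieldType) (iota : {rmorphism K -> L}) (D : L).
Hypothesis D_nsqr : forall g, g ^+ 2 != D.

Section OneSide.

Variables (phi : {rmorphism L -> L}) (W : L).
Hypothesis WD : W ^+ 2 = phi D.

Lemma quad_eq0 A B : phi A + phi B * W = 0 -> A = 0 /\ B = 0.
Proof.
move=> e; have [B0|B0] := eqVneq B 0.
  by move: e; rewrite B0 rmorph0 mul0r addr0 => /eqP; rewrite fmorph_eq0 => /eqP.
have pB : phi B != 0 by rewrite fmorph_eq0.
have : (A / B) ^+ 2 = D.
  apply: (fmorph_inj phi); rewrite -WD rmorphXn fmorph_div.
  rewrite (_ : W = - (phi A / phi B)) ?sqrrN //.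
  by apply: (lin_eq (k := (phi B)^-1) e); field.
by move/eqP; rewrite (negPf (D_nsqr _)).
Qed.

End OneSide.

Variables (phi phi' : {rmorphism L -> L}) (W W' : L).
Hypotheses (phiC : forall k, phi (iota k) = iota k)
  (phiC' : forall k, phi' (iota k) = iota k).
Hypotheses (WD : W ^+ 2 = phi D) (WD' : W' ^+ 2 = phi' D).

(** The graph of the isomorphism between the two function fields, both identified with K(X1, X2,
    X3)(sqrt D). It is kept as a relation because the fields are predicates on L; as D is not a
    square, [corr_fun] and [corr_eq0] make it an injective function. *)
Definition corr g g' := exists A B,
  g = phi A + phi B * W /\ g' = phi' A + phi' B * W'.

Lemma corrB g g' h h' : corr g g' -> corr h h' -> corr (g - h) (g' - h').
Proof.
move=> [A [B [-> ->]]] [A2 [B2 [-> ->]]]; exists (A - A2), (B - B2).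
by rewrite !rmorphB; split; ring.
Qed.

Lemma corrM g g' h h' : corr g g' -> corr h h' -> corr (g * h) (g' * h').
Proof.
move=> [A [B [-> ->]]] [A2 [B2 [-> ->]]].
exists (A * A2 + B * B2 * D), (A * B2 + B * A2).
by rewrite !(rmorphD, rmorphM) -WD -WD'; split; ring.
Qed.

Lemma corrC k : corr (iota k) (iota k).
Proof. by exists (iota k), 0; rewrite !rmorph0 phiC phiC' !mul0r !addr0. Qed.

Lemma corr_eq0 g g' : corr g g' -> g = 0 <-> g' = 0.
Proof.
by move=> [A [B [-> ->]]]; split=> /(quad_eq0 _)[]// -> ->;
   rewrite !rmorph0 mul0r addr0.
Qed.

Lemma corrV g g' : corr g g' -> corr g^-1 g'^-1.
Proof.
move=> cg; have [g0|g0] := eqVneq g 0.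
  have /(corr_eq0 cg) -> := g0; rewrite g0 !invr0.
  by have := corrC 0; rewrite rmorph0.
have g'0 : g' != 0 by apply/eqP=> /(corr_eq0 cg)/eqP; rewrite (negPf g0).
case: cg g0 g'0 => A [B [-> ->]] g0 g'0.
have n0 : A ^+ 2 - B ^+ 2 * D != 0.
  apply/eqP=> e; have [B0|B0] := eqVneq B 0.
    move/eqP: e; rewrite B0 expr0n mul0r subr0 expf_eq0 /= => /eqP A0.
    by move: g0; rewrite A0 B0 !rmorph0 mul0r addr0 eqxx.
  have /eqP := D_nsqr (A / B); apply; apply: (lin_eq (k := B ^- 2) e).
  by field.
exists (A / (A ^+ 2 - B ^+ 2 * D)), (- B / (A ^+ 2 - B ^+ 2 * D)).
have norm (f : {rmorphism L -> L}) V : V ^+ 2 = f D -> f A + f B * V != 0 ->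
    (f A + f B * V)^-1 = f (A / (A ^+ 2 - B ^+ 2 * D)) + f (- B / (A ^+ 2 - B ^+ 2 * D)) * V.
  move=> Vf v0; have fn0 : f (A ^+ 2 - B ^+ 2 * D) != 0 by rewrite fmorph_eq0.
  have nE : f (A ^+ 2 - B ^+ 2 * D) = (f A + f B * V) * (f A - f B * V).
    by rewrite rmorphB rmorphXn rmorphM rmorphXn -Vf; ring.
  rewrite !fmorph_div nE rmorphN; move: fn0; rewrite nE mulf_eq0 negb_or => /andP[_ v1].
  by field; rewrite v0 v1.
by split; apply: norm.
Qed.

Lemma corr_div g g' h h' : corr g g' -> corr h h' -> corr (g / h) (g' / h').
Proof. by move=> gg hh; apply: corrM => //; apply: corrV. Qed.

Lemma corr_fun g g' g'' : corr g g' -> corr g g'' -> g' = g''.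
Proof.
move=> c1 c2; have /corr_eq0 := corrB c1 c2; rewrite subrr => -[/(_ erefl) e _].
by apply/eqP; rewrite -subr_eq0 e.
Qed.

Lemma transfer_purely (M M' : L -> Prop) :
    (forall x, M x <-> exists A B, x = phi A + phi B * W) ->
    (forall x, M' x <-> exists A B, x = phi' A + phi' B * W') ->
  purely_transcendental iota M -> purely_transcendental iota M'.
Proof.
move=> ME ME' [B [indB MB]].
have BM x : B x -> M x by move=> Bx; apply/MB; apply: adjoin_in.
pose B' x' := exists2 x, B x & corr x x'; exists B'; split.
  move=> n y' y'_inj yB p py.
  have [y yP] := @fin_all_exists _ _ (fun i x => B x /\ corr x (y' i))
    (fun i => let: ex_intro2 x Bx cx := yB i in ex_intro _ x (conj Bx cx)).
  have cp q : corr (mev iota y q) (mev iota y' q).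
    elim/mpolyind: q => [|k m q _ _ IH].
      by rewrite !rmorph0; have := corrC 0; rewrite rmorph0.
    rewrite !rmorphD -mul_mpolyC !rmorphM !mevC.
    rewrite -[X in corr _ (_ + X)]opprK -[X in corr (_ + X)]opprK; apply: corrB.
      apply: corrM; first exact: corrC.
      rewrite mpolyXE_id !rmorph_prod; apply: (big_ind2 corr).
      - by have := corrC 1; rewrite rmorph1.
      - by move=> *; apply: corrM.
      move=> i _; rewrite !rmorphXn !mevX; elim: (m i) => [|j IHj].
        by rewrite !expr0; have := corrC 1; rewrite rmorph1.
      by rewrite !exprS; apply: corrM => //; case: (yP i).
    rewrite -[- mev iota y q]sub0r -[- mev iota y' q]sub0r; apply: corrB => //.
    by have := corrC 0; rewrite rmorph0.
  apply: (indB n y) => [i j yij|i|]; first by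
    apply: y'_inj; apply: corr_fun (yP i).2 _; rewrite yij; exact: (yP j).2.
    by case: (yP i).
  by rewrite -mevE; apply/(corr_eq0 (cp p)); rewrite mevE.
have adj_corr x : adjoin iota B x -> exists2 x', corr x x' & adjoin iota B' x'.
  have A_sf := adjoin_sf iota B'.
  move=> Ax; apply: (Ax (fun x => exists2 x', corr x x' & adjoin iota B' x')).
    split; first by exists 1; [have := corrC 1; rewrite rmorph1 | exact: (sf1 A_sf)].
      move=> g h [g' cg Ag] [h' ch Ah]; exists (g' - h'); first exact: corrB.
      exact: (sfB A_sf).
    move=> g h [g' cg Ag] [h' ch Ah]; exists (g' / h'); first exact: corr_div.
    exact: (sf_div A_sf).
    by move=> k; exists (iota k); [exact: corrC | move=> N _ NK _; exact: NK].
  move=> b Bb; have /ME[P [Q bE]] := BM b Bb; exists (phi' P + phi' Q * W').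
    by exists P, Q.
  by apply: adjoin_in; exists b => //; exists P, Q.
move=> x'; split=> [/ME'[P [Q x'E]]|].
  have /MB/adj_corr[x'' cx Ax] : M (phi P + phi Q * W) by apply/ME; exists P, Q.
  suff -> : x' = x'' by [].
  by apply: corr_fun cx; exists P, Q.
have c'_sf : is_subfield (fun x' => exists x, corr x x').
  split; first by exists 1; have := corrC 1; rewrite rmorph1.
    by move=> g h [g' cg] [h' ch]; exists (g' - h'); apply: corrB.
  by move=> g h [g' cg] [h' ch]; exists (g' / h'); apply: corr_div.
move=> Ax; have [x [P [Q [_ ->]]]] : exists x, corr x x'.
  apply: (Ax (fun x' => exists x, corr x x')) => //; first by move=> k; exists (iota k);
    apply: corrC.
  by move=> b [x _ cx]; exists x.
by apply/ME'; exists P, Q.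
Qed.

End Transfer.

(** * Sums of two squares of polynomials *)

Section Irreducible.

Variable F : fieldType.
Implicit Types p q : {poly F}.

Lemma irreducible_dvdVcoprime p q : irreducible_poly p -> p %| q \/ coprimep p q.
Proof.
move=> [sp ip]; have [c|nc] := boolP (coprimep p q); [by right | left].
have /ip : size (gcdp p q) != 1%N by [].
by move/(_ (dvdp_gcdl _ _))/eqp_dvdl <-; apply: dvdp_gcdr.
Qed.

Lemma irreducible_dvdM p q r : irreducible_poly p ->
  p %| q * r -> p %| q \/ p %| r.
Proof.
move=> ip d; have [|c] := irreducible_dvdVcoprime q ip; first by left.
by right; rewrite -(Gauss_dvdpr _ c).
Qed.

Lemma irreducible_dvdX p q : irreducible_poly p -> p %| q ^+ 2 -> p %| q.
Proof. by move=> ip; rewrite expr2 => /(irreducible_dvdM ip)[]. Qed.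

Lemma irreducible_factor p : (1 < size p)%N ->
  exists q, irreducible_poly q /\ q %| p.
Proof.
have [n] := ubnP (size p); elim: n p => // n IH p; rewrite ltnS => le_pn sp.
have [ip|nip] := excluded_middle_informative (irreducible_poly p).
  by exists p; rewrite dvdpp.
have [q [sq dq nq]] : exists q, [/\ size q != 1%N, q %| p & ~~ (q %= p)].
  apply: NNPP => nex; apply: nip; split=> // q sq dq.
  by apply/negPn/negP=> nq; apply: nex; exists q.
have p0 : p != 0 by rewrite -size_poly_gt0 ltnW.
have q0 : q != 0 by apply: contraTneq dq => ->; rewrite dvd0p.
have lt_qp : (size q < size p)%N.
  rewrite ltn_neqAle dvdp_leq // andbT; apply: contra nq => e.
  by rewrite -dvdp_size_eqp.
have [||r [ir rq]] := IH q; first exact: leq_trans lt_qp le_pn.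
  by rewrite ltn_neqAle eq_sym sq size_poly_gt0.
by exists r; split=> //; apply: dvdp_trans rq dq.
Qed.

End Irreducible.

Section TwoSquares.

Variable F : fieldType.
Hypothesis N1_nsqr : forall x : F, x ^+ 2 != -1.
Implicit Types (f h p q r s m A B : {poly F}).

Lemma two_sqr_eq0 (x y : F) : x ^+ 2 + y ^+ 2 = 0 -> x = 0 /\ y = 0.
Proof.
move=> e; have [y0|y0] := eqVneq y 0.
  by move/eqP: e; rewrite y0 expr0n addr0 expf_eq0 => /eqP.
have /eqP[] := N1_nsqr (x / y); apply: (lin_eq (k := y ^- 2) e).
by field.
Qed.

Lemma two_sqr_poly_eq0 A B : A ^+ 2 + B ^+ 2 = 0 -> A = 0 /\ B = 0.
Proof.
move=> e; have [B0|B0] := eqVneq B 0.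
  by move/eqP: e; rewrite B0 expr0n addr0 expf_eq0 => /eqP.
have lB : lead_coef B != 0 by rewrite lead_coef_eq0.
have : lead_coef A ^+ 2 = - lead_coef B ^+ 2.
  by rewrite -!lead_coef_exp -lead_coefN; congr lead_coef; apply/eqP; rewrite -addr_eq0 e.
move=> l; have /two_sqr_eq0[_ /eqP] : lead_coef A ^+ 2 + lead_coef B ^+ 2 = 0.
  by rewrite l addNr.
by rewrite (negPf lB).
Qed.

(* [Nm f]: up to a constant, f is a sum of two squares in the field F(y). *)
Definition Nm f := exists (g : F) m A B,
  [/\ g != 0, m != 0 & f * m ^+ 2 = g%:P * (A ^+ 2 + B ^+ 2)].

Lemma NmM f h : Nm f -> Nm h -> Nm (f * h).
Proof.
move=> [g [m [A [B [g0 m0 e]]]]] [g' [m' [A' [B' [g0' m0' e']]]]].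
exists (g * g'), (m * m'), (A * A' - B * B'), (A * B' + B * A').
split; rewrite ?mulf_neq0 // polyCM.
transitivity ((f * m ^+ 2) * (h * m' ^+ 2)); first by ring.
by rewrite e e'; ring.
Qed.

Lemma NmC (g : F) : g != 0 -> Nm g%:P.
Proof.
move=> g0; exists g, 1, 1, 0; rewrite oner_eq0; split=> //.
by rewrite expr1n expr0n addr0.
Qed.

Lemma NmX p : Nm (p ^+ 2).
Proof.
exists 1, 1, p, 0; rewrite !oner_eq0; split=> //.
by rewrite expr1n expr0n addr0 mulr1 mul1r.
Qed.

Lemma Nm_div f h : h != 0 -> Nm (f * h) -> Nm h -> Nm f.
Proof.
move=> h0 fh Nh; have [g [m [A [B [g0 m0 e]]]]] := NmM fh Nh.
exists g, (h * m), A, B; split; rewrite ?mulf_neq0 // -e; ring.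
Qed.

(** For irreducible p this says that -1 is not a square in the residue field F[y] / (p), so p stays
    prime over F(i). *)
Definition inert p := forall r s, p %| r ^+ 2 + s ^+ 2 -> p %| r /\ p %| s.

(** A sum of two squares has even valuation at an inert prime. Both A and B are divisible by p; if m
    is too, all three are divided by p and the size of m drops, otherwise p^2 divides f. *)
Lemma inert_sqr_dvd p f : irreducible_poly p -> inert p -> Nm f ->
  p %| f -> p ^+ 2 %| f.
Proof.
move=> ip np [g [m [A [B [g0 m0 e]]]]] pf.
have p0 : p != 0 by case: ip => sp _; rewrite -size_poly_gt0 ltnW.
have [n] := ubnP (size m); elim: n m A B m0 e => // n IH m A B m0 e le_mn.
have pAB : p %| A ^+ 2 + B ^+ 2.
  have : p %| g%:P * (A ^+ 2 + B ^+ 2) by rewrite -e dvdp_mulr.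
  by rewrite mul_polyC dvdpZr.
have [/dvdpP[A' AE] /dvdpP[B' BE]] := np _ _ pAB.
have [/dvdpP[m' mE]|pm] := irreducible_dvdVcoprime m ip.
  apply: (IH m' A' B'); first by apply: contraNneq m0; rewrite mE => ->; rewrite mul0r.
    apply: (mulfI (expf_neq0 2 p0)).
    transitivity (f * m ^+ 2); first by rewrite mE; ring.
    by rewrite e AE BE; ring.
  have m'0 : m' != 0 by apply: contraNneq m0; rewrite mE => ->; rewrite mul0r.
  rewrite -ltnS (leq_trans _ le_mn) // ltnS mE size_mul //; case: ip => sp _.
  by case: (size p) sp => [|[|k]] // _; rewrite !addnS /= ltnS leq_addr.
have : p ^+ 2 %| f * m ^+ 2 by rewrite e AE BE; apply/dvdpP; exists (g%:P * (A' ^+ 2 + B' ^+ 2));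
  ring.
by rewrite Gauss_dvdpl // coprimep_pexpl // coprimep_pexpr.
Qed.

(** Induction on the degree of f, one prime p of f at a time. An inert p does not divide h, so p^2
    divides f and is cancelled. A prime p that is not inert divides some r^2 + s^2; reduction modulo
    p gives t p = r'^2 + s'^2 with t of smaller degree, so t and then p satisfy [Nm], and p is
    cancelled. *)
Lemma Nm_descent f h : f != 0 -> h != 0 -> Nm (f * h) ->
    (forall p, irreducible_poly p -> p %| f -> p %| h -> ~ inert p) ->
  Nm f.
Proof.
have [n] := ubnP (size f); elim: n f h => // n IH f h; rewrite ltnS.
move=> le_fn f0 h0 Nfh common; have [sf|sf] := leqP (size f) 1.
  by rewrite (size1_polyC sf) in f0 *; apply: NmC; rewrite polyC_eq0 in f0.
have [p [ip pf]] := irreducible_factor sf.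
have sp : (1 < size p)%N by case: ip.
have p0 : p != 0 by rewrite -size_poly_gt0 ltnW.
have size_quo q r : f = q * r -> (1 < size r)%N -> (size q < n)%N.
  move=> fE sr; rewrite (leq_trans _ le_fn) // fE.
  have r0 : r != 0 by rewrite -size_poly_gt0 ltnW.
  have q0 : q != 0 by apply: contraNneq f0; rewrite fE => ->; rewrite mul0r.
  rewrite size_mul //; case: (size r) sr => [|[|k]] // _.
  by rewrite !addnS /= ltnS leq_addr.
have [np|nnp] := excluded_middle_informative (inert p).
  have pnh : ~ p %| h by move=> ph; apply: (common p).
  have /dvdpP[q fE] : p ^+ 2 %| f.
    have : p ^+ 2 %| f * h by apply: inert_sqr_dvd => //; apply: dvdp_mulr.
    have [//|ph] := irreducible_dvdVcoprime h ip.
    by rewrite Gauss_dvdpl // coprimep_pexpl.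
  have q0 : q != 0 by apply: contraNneq f0; rewrite fE => ->; rewrite mul0r.
  rewrite fE; apply: NmM; last exact: NmX.
  apply: (IH q h) => //.
  - apply: (size_quo _ _ fE); rewrite expr2 size_mul //.
    by case: (size p) sp => [|[|k]] // _; rewrite !addnS.
  - apply: (@Nm_div _ (p ^+ 2)); [exact: expf_neq0 | | exact: NmX].
    by rewrite mulrAC -fE.
  - by move=> p' ip' p'q; apply: common => //; rewrite fE dvdp_mulr.
have Np : Nm p.
  have [r [s [prs nrs]]] : exists r s, p %| r ^+ 2 + s ^+ 2 /\ ~ (p %| r /\ p %| s).
    apply: NNPP => nex; apply: nnp => r s prs.
    by apply: NNPP => nrs; apply: nex; exists r, s.
  pose r' := r %% p; pose s' := s %% p.
  have /dvdpP[t tE] : p %| r' ^+ 2 + s' ^+ 2.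
    rewrite (_ : r' ^+ 2 + s' ^+ 2 = r ^+ 2 + s ^+ 2 -
      p * ((r %/ p) * (r + r') + (s %/ p) * (s + s'))); first by rewrite dvdp_sub ?dvdp_mulr.
    have rE : r = r %/ p * p + r' by rewrite -divp_eq.
    have sE : s = s %/ p * p + s' by rewrite -divp_eq.
    rewrite [in r ^+ 2]rE [in s ^+ 2]sE [in r + _]rE [in s + _]sE.
    by ring.
  have t0 : t != 0.
    apply/eqP=> t0; move: tE; rewrite t0 mul0r => /two_sqr_poly_eq0[/eqP r0 /eqP s0].
    by apply: nrs; rewrite /dvdp -/r' -/s' r0 s0.
  have lt_tp : (size t < size p)%N.
    have sr : (size r' < size p)%N by rewrite ltn_modp.
    have ss : (size s' < size p)%N by rewrite ltn_modp.
    have sz (u : {poly F}) : (size u < size p)%N -> (size (u ^+ 2) <= ((size p).-2).*2.+1)%N.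
      move=> su; apply: (leq_trans (size_exp_leq _ _)); rewrite ltnS muln2 leq_double.
      by rewrite -subn1 leq_subLR add1n; case: (size p) sp su => [|[|k]].
    have : (size (t * p)%R <= ((size p).-2).*2.+1)%N.
      by rewrite -tE (leq_trans (size_polyD _ _)) // geq_max !sz.
    rewrite size_mul //; case: (size p) sp => [|[|k]] //= _.
    rewrite !addnS /= ltnS -addnn leq_add2r => /leq_trans; apply.
    exact: leqnSn.
  have Nt : Nm t.
    (* Used with [h := p]: a prime common to t and p would be associate to p, which is too large to
       divide t. *)
    apply: (IH t p) => //; first exact: leq_trans lt_tp (leq_trans (dvdp_leq f0 pf) le_fn).
      by rewrite -tE; exists 1, 1, r', s'; rewrite !oner_eq0 expr1n mulr1 mul1r.
    move=> p' ip' p't p'p; have /ip.2 : size p' != 1%N by case: ip' => + _;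
      case: (size p') => [|[]].
    move=> /(_ p'p)/eqp_size e; have := dvdp_leq t0 p't.
    by rewrite e leqNgt lt_tp.
  apply: (Nm_div t0) => //.
  by rewrite mulrC -tE; exists 1, 1, r', s'; rewrite !oner_eq0 expr1n mulr1 mul1r.
have /dvdpP[q fE] := pf.
have q0 : q != 0 by apply: contraNneq f0; rewrite fE => ->; rewrite mul0r.
rewrite fE; apply: NmM => //; apply: (IH q h) => //.
- exact: size_quo fE sp.
- by apply: (Nm_div p0) => //; rewrite mulrAC -fE.
- by move=> p' ip' p'q; apply: common => //; rewrite fE dvdp_mulr.
Qed.

(** Modulo a common prime w of the two factors, a is (p / q)^2 and -a is (r / s)^2, so -1 is a
    square there. Without division: w divides (p s)^2 + (q r)^2, and if w were inert it would divide
    p and q, or r and s, against coprimality. *)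
Lemma Nm_norm_forms (a : F) p q r s : a != 0 ->
    (forall x : F, x ^+ 2 != a) -> (forall x : F, x ^+ 2 != - a) ->
    coprimep p q -> coprimep r s ->
    Nm ((p ^+ 2 - a%:P * q ^+ 2) * (r ^+ 2 + a%:P * s ^+ 2)) ->
  Nm (p ^+ 2 - a%:P * q ^+ 2).
Proof.
move=> a0 na nNa pq rs N.
have aniso (b : F) u v : (forall x : F, x ^+ 2 != b) -> coprimep u v -> u ^+ 2 - b%:P * v ^+ 2 != 0.
  move=> nb uv; apply/eqP=> /eqP; rewrite subr_eq0 => /eqP e.
  have [v0|v0] := eqVneq v 0.
    move: uv e; rewrite v0 coprimep0 expr0n mulr0 => /eqp_size; rewrite size_poly1.
    move=> su /eqP; rewrite expf_eq0 /= => /eqP u0.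
    by move: su; rewrite u0 size_poly0.
  have lv : lead_coef v != 0 by rewrite lead_coef_eq0.
  have l : lead_coef u ^+ 2 = b * lead_coef v ^+ 2.
    by rewrite -!lead_coef_exp e lead_coefM lead_coefC.
  have /eqP := nb (lead_coef u / lead_coef v); apply.
  by rewrite exprMn l exprVn mulfK ?expf_neq0.
have d1 := aniso a p q na pq.
have d2 : r ^+ 2 + a%:P * s ^+ 2 != 0.
  by have := aniso (- a) r s nNa rs; rewrite polyCN mulNr opprK.
apply: (Nm_descent d1 d2 N) => w iw w1 w2 nw.
have [|ws wr] := nw (p * s) (q * r).
  rewrite (_ : _ + _ = (p ^+ 2 - a%:P * q ^+ 2) * s ^+ 2 + q ^+ 2 * (r ^+ 2 + a%:P * s ^+ 2)).
    by apply: dvdp_add; [apply: dvdp_mulr | apply: dvdp_mull].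
  by ring.
have sw : size w != 1%N by case: iw => + _; case: (size w) => [|[]].
have not_both u v : coprimep u v -> w %| u -> w %| v -> False.
  by move=> uv wu wv; move/negP: sw; apply; rewrite -(coprimepp w);
    apply: coprimep_dvdl wv (coprimep_dvdr wu uv).
have a0' : a%:P != 0 by rewrite polyC_eq0.
have [wp|wns] := irreducible_dvdM iw ws.
  apply: (not_both p q) => //; apply: (irreducible_dvdX iw).
  rewrite -(dvdpZr _ _ a0) -mul_polyC.
  rewrite (_ : _ * _ = p ^+ 2 - (p ^+ 2 - a%:P * q ^+ 2)); last by ring.
  by rewrite dvdp_sub // expr2 dvdp_mulr.
apply: (not_both r s) => //; apply: (irreducible_dvdX iw).
rewrite (_ : r ^+ 2 = (r ^+ 2 + a%:P * s ^+ 2) - a%:P * s ^+ 2); last by ring.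
by rewrite dvdp_sub // dvdp_mull // expr2 dvdp_mulr.
Qed.

End TwoSquares.

(** * Unramified elements of rational function fields *)

Section SumOfSquares.

Variables (L : fieldType) (M : L -> Prop).
Hypothesis M_sf : is_subfield M.

Definition sos (y : L) := exists A B, [/\ M A, M B & y = A ^+ 2 + B ^+ 2].

Lemma sos_sqr x : M x -> sos (x ^+ 2).
Proof.
move=> Mx; exists x, 0; split=> //; first exact: sf0.
by rewrite expr0n addr0.
Qed.

Lemma sosM x y : sos x -> sos y -> sos (x * y).
Proof.
move=> [A [B [MA MB ->]]] [A' [B' [MA' MB' ->]]].
by exists (A * A' - B * B'), (A * B' + B * A'); split; [sf_tac M_sf.. | ring].
Qed.

Lemma sos_in x : sos x -> M x.
Proof. by move=> [A [B [MA MB ->]]]; sf_tac M_sf. Qed.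

Lemma sosV x : sos x -> sos x^-1.
Proof.
move=> sx; have [->|x0] := eqVneq x 0.
  by rewrite invr0; have := sos_sqr (sf0 M_sf); rewrite expr0n.
rewrite (_ : x^-1 = x * x^-1 ^+ 2); last by field.
by apply: sosM => //; apply: sos_sqr; apply: sfV => //; apply: sos_in.
Qed.

End SumOfSquares.

Lemma dvdX_root0 (F : fieldType) (p : {poly F}) : p.[0] = 0 -> exists q, p = q * 'X.
Proof.
move=> p0; have /dvdpP[q pE] : ('X - 0%:P) %| p by rewrite dvdp_XsubCl; apply/rootP.
by exists q; rewrite pE subr0.
Qed.

Section Specialize.

Variable F : fieldType.
Hypothesis N1_nsqr : forall x : F, x ^+ 2 != -1.

(** Where the denominator m vanishes at 0, so does A^2 + B^2, hence A and B do since -1 is not a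
    square; the common factor X is cancelled until m does not vanish. *)
Lemma two_sqr_at0 (g : F) (f m A B : {poly F}) : m != 0 -> g != 0 ->
    f * m ^+ 2 = g%:P * (A ^+ 2 + B ^+ 2) ->
  exists x y : F, f.[0] = g * (x ^+ 2 + y ^+ 2).
Proof.
move=> m0 g0; have [n] := ubnP (size m); elim: n m A B m0 => // n IH m A B m0 le_mn e.
have e0 : f.[0] * m.[0] ^+ 2 = g * (A.[0] ^+ 2 + B.[0] ^+ 2).
  by have := congr1 (fun p => p.[0]) e; rewrite /= !(hornerM, hornerD, hornerC, horner_exp).
have [mz|mz] := eqVneq m.[0] 0; last first.
  exists (A.[0] / m.[0]), (B.[0] / m.[0]).
  by apply: (lin_eq (k := m.[0] ^- 2) e0); field.
move/esym/eqP: e0; rewrite mz expr0n mulr0 mulf_eq0 (negPf g0) /= => /eqP.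
move=> /(two_sqr_eq0 N1_nsqr)[/dvdX_root0[A' AE] /dvdX_root0[B' BE]].
have [m' mE] := dvdX_root0 mz.
have m'0 : m' != 0 by apply: contraNneq m0; rewrite mE => ->; rewrite mul0r.
apply: (IH m' A' B') => //; first by rewrite -ltnS (leq_trans _ le_mn) // mE size_mulX.
have X2 : ('X ^+ 2 : {poly F}) != 0 by rewrite expf_neq0 // polyX_eq0.
apply: (mulfI X2); transitivity (f * m ^+ 2); first by rewrite mE; ring.
by rewrite e AE BE; ring.
Qed.

End Specialize.

Section UnramifiedStep.

Variables (K L : fieldType) (iota : {rmorphism K -> L}) (a : K).
Hypothesis a0 : a != 0.
Hypotheses (N1_nsqr : forall x : L, x ^+ 2 != -1)
  (a_nsqr : forall x : L, x ^+ 2 != iota a)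
  (Na_nsqr : forall x : L, x ^+ 2 != - iota a).

Local Notation adj := (adj iota).
Local Notation ia := (iota a).

(* The pairs (p, q) and (r, t) are homogeneous coordinates of u and z in
   W^2 + V^2 = (u^2 - a)(z^2 + a). *)
Definition unramified (s : seq L) := forall p q r t,
  adj s p -> adj s q -> adj s r -> adj s t ->
  (p != 0) || (q != 0) -> (r != 0) || (t != 0) ->
  sos (adj s) ((p ^+ 2 - ia * q ^+ 2) * (r ^+ 2 + ia * t ^+ 2)) ->
  exists lam y, [/\ lam != 0, sos (adj s) y & p ^+ 2 - ia * q ^+ 2 = iota lam * y].

Lemma norm_neq0 (b p q : L) : (forall x : L, x ^+ 2 != b) ->
  (p != 0) || (q != 0) -> p ^+ 2 - b * q ^+ 2 != 0.
Proof.
move=> nb pq; rewrite subr_eq0; have [q0|q0] := eqVneq q 0.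
  by move: pq; rewrite q0 eqxx orbF expr0n mulr0; apply: expf_neq0.
apply: contraNneq (nb (p / q)) => e.
by rewrite exprMn e exprVn mulfK ?expf_neq0.
Qed.

Lemma adj_nil x : adj [::] x -> exists k, x = iota k.
Proof.
apply: (adj_sub (M := fun x => exists k, x = iota k)) => //; last by move=> k; exists k.
split; first by exists 1; rewrite rmorph1.
  by move=> _ _ [k ->] [l ->]; exists (k - l); rewrite rmorphB.
by move=> _ _ [k ->] [l ->]; exists (k / l); rewrite fmorph_div.
Qed.

Lemma unramified_nil : unramified [::].
Proof.
move=> p q r t /adj_nil[p' pE] /adj_nil[q' qE] _ _ pq _ _.
exists (p' ^+ 2 - a * q' ^+ 2), 1; split.
- by rewrite -(fmorph_eq0 iota) rmorphB rmorphXn rmorphM rmorphXn -pE -qE norm_neq0.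
- by rewrite -(expr1n _ 2); apply: sos_sqr (sf1 _); apply: adj_sf.
- by rewrite mulr1 rmorphB rmorphXn rmorphM rmorphXn -pE -qE.
Qed.

Section Step.

Variables (s : seq L) (x : L).
Hypothesis tr : ~ acl iota s x.
Variables (F : fieldType) (e : {rmorphism F -> L}).
Hypothesis eM : image_of e (adj s).

Let ev := poly_ev e x.

Let adjS y : adj s y -> adj (x :: s) y.
Proof. by apply: adj_trans => z zs; apply: adj_mem; rewrite inE zs orbT. Qed.

Let FN1 (y : F) : y ^+ 2 != -1.
Proof. by rewrite -(inj_eq (fmorph_inj e)) rmorphXn rmorphN1. Qed.

Lemma sos_adj_poly y f : sos (adj (x :: s)) y -> y = ev f ->
  exists m A B, m != 0 /\ f * m ^+ 2 = A ^+ 2 + B ^+ 2.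
Proof.
move=> [A [B [/(adj_cons_frac eM)[A1 [A2 [A20 ->]]] /(adj_cons_frac eM)[B1 [B2 [B20 ->]]] ->]]].
move=> yf; exists (A2 * B2), (A1 * B2), (B1 * A2); split.
  by apply: contraTneq (mulf_neq0 A20 B20) => e0; rewrite -rmorphM e0 rmorph0 eqxx.
apply: (transc_poly_inj eM tr); rewrite rmorphM -/ev -yf rmorphD !rmorphXn !rmorphM.
by field; rewrite A20 B20.
Qed.

Lemma sos_const_descent y : adj s y -> sos (adj (x :: s)) y -> sos (adj s) y.
Proof.
move=> /eM[k ->] sy; have [|m [A [B [m0 mE]]]] := @sos_adj_poly _ k%:P sy.
  by rewrite /ev poly_evC.
have [||u [v kE]] := @two_sqr_at0 _ FN1 1 k%:P m A B m0.
- by rewrite oner_eq0.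
- by rewrite mE mul1r.
move: kE; rewrite hornerC mul1r => ->; exists (e u), (e v).
by split; [apply/eM; exists u | apply/eM; exists v | rewrite rmorphD !rmorphXn].
Qed.

(** The factor f equals g times a sum of two squares, with g in K(s) rather than K. Setting x = 0
    preserves the hypotheses, so f(0) is a constant of K times a sum of two squares by induction;
    since f(0) is also g times such a sum, so is g. *)
Lemma unramified_step : unramified s -> unramified (x :: s).
Proof.
move=> IH p q r t Ap Aq Ar At pq rt sos0.
have A_sf := adj_sf iota (x :: s); have S_sf := adj_sf iota s.
have A1 : adj (x :: s) 1 by apply: sf1.
have [q0|q0] := eqVneq q 0.
  exists 1, (p ^+ 2); rewrite oner_eq0 q0 expr0n mulr0 subr0 rmorph1 mul1r.
  by split=> //; apply: sos_sqr.
have [t0|t0] := eqVneq t 0.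
  move: rt sos0; rewrite t0 eqxx orbF expr0n mulr0 addr0 => r0 sos0.
  exists 1, (p ^+ 2 - ia * q ^+ 2); rewrite oner_eq0 rmorph1 mul1r; split=> //.
  rewrite -(mulfK (expf_neq0 2 r0) (_ - _)); apply: sosM => //; apply: sosV => //.
  exact: sos_sqr.
have [|P [Q [PQ Q0 pE]]] := @adj_cons_coprime _ _ iota _ e s eM x (p / q).
  exact: (sf_div A_sf).
have [|R [T [RT T0 rE]]] := @adj_cons_coprime _ _ iota _ e s eM x (r / t).
  exact: (sf_div A_sf).
have /eM[b bE] : adj s ia by apply: adjC.
have b0 : b != 0 by rewrite -(fmorph_eq0 e) -bE fmorph_eq0.
have nb (y : F) : y ^+ 2 != b by rewrite -(inj_eq (fmorph_inj e)) rmorphXn -bE.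
have nNb (y : F) : y ^+ 2 != - b.
  by rewrite -(inj_eq (fmorph_inj e)) rmorphXn rmorphN -bE.
pose f := P ^+ 2 - b%:P * Q ^+ 2; pose h := R ^+ 2 + b%:P * T ^+ 2.
have fE : p ^+ 2 - ia * q ^+ 2 = (q / ev Q) ^+ 2 * ev f.
  rewrite /f rmorphB rmorphXn rmorphM rmorphXn /ev poly_evC -bE -/ev.
  rewrite (_ : ev P = p / q * ev Q); last by rewrite pE divfK.
  by field; rewrite Q0 q0.
have hE : r ^+ 2 + ia * t ^+ 2 = (t / ev T) ^+ 2 * ev h.
  rewrite /h rmorphD rmorphXn rmorphM rmorphXn /ev poly_evC -bE -/ev.
  rewrite (_ : ev R = r / t * ev T); last by rewrite rE divfK.
  by field; rewrite T0 t0.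
have AQ : adj (x :: s) (ev Q) by apply: adj_poly_ev.
have AT : adj (x :: s) (ev T) by apply: adj_poly_ev.
have [|m [A [B [m0 mE]]]] := @sos_adj_poly (ev (f * h)) (f * h) _ erefl.
  rewrite rmorphM (_ : ev f * ev h = (p ^+ 2 - ia * q ^+ 2) * (r ^+ 2 + ia * t ^+ 2) *
    (ev Q / q * (ev T / t)) ^+ 2); last by rewrite fE hE; field; rewrite q0 Q0 t0 T0.
  by apply: sosM => //; apply: sos_sqr => //; sf_tac A_sf.
have Nfh : Nm (f * h) by exists 1, m, A, B; rewrite oner_eq0 mE mul1r.
have [g [n [C [D [g0 n0 nE]]]]] : Nm f by apply: Nm_norm_forms Nfh.
have [u [v uvE]] := two_sqr_at0 FN1 n0 g0 nE.
have [||u' [v' uvE']] := @two_sqr_at0 _ FN1 1 (f * h) m A B m0.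
- by rewrite oner_eq0.
- by rewrite mE mul1r.
(* This is why [unramified] uses homogeneous coordinates: u = P / Q may have a pole at x = 0, but
   the pair (P, Q) does not vanish there. *)
have nz0 (U V : {poly F}) : coprimep U V -> (e U.[0] != 0) || (e V.[0] != 0).
  move=> UV; rewrite !fmorph_eq0 -negb_and; apply/negP=> /andP[/rootP U0 /eqP V0].
  by have := coprimep_root UV (introT rootP U0); rewrite V0 eqxx.
have inF (y : F) : adj s (e y) by apply/eM; exists y.
have f0E : e f.[0] = e P.[0] ^+ 2 - ia * e Q.[0] ^+ 2.
  by rewrite /f hornerD hornerN horner_exp hornerM horner_exp hornerC rmorphB rmorphXn rmorphM
    rmorphXn -bE.
have h0E : e h.[0] = e R.[0] ^+ 2 + ia * e T.[0] ^+ 2.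
  by rewrite /h hornerD horner_exp hornerM horner_exp hornerC rmorphD rmorphXn rmorphM rmorphXn -bE.
have [|||lam [y [lam0 sy yE]]] := IH _ _ _ _ (inF P.[0]) (inF Q.[0]) (inF R.[0]) (inF T.[0]).
- exact: nz0.
- exact: nz0.
- exists (e u'), (e v'); split=> //; rewrite -f0E -h0E -rmorphM -hornerM uvE' mul1r.
  by rewrite rmorphD !rmorphXn.
have uv0 : e u ^+ 2 + e v ^+ 2 != 0.
  have : e f.[0] != 0 by rewrite f0E norm_neq0 // nz0.
  by rewrite uvE rmorphM rmorphD !rmorphXn mulf_eq0 negb_or => /andP[].
have gE : e g = iota lam * (y / (e u ^+ 2 + e v ^+ 2)).
  rewrite mulrA -yE -f0E uvE rmorphM rmorphD !rmorphXn mulfK //.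
have en0 : ev n != 0.
  by apply: contraNneq n0 => z; apply/eqP; apply: (transc_poly_inj eM tr); rewrite rmorph0.
have efE : ev f = e g * ((ev C ^+ 2 + ev D ^+ 2) / ev n ^+ 2).
  rewrite mulrA; have := congr1 ev nE;
    rewrite rmorphM rmorphXn rmorphM (rmorphD _ (C ^+ 2)) !rmorphXn /ev poly_evC -/ev => <-.
  by rewrite mulfK // expf_neq0.
exists lam, ((q / ev Q) ^+ 2 * (y / (e u ^+ 2 + e v ^+ 2)) * ((ev C ^+ 2 + ev D ^+ 2) / ev n ^+ 2)).
split=> //; last by rewrite fE efE gE; ring.
have sosS z : sos (adj s) z -> sos (adj (x :: s)) z.
  by move=> [U [V [AU AV ->]]]; exists U, V; split=> //; apply: adjS.
have sos2 z w : adj (x :: s) z -> adj (x :: s) w -> sos (adj (x :: s)) (z ^+ 2 + w ^+ 2).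
  by move=> *; exists z, w.
apply: (sosM A_sf); first apply: (sosM A_sf).
- by apply: sos_sqr => //; sf_tac A_sf.
- apply: (sosM A_sf); first exact: sosS.
  by apply: (sosV A_sf); apply: sos2; apply: adjS.
- apply: (sosM A_sf); first by apply: sos2; apply: adj_poly_ev.
  by apply: (sosV A_sf); apply: sos_sqr => //; apply: adj_poly_ev.
Qed.

End Step.

End UnramifiedStep.

(** * Norms of an involution inverting a variable *)

Section NormStep.

Variables (K L : fieldType) (iota : {rmorphism K -> L}) (s : seq L) (x f : L).
Variable tau : {rmorphism L -> L}.
Hypothesis tauK : forall y, tau (tau y) = y.
Hypothesis tau_adj : forall y, adj iota s y -> adj iota s (tau y).
Hypothesis tr : ~ acl iota s x.
Hypotheses (f_in : adj iota s f) (f0 : f != 0) (tau_f : tau f = f)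
  (tau_x : tau x = f / x).

Variables (F : fieldType) (e : {rmorphism F -> L}).
Hypothesis eM : image_of e (adj iota s).

Let ev := poly_ev e x.

Let ev_inj P Q : ev P = ev Q -> P = Q. Proof. exact: (transc_poly_inj eM tr). Qed.

Let x0 : x != 0.
Proof. by apply/eqP=> x0; apply: tr; rewrite x0; apply: sf0 (acl_sf _ _). Qed.

(* The reciprocal polynomial: [ev P* = x ^+ n * tau (ev P)]. *)
Lemma star_exists n (P : {poly F}) : (size P <= n.+1)%N -> exists P' : {poly F},
  [/\ (size P' <= n.+1)%N, ev P' = x ^+ n * tau (ev P),
      e P'`_0 = tau (e P`_n) * f ^+ n & e P'`_n = tau (e P`_0)].
Proof.
move=> sP; have ex (i : nat) : exists c, e c = tau (e P`_(n - i)) * f ^+ (n - i).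
  have /eM[c cE] : adj iota s (tau (e P`_(n - i)) * f ^+ (n - i)); last by exists c.
  have A_sf := adj_sf iota s; apply: (sfM A_sf); last exact: (sfX A_sf).
  by apply: tau_adj; apply/eM; exists P`_(n - i).
pose c i := proj1_sig (constructive_indefinite_description _ (ex i)).
have cE i : e (c i) = tau (e P`_(n - i)) * f ^+ (n - i).
  exact: proj2_sig (constructive_indefinite_description _ (ex i)).
have szS : (size (\poly_(i < n.+1) c i) <= n.+1)%N by apply: size_poly.
exists (\poly_(i < n.+1) c i); split=> //.
- rewrite /ev !poly_evE.
  rewrite (@horner_coef_wide _ n.+1 (map_poly e P)) ?size_map_poly //.
  rewrite (@horner_coef_wide _ n.+1) ?size_map_poly //.
  rewrite rmorph_sum mulr_sumr [RHS](reindex_inj rev_ord_inj) /=.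
  apply: eq_bigr => i _; rewrite !coef_map /= coef_poly ltn_ord cE subSS.
  rewrite rmorphM rmorphXn tau_x exprMn exprVn.
  have -> : x ^+ n = x ^+ i * x ^+ (n - i) by rewrite -exprD subnKC // -ltnS.
  have := expf_neq0 (n - i) x0; move: (x ^+ (n - i)) => z z0.
  by field.
- by rewrite coef_poly cE subn0.
- by rewrite coef_poly ltnSn cE subnn expr0 mulr1.
Qed.

(** Write R = P / Q in lowest terms. Up to powers of x, tau sends P and Q to reciprocal polynomials,
    and P times its reciprocal equals Q times its own, up to a factor free of x. By coprimality P is
    associate to the reciprocal of Q, and the factor c of proportionality yields h. *)
Lemma norm_step R g : adj iota (x :: s) R -> adj iota s g -> g != 0 ->
    R * tau R = g ->
  exists k h, [/\ adj iota s h, h != 0 & g = f ^+ k * (h * tau h)].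
Proof.
move=> AR /eM[g' gE] g0 Rg.
have [P [Q [PQ Q0 RE]]] := adj_cons_coprime eM AR.
have P0 : ev P != 0.
  by apply: contraNneq g0 => P0; rewrite -Rg RE -/ev P0 !mul0r.
(* tau exchanges x = 0 and x = infinity. Powers of x are split off first: the norm of x is f, so
   they only contribute powers of f. *)
have split_X (U : {poly F}) : ev U != 0 -> exists i V, V.[0] != 0 /\ U = V * 'X^i.
  move=> U0; have Un0 : U != 0 by apply: contraNneq U0 => ->; rewrite rmorph0.
  have [i [V VE UE]] := multiplicity_XsubC U 0; exists i, V.
  by move: VE UE; rewrite Un0 subr0 /=.
have [i [P1 [P10 PE]]] := split_X P P0.
have [j [Q1 [Q10 QE]]] := split_X Q Q0.
have P1Q1 : coprimep P1 Q1.
  move: PQ; rewrite PE QE => /(coprimep_dvdr (dvdp_mulr 'X^i (dvdpp P1))).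
  by move/(coprimep_dvdl (dvdp_mulr 'X^j (dvdpp Q1))).
have evXn k : ev 'X^k = x ^+ k by rewrite rmorphXn /ev poly_evX.
have evP1 : ev P1 != 0 by apply: contraNneq P0; rewrite PE rmorphM => ->; rewrite mul0r.
have evQ1 : ev Q1 != 0 by apply: contraNneq Q0; rewrite QE rmorphM -/ev => ->; rewrite mul0r.
pose p := (size P1).-1; pose q := (size Q1).-1.
have P1n0 : P1 != 0 by apply: contraNneq P10 => ->; rewrite horner0.
have Q1n0 : Q1 != 0 by apply: contraNneq Q10 => ->; rewrite horner0.
have sP : size P1 = p.+1 by rewrite prednK // size_poly_gt0.
have sQ : size Q1 = q.+1 by rewrite prednK // size_poly_gt0.
have [P2 [sP2 evP2 P20 P2n]] := @star_exists p P1 (eq_leq sP).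
have [Q2 [sQ2 evQ2 Q20 Q2n]] := @star_exists q Q1 (eq_leq sQ).
have lead_n0 (U : {poly F}) n : U != 0 -> size U = n.+1 -> tau (e U`_n) * f ^+ n != 0.
  move=> U0 sU; rewrite mulf_neq0 ?expf_neq0 // !fmorph_eq0.
  by have := U0; rewrite -lead_coef_eq0 lead_coefE sU.
have P200 : P2.[0] != 0 by rewrite horner_coef0 -(fmorph_eq0 e) P20 lead_n0.
have Q200 : Q2.[0] != 0 by rewrite horner_coef0 -(fmorph_eq0 e) Q20 lead_n0.
have [gam gamE] : exists gam, e gam = g * f ^+ j / f ^+ i.
  have A_sf := adj_sf iota s.
  have /eM[c cE] : adj iota s (g * f ^+ j / f ^+ i); last by exists c.
  by have Ag : adj iota s g by [apply/eM; exists g']; sf_tac A_sf.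
have gam0 : gam != 0.
  by rewrite -(fmorph_eq0 e) gamE !mulf_neq0 ?invr_eq0 ?expf_neq0.
have xn k : x ^+ k != 0 by apply: expf_neq0.
have fn k : f ^+ k != 0 by apply: expf_neq0.
have tP1 : tau (ev P1) = ev P2 / x ^+ p by rewrite evP2 mulrC mulKf.
have tQ1 : tau (ev Q1) = ev Q2 / x ^+ q by rewrite evQ2 mulrC mulKf.
have evQ2n : ev Q2 != 0 by rewrite evQ2 mulf_neq0 // fmorph_eq0.
have key : P1 * P2 * 'X^q = gam%:P * (Q1 * Q2) * 'X^p.
  apply: ev_inj; rewrite !(rmorphM ev) !evXn /ev poly_evC -/ev gamE -Rg.
  rewrite RE -/ev PE QE !(rmorphM ev) !evXn !(fmorph_div, rmorphM tau) !(rmorphXn tau) tau_x.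
  rewrite tP1 tQ1 !exprMn !exprVn.
  have := (xn i, xn j, xn p, xn q, (fn i, fn j)).
  move: (x ^+ i) (x ^+ j) (x ^+ p) (x ^+ q) (f ^+ i) (f ^+ j).
  move=> xi xj xp xq fi fj [[[[? ?] ?] ?] [? ?]].
  by field; repeat (apply/andP; split=> //).
(* P1, P2, Q1, Q2 have nonzero constant terms, so the powers of X on the two sides of [key]
   agree. *)
have pq : p = q.
  have cancel m n (U V : {poly F}) : V.[0] != 0 -> U * 'X^n = V * 'X^m -> (n <= m)%N.
    move=> V0 UV; rewrite leqNgt; apply/negP=> lt_mn; case/eqP: V0.
    have Xm : ('X^m : {poly F}) != 0 by rewrite monic_neq0 ?monicXn.
    have -> : V = U * 'X^(n - m).
      by apply: (mulIf Xm); rewrite -UV -mulrA -exprD subnK // ltnW.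
    by rewrite hornerM hornerXn expr0n subn_eq0 leqNgt lt_mn mulr0.
  apply/eqP; rewrite eqn_leq; apply/andP; split.
    by apply: (cancel _ _ _ _ _ (esym key)); rewrite hornerM mulf_neq0.
  by apply: (cancel _ _ _ _ _ key); rewrite !hornerM hornerC !mulf_neq0.
have key' : P1 * P2 = gam%:P * (Q1 * Q2).
  have Xq : ('X^q : {poly F}) != 0 by rewrite monic_neq0 ?monicXn.
  by apply: (mulIf Xq); rewrite key pq.
have [c cE] : exists c : F, Q2 = c%:P * P1.
  have : P1 %| Q2.
    have d : P1 %| Q1 * Q2.
      have : P1 %| gam%:P * (Q1 * Q2) by rewrite -key' dvdp_mulr.
      by rewrite mul_polyC dvdpZr.
    by rewrite -(Gauss_dvdpr _ P1Q1).
  move=> /dvdpP[c cE]; have Q2n0 : Q2 != 0 by apply: contraNneq Q200 => ->; rewrite horner0.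
  have c0 : c != 0 by apply: contraNneq Q2n0; rewrite cE => ->; rewrite mul0r.
  have : (size c <= 1)%N.
    move: sQ2; rewrite cE size_mul // sP pq addnS /= -add1n leq_add2r //.
  by move/size1_polyC => cC; exists c`_0; rewrite -cC.
have c0 : c != 0 by apply: contraNneq Q200; rewrite cE => ->; rewrite mul0r horner0.
have P2E : P2 = (gam * c)%:P * Q1.
  apply: (mulfI P1n0); rewrite key' cE polyCM; ring.
(* Since tau is an involution, taking the reciprocal of Q1 twice returns Q1 up to f^q; this is
   compared with [Q2 = c P1] and [P2 = gam c Q1]. *)
have fE : f ^+ q = tau (e c) * (e gam * e c).
  have P2ev : e gam * e c * ev Q1 = x ^+ q * tau (ev P1).
    by rewrite -pq -evP2 P2E (rmorphM ev) /ev poly_evC rmorphM.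
  apply: (mulIf evQ1); rewrite -[RHS]mulrA P2ev.
  have t2 : tau (ev Q2) = x ^- q * f ^+ q * ev Q1.
    by rewrite evQ2 rmorphM rmorphXn tauK tau_x exprMn exprVn mulrC; ring.
  have : tau (ev Q2) = tau (e c) * tau (ev P1) by rewrite cE (rmorphM ev) /ev poly_evC rmorphM.
  rewrite t2 => t3; apply: (lin_eq (k := x ^+ q) t3).
  by have := xn q; move: (x ^+ q) => z z0; field.
have Ac : adj iota s (e c) by apply/eM; exists c.
have A_sf := adj_sf iota s.
have ec0 : e c != 0 by rewrite fmorph_eq0.
have tec0 : tau (e c) != 0 by rewrite fmorph_eq0.
(* The true exponent is i + q - j. Putting f^j, of norm f^(2j), into h keeps it a natural number. *)
exists (i + q + j)%N, ((f ^+ j * e c)^-1); split.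
- by sf_tac A_sf.
- by rewrite invr_eq0 mulf_neq0.
rewrite fmorphV rmorphM rmorphXn tau_f !exprD fE gamE.
have := (fn i, fn j); move: (f ^+ i) (f ^+ j) => fi fj [? ?].
by field; repeat (apply/andP; split=> //).
Qed.

End NormStep.

(** * Irrationality of the fixed field of tau when c is a square *)

Section Irrationality.

Variables (K L : fieldType) (iota : {rmorphism K -> L}) (X1 X2 X3 : L).
Hypothesis indX : mindep iota 3 [:: X1; X2; X3].
Hypothesis genX : forall x, adj iota [:: X1; X2; X3] x.
Hypothesis two_neq0 : (2%:R : L) != 0.

Local Notation adj := (adj iota).
Local Notation acl := (acl iota).

(** From P^2 = k Q^2, the ratio of the leading coefficients is a square root of k free of x. *)
Lemma sqr_const_descent s x k y : ~ acl s x -> adj s k -> adj (x :: s) y ->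
  y ^+ 2 = k -> exists2 y', adj s y' & y' ^+ 2 = k.
Proof.
move=> tr Ak Ay yk; have [F [e eM]] := subfield_type (adj_sf iota s).
have /eM[l lE] := Ak; have [P [Q [Q0 yE]]] := adj_cons_frac eM Ay.
have Qn0 : Q != 0 by apply: contraNneq Q0 => ->; rewrite rmorph0.
have PQ : P ^+ 2 = l%:P * Q ^+ 2.
  apply: (transc_poly_inj eM tr); rewrite (rmorphXn (poly_ev e x)) (rmorphM (poly_ev e x)).
  rewrite (rmorphXn (poly_ev e x)) poly_evC -lE -yk yE; by field.
exists (e (lead_coef P / lead_coef Q)); first by apply/eM; exists (lead_coef P / lead_coef Q).
rewrite lE -rmorphXn; congr (e _); rewrite exprMn exprVn -lead_coef_exp PQ.
by rewrite lead_coefM lead_coefC lead_coef_exp mulfK // expf_neq0 ?lead_coef_eq0.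
Qed.

Let tr1 : ~ acl [::] X1. Proof. by case: (transc_X indX). Qed.
Let tr2 : ~ acl [:: X1] X2. Proof. by case: (transc_X indX). Qed.
Let tr3' : ~ acl [:: X1; X2] X3. Proof. by case: (transc_X indX). Qed.
Let tr3 : ~ acl [:: X2; X1] X3. Proof. by move=> /acl2. Qed.

Let gen321 x : adj [:: X3; X2; X1] x.
Proof.
apply: adj_trans (genX x); apply: forall_in_seq.
by split; [|split; [|split]] => //; apply: adj_mem; rewrite !inE eqxx ?orbT.
Qed.

Lemma sqr_ratfun (k : K) y : y ^+ 2 = iota k -> exists y', y' ^+ 2 = k.
Proof.
move=> yk; have AC s : adj s (iota k) by apply: adjC.
have [y3 A3 y3k] := sqr_const_descent tr3 (AC _) (gen321 y) yk.
have [y2 A2 y2k] := sqr_const_descent tr2 (AC _) A3 y3k.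
have [y1 /adj_nil[l ->] y1k] := sqr_const_descent tr1 (AC _) A2 y2k.
by exists l; apply: (fmorph_inj iota); rewrite rmorphXn.
Qed.

Variables (a c sg : K).
Hypotheses (a_neq0 : a != 0) (c_neq0 : c != 0) (c_sqr : c = sg ^+ 2).
Hypotheses (N1_nsqr : forall x : K, x ^+ 2 != -1)
  (a_nsqr : forall x : K, x ^+ 2 != a) (Na_nsqr : forall x : K, x ^+ 2 != - a).
Local Notation ia := (iota a).
Local Notation ic := (iota c).

Let ia0 : ia != 0. Proof. by rewrite fmorph_eq0. Qed.

Let L_nsqr (k : K) (y : L) : (forall x, x ^+ 2 != k) -> y ^+ 2 != iota k.
Proof. by move=> nk; apply/eqP=> /sqr_ratfun[x /eqP]; rewrite (negPf (nk x)). Qed.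

Let LN1 (y : L) : y ^+ 2 != -1.
Proof. by rewrite -(rmorphN1 iota); apply: L_nsqr. Qed.
Let La (y : L) : y ^+ 2 != ia. Proof. exact: L_nsqr. Qed.
Let LNa (y : L) : y ^+ 2 != - ia. Proof. by rewrite -rmorphN; apply: L_nsqr. Qed.

Lemma sos_ratfun (k : K) : sos (fun _ : L => True) (iota k) ->
  exists x y : K, k = x ^+ 2 + y ^+ 2.
Proof.
move=> [A [B [_ _ kE]]].
have step s x : ~ acl s x -> sos (adj (x :: s)) (iota k) -> sos (adj s) (iota k).
  move=> tr; have [F [e eM]] := subfield_type (adj_sf iota s).
  by apply: (sos_const_descent LN1 tr eM); apply: adjC.
have [A' [B' [/adj_nil[x ->] /adj_nil[y ->] e]]] : sos (adj [::]) (iota k).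
  apply: (step _ _ tr1); apply: (step _ _ tr2); apply: (step _ _ tr3).
  by exists A, B; split.
by exists x, y; apply: (fmorph_inj iota); rewrite e rmorphD !rmorphXn.
Qed.

Variable tau : {rmorphism L -> L}.
Hypothesis tauC : forall k, tau (iota k) = iota k.
Hypotheses (tau1 : tau X1 = - X1) (tau2 : tau X2 = ia / X2)
  (tau3 : tau X3 = (ia * X1 ^+ 2 - ic) / X3).

Let X1_0 : X1 != 0. Proof. exact: transc_neq0 tr1. Qed.
Let X2_0 : X2 != 0. Proof. exact: transc_neq0 tr2. Qed.
Let X3_0 : X3 != 0. Proof. exact: transc_neq0 tr3. Qed.

Let f := ia * X1 ^+ 2 - ic.

Let f0 : f != 0.
Proof.
rewrite subr_eq0; apply: contraNneq (transc_sqr_neq (c / a) tr1) => e.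
by rewrite fmorph_div -e mulrAC mulfV ?mul1r.
Qed.

Let tau_f : tau f = f.
Proof. by rewrite rmorphB rmorphM rmorphXn !tauC tau1 sqrrN. Qed.

Let tauK y : tau (tau y) = y.
Proof.
pose tt := [the {rmorphism L -> L} of tau \o tau].
apply: (@subfield_full _ _ iota X1 X2 X3 genX (fun y => tt y = y)); first exact: fix_sf.
- by move=> k /=; rewrite !tauC.
- by rewrite /= tau1 rmorphN tau1 opprK.
- by rewrite /= tau2 fmorph_div tauC tau2 divKf.
- by rewrite /= tau3 -/f fmorph_div tau_f tau3 -/f divKf.
Qed.

Let tau_adj s y : {in s, forall z, adj s (tau z)} -> adj s y -> adj s (tau y).
Proof.
move=> ts; apply: (adj_sub (M := fun y => adj s (tau y))) => //.
  have A_sf := adj_sf iota s; split; first by rewrite rmorph1; apply: sf1.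
    by move=> u v Au Av; rewrite rmorphB; apply: (sfB A_sf).
  by move=> u v Au Av; rewrite fmorph_div; apply: (sf_div A_sf).
by move=> k; rewrite tauC; apply: adjC.
Qed.

Lemma no_norm_N1 R : R * tau R != -1.
Proof.
apply/eqP=> R1.
have A21 : adj [:: X2; X1] X1 by apply: adj_mem; rewrite !inE eqxx orbT.
have A22 : adj [:: X2; X1] X2 by apply: adj_mem; rewrite mem_head.
have A11 : adj [:: X1] X1 by apply: adj_mem; rewrite mem_head.
have S2_sf := adj_sf iota [:: X2; X1]; have S1_sf := adj_sf iota [:: X1].
have A2f : adj [:: X2; X1] f by rewrite /f; adj_tac S2_sf.
have A1f : adj [:: X1] f by rewrite /f; adj_tac S1_sf.
have [k [h [Ah h0 hE]]] : exists k h,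
    [/\ adj [:: X2; X1] h, h != 0 & -1 = f ^+ k * (h * tau h)].
  have [F [e eM]] := subfield_type S2_sf.
  apply: (norm_step tauK _ tr3 A2f f0 tau_f tau3 eM (gen321 R)) => //; last 2 first.
  - by sf_tac S2_sf.
  - by rewrite oppr_eq0 oner_eq0.
  move=> y; apply: tau_adj; apply: forall_in_seq; split; first by rewrite tau2; adj_tac S2_sf.
  by split=> //; rewrite tau1; sf_tac S2_sf.
have fk : f ^+ k != 0 by apply: expf_neq0.
have hE' : h * tau h = - (f ^+ k)^-1.
  by apply: (lin_eq (k := - (f ^+ k)^-1) hE); field.
have [m [h' [Ah' h'0 h'E]]] : exists m h',
    [/\ adj [:: X1] h', h' != 0 & - (f ^+ k)^-1 = ia ^+ m * (h' * tau h')].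
  have [F [e eM]] := subfield_type S1_sf.
  have A1a : adj [:: X1] ia by apply: adjC.
  apply: (norm_step tauK _ tr2 A1a ia0 (tauC a) tau2 eM Ah) => //.
  - move=> y; apply: tau_adj; apply: forall_in_seq; split=> //.
    by rewrite tau1; sf_tac S1_sf.
  - by sf_tac S1_sf.
  - by rewrite oppr_eq0 invr_eq0.
have eM : image_of iota (adj [::]).
  by move=> y; split=> [/adj_nil //|[z ->]]; apply: adjC.
have [P [Q [PQ Q0 hPQ]]] := adj_cons_coprime eM Ah'.
pose ev := poly_ev iota X1; pose neg (U : {poly K}) := U \Po (- 'X).
have tau_ev U : tau (ev U) = ev (neg U).
  rewrite /ev /neg; elim/poly_ind: U => [|U d IH]; first by rewrite comp_poly0 !rmorph0.
  rewrite comp_polyD comp_polyM comp_polyC comp_polyX !rmorphD !rmorphM IH.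
  by rewrite rmorphN !poly_evC poly_evX tauC tau1.
have Pn0 : P != 0.
  by apply: contraNneq h'0 => P0; rewrite hPQ P0 rmorph0 mul0r.
have Qn0 : Q != 0 by apply: contraNneq Q0 => ->; rewrite rmorph0.
have evnQ : ev (neg Q) != 0 by rewrite -tau_ev fmorph_eq0.
(* This is -1 = f^k a^m h' tau(h') for h' = P / Q in K(X1), cleared of denominators; tau acts there
   by X1 -> -X1, which is [neg]. *)
have key : - (Q * neg Q) = (a%:P * 'X^2 - c%:P) ^+ k * (a ^+ m)%:P * (P * neg P).
  apply: (transc_poly_inj eM tr1);
    rewrite -/ev rmorphN !(rmorphM ev) rmorphXn rmorphB rmorphM rmorphXn.
  rewrite /ev !poly_evC poly_evX rmorphXn -/ev -/f.
  have h'E2 : -1 = f ^+ k * (ia ^+ m * (h' * tau h')) by rewrite -h'E mulrN mulfV.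
  rewrite hPQ -/ev fmorph_div !tau_ev in h'E2.
  by apply: (lin_eq (k := ev Q * ev (neg Q)) h'E2); field; rewrite evnQ Q0.
have neg0 U : (neg U).[0] = U.[0] by rewrite horner_comp hornerN hornerX oppr0.
have at0 : - Q.[0] ^+ 2 = (- c) ^+ k * a ^+ m * P.[0] ^+ 2.
  have := congr1 (fun U : {poly K} => U.[0]) key; rewrite /= hornerN !hornerM !neg0 horner_exp.
  rewrite hornerD hornerN hornerM !hornerC hornerXn expr0n mulr0 add0r => e0.
  by rewrite !expr2.
have ck : (- c) ^+ k != 0 by rewrite expf_neq0 // oppr_eq0.
have am : a ^+ m != 0 by apply: expf_neq0.
have P00 : P.[0] != 0.
  apply/eqP=> P0; have := coprimep_root PQ (introT rootP P0).
  move/eqP: at0; rewrite P0 expr0n mulr0 oppr_eq0 expf_eq0 /= => /eqP->.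
  by rewrite eqxx.
have szn U : size (neg U) = size U.
  by rewrite size_comp_poly2 // size_polyN size_polyX.
have ldn U : lead_coef (neg U) = lead_coef U * (-1) ^+ (size U).-1.
  by rewrite lead_coef_comp ?size_polyN ?size_polyX // lead_coefN lead_coefX.
have ldD : lead_coef (a%:P * 'X^2 - c%:P) = a /\ size (a%:P * 'X^2 - c%:P) = 3.
  have s2 : size (a%:P * 'X^2 : {poly K}) = 3 by rewrite mul_polyC size_scale // size_polyXn.
  have lt : (size (- c%:P : {poly K}) < size (a%:P * 'X^2 : {poly K})%R)%N.
    by rewrite s2 size_polyN (leq_ltn_trans (size_polyC_leq1 _)).
  by rewrite lead_coefDl // lead_coefM lead_coefC lead_coefXn mulr1 size_polyDl.
have negn0 U : U != 0 -> neg U != 0 by rewrite -!size_poly_gt0 szn.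
have ld : - (lead_coef Q ^+ 2 * (-1) ^+ (size Q).-1) =
    a ^+ (k + m) * (lead_coef P ^+ 2 * (-1) ^+ (size P).-1).
  have := congr1 (@lead_coef _) key.
  rewrite lead_coefN !lead_coefM !ldn lead_coef_exp lead_coefC ldD.1 exprD => e0.
  by apply: (lin_eq (k := 1) e0); ring.
(* [neg] multiplies leading coefficients by (-1)^deg; comparing degrees in [key] shows that the two
   signs differ by (-1)^k. *)
have sz : (size Q).-1 = ((size P).-1 + k)%N.
  have Dn0 : a%:P * 'X^2 - c%:P != 0 by rewrite -size_poly_gt0 ldD.2.
  have sD : size ((a%:P * 'X^2 - c%:P) ^+ k) = (2 * k).+1.
    by rewrite -[LHS]prednK ?size_poly_gt0 ?expf_neq0 // size_exp ldD.2.
  have := congr1 (fun U : {poly K} => size U) key; rewrite /= size_polyN.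
  have := sD; have := expf_neq0 k Dn0; move: (_ ^+ k) => Dk Dk0 sDk.
  rewrite size_mul ?negn0 // szn (mulrC Dk) -mulrA mul_polyC size_scale //.
  rewrite size_mul ?mulf_neq0 ?negn0 // size_mul ?negn0 // szn sDk.
  have := Pn0; have := Qn0; rewrite -!size_poly_gt0.
  case: (size Q) => // q _; case: (size P) => // p _ /=.
  rewrite !addnS /= ?addSn => /succn_inj; rewrite mul2n !addnn -doubleD => e1.
  by rewrite (double_inj e1) addnC.
move: ld; rewrite sz exprD => ld.
have sp : ((-1) ^+ (size P).-1 : K) != 0 by rewrite expf_neq0 // oppr_eq0 oner_eq0.
have {}ld : - (lead_coef Q ^+ 2 * (-1) ^+ k) = a ^+ (k + m) * lead_coef P ^+ 2.
  by apply: (mulIf sp); apply: (lin_eq (k := 1) ld); ring.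
have lP : lead_coef P != 0 by rewrite lead_coef_eq0.
have sg0 : sg != 0 by apply: contraNneq c_neq0; rewrite c_sqr => ->; rewrite expr0n.
have pow_nsqr (b : K) n w : b != 0 -> (forall x : K, x ^+ 2 != b) -> odd n ->
    w ^+ 2 = b ^+ n -> False.
  move=> b0 nb on wE; have /eqP := nb (w / b ^+ n./2); apply.
  rewrite exprMn wE -{1}(odd_double_half n) on -muln2 exprD expr1 exprVn -exprM.
  by rewrite mulfK // expf_neq0.
(* As c is a square, [at0] says that -(-1)^k a^m is a square, and [ld] that -(-1)^k a^(k+m) is. For
   k odd, a^m and a^(k+m) are squares and one exponent is odd, so a is a square. For k even, -a^m is
   a square, which makes -a a square when m is odd and -1 when m is even. *)
have [ok|ek] := boolP (odd k).
  have e1 : (Q.[0] / (sg ^+ k * P.[0])) ^+ 2 = a ^+ m.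
    have at0' : Q.[0] ^+ 2 = (sg ^+ k) ^+ 2 * a ^+ m * P.[0] ^+ 2.
      move: at0; rewrite exprNn -signr_odd ok expr1 c_sqr -exprM mulnC exprM => e0.
      by apply: (lin_eq (k := -1) e0); ring.
    rewrite exprMn at0' exprVn; have := expf_neq0 k sg0; move: (sg ^+ k) => z z0.
    by field; rewrite z0 P00.
  have e2 : (lead_coef Q / lead_coef P) ^+ 2 = a ^+ (k + m).
    rewrite -signr_odd ok expr1 mulrN1 opprK in ld.
    by rewrite exprMn ld exprVn mulfK // expf_neq0.
  have [om|em] := boolP (odd m); first exact: pow_nsqr e1.
  by apply: pow_nsqr e2 => //; rewrite oddD ok (negPf em).
have at0' : (Q.[0] / (sg ^+ k * P.[0])) ^+ 2 = - a ^+ m.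
  have at1 : - Q.[0] ^+ 2 = (sg ^+ k) ^+ 2 * a ^+ m * P.[0] ^+ 2.
    move: at0; rewrite exprNn -signr_odd (negPf ek) expr0 mul1r c_sqr -exprM mulnC exprM.
    by [].
  have at2 : Q.[0] ^+ 2 = - ((sg ^+ k) ^+ 2 * a ^+ m * P.[0] ^+ 2) by rewrite -at1 opprK.
  rewrite exprMn at2 exprVn; have := expf_neq0 k sg0; move: (sg ^+ k) => z z0.
  by field; rewrite z0 P00.
have [om|em] := boolP (odd m).
  apply: (pow_nsqr (- a) m (Q.[0] / (sg ^+ k * P.[0])) _ Na_nsqr om); first by rewrite oppr_eq0.
  by rewrite at0' exprNn -signr_odd om expr1 mulN1r.
have /eqP := N1_nsqr (Q.[0] / (sg ^+ k * P.[0]) / a ^+ m./2); apply.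
rewrite exprMn at0' -{1}(odd_double_half m) (negPf em) add0n -muln2 exprM exprVn mulNr.
by rewrite mulfV // expf_neq0 // expf_neq0.
Qed.

(** The list is reversed because independence singles out the last entry, while [unramified_step]
    adjoins a new head. *)
Lemma mindep_unramified s : mindep iota (size s) s -> unramified iota a (rev s).
Proof.
elim/last_ind: s => [|s x IH]; first by move=> _; apply: unramified_nil.
rewrite size_rcons rev_rcons => /(mindep_rconsP _ _ (erefl (size s)))[/IH un tr].
have [F [e eM]] := subfield_type (adj_sf iota (rev s)).
apply: (unramified_step a_neq0 LN1 La LNa _ eM un) => al; apply: tr.
by apply: acl_trans al => z zs; apply: acl_mem; rewrite -mem_rev.
Qed.

Lemma threefold_irrational s : mindep iota (size s) s ->
    {in s, forall z, tau z = z} ->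
    adj s (tau_u iota X2 a) -> adj s (tau_z iota X1 X3 a c) ->
    adj s (tau_v iota X1 X2 a) -> adj s (tau_W iota X1 X2 X3 a c) -> False.
Proof.
move=> ind ts; set u := tau_u _ _ _; set z := tau_z _ _ _ _ _.
set v := tau_v _ _ _ _; set W := tau_W _ _ _ _ _ _.
have sub y : adj s y -> adj (rev s) y.
  by apply: adj_trans => w ws; apply: adj_mem; rewrite mem_rev.
move=> /sub Au /sub Az /sub Av /sub AW; have A_sf := adj_sf iota (rev s).
have fixA y : adj (rev s) y -> tau y = y.
  apply: (adj_sub (M := fun y => tau y = y)); [exact: fix_sf | exact: tauC |].
  by move=> w; rewrite mem_rev; apply: ts.
have A1 : adj (rev s) 1 by apply: sf1.
have n1 (w : L) : (w != 0) || ((1 : L) != 0) by rewrite oner_eq0 orbT.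
have [|lam [y [lam0 [A [B [AA AB yE]]] uE]]] :=
    mindep_unramified ind Au A1 Az A1 (n1 u) (n1 z).
  exists W, (iota sg * v); split=> //; first by adj_tac A_sf.
  by rewrite !expr1n !mulr1 -(tau_rel indX two_neq0) [(iota sg * v) ^+ 2]exprMn -(rmorphXn iota)
    -c_sqr.
pose D := (X2 - ia / X2) / 2%:R.
have uD : u ^+ 2 - ia = D ^+ 2 by rewrite /u /tau_u /D; fld.
have tauD : tau D = - D.
  rewrite /D fmorph_div rmorphB fmorph_div tauC tau2 rmorph_nat; fld.
have D0 : D != 0.
  by rewrite -sqrf_eq0 -uD subr_eq0 La.
move: uE; rewrite expr1n mulr1 uD => DE.
have il0 : iota lam != 0 by rewrite fmorph_eq0.
have y0 : y != 0.
  by apply: contraNneq (expf_neq0 2 D0); rewrite DE => ->; rewrite mulr0.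
(* In L, where D lives, lam = D^2 / y is a sum of two squares; [sos_ratfun] brings this down to
   K. *)
have [l1 [l2 lE]] : exists l1 l2 : K, lam = l1 ^+ 2 + l2 ^+ 2.
  apply: sos_ratfun; rewrite (_ : iota lam = D ^+ 2 * y^-1); last by rewrite DE mulfK.
  have T_sf : is_subfield (fun _ : L => True) by [].
  apply: (sosM T_sf); first exact: sos_sqr.
  by apply: (sosV T_sf); exists A, B.
(* Real and imaginary parts of (l1 + i l2)(A + i B), so that P^2 + Q^2 = lam y = D^2. *)
pose P := iota l1 * A - iota l2 * B; pose Q := iota l1 * B + iota l2 * A.
have DPQ : D ^+ 2 = P ^+ 2 + Q ^+ 2.
  by rewrite DE lE yE rmorphD !rmorphXn /P /Q; ring.
have tP : tau P = P by apply: fixA; rewrite /P; adj_tac A_sf.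
have tQ : tau Q = Q by apply: fixA; rewrite /Q; adj_tac A_sf.
have Q0 : Q != 0.
  apply/eqP=> Q0; move: DPQ; rewrite Q0 expr0n addr0 => /eqP; rewrite eqf_sqr.
  have nD : D != - D.
    by rewrite -subr_eq0 opprK -mulr2n -mulr_natl mulf_neq0.
  case/orP=> /eqP DP; case/eqP: nD; first by rewrite -tauD DP tP.
  by rewrite -tauD DP rmorphN tP.
(* tau sends D - P to -D - P, so the norm is (P^2 - D^2) / Q^2 = -1. *)
have /eqP := no_norm_N1 ((D - P) / Q); apply.
rewrite fmorph_div rmorphB tauD tP tQ.
by apply: (lin_eq (k := - Q ^- 2) DPQ); field.
Qed.

End Irrationality.

(** * Morphisms of rational function fields *)

Lemma sub_divf (F : fieldType) (p q r s : F) : q != 0 -> s != 0 ->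
  p / q - r / s = (p * s - r * q) / (q * s).
Proof. by move=> q0 s0; field; rewrite q0 s0. Qed.

Section RatfunMorphisms.

Variables (K : fieldType) (n : nat) (L : fieldType).
Local Notation P := {mpoly K[n]}.

Lemma ratfun_extend (e : {rmorphism P -> L}) : (forall p, e p = 0 -> p = 0) ->
  exists E : {rmorphism ratfun K n -> L}, forall p, E (FracField.tofrac p) = e p.
Proof.
move=> e_inj; have e0 p : p != 0 -> e p != 0.
  by move=> p0; apply: contraNneq p0 => /e_inj ->.
pose E (f : ratfun K n) := e \n_(repr f) / e \d_(repr f).
have E_frac p q : q != 0 -> E (FracField.tofrac p / FracField.tofrac q) = e p / e q.
  move=> q0; set f := _ / _; have := frac_repr f; rewrite /E.
  have d0 : \d_(repr f) != 0 by apply: denom_ratioP.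
  move: (\n_(repr f)) (\d_(repr f)) d0 => p' q' q'0 /eqP.
  rewrite eqr_div ?tofrac_eq0 // -!rmorphM => /eqP/tofrac_inj pq.
  by apply/eqP; rewrite eqr_div ?e0 // -!rmorphM pq.
have repE (f : ratfun K n) : exists p q : P, q != 0 /\ f = FracField.tofrac p / FracField.tofrac q.
  by exists \n_(repr f), \d_(repr f); split; [exact: denom_ratioP | exact: (frac_repr f)].
have E_tofrac p : E (FracField.tofrac p) = e p.
  by have := E_frac p 1 (oner_neq0 _); rewrite !rmorph1 !divr1.
have addE : zmod_morphism E.
  move=> f g; have [p [q [q0 ->]]] := repE f; have [r [s [s0 ->]]] := repE g.
  have qf : FracField.tofrac q != 0 by rewrite tofrac_eq0.
  have sf : FracField.tofrac s != 0 by rewrite tofrac_eq0.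
  rewrite (sub_divf _ _ qf sf) -!rmorphM -rmorphB E_frac ?mulf_neq0 // !E_frac //.
  by rewrite (sub_divf _ _ (e0 _ q0) (e0 _ s0)) rmorphB !rmorphM.
have mulE : monoid_morphism E.
  split=> [|f g]; first by have := E_tofrac 1; rewrite !rmorph1.
  have [p [q [q0 ->]]] := repE f; have [r [s [s0 ->]]] := repE g.
  by rewrite mulf_div -!rmorphM E_frac ?mulf_neq0 // !E_frac // !rmorphM mulf_div.
pose za := GRing.isZmodMorphism.Build _ _ E addE.
pose ma := GRing.isMonoidMorphism.Build _ _ E mulE.
pose E' : {rmorphism ratfun K n -> L} := HB.pack E za ma.
by exists E'.
Qed.

Lemma ratfun_rmorph_ext (s t : {rmorphism ratfun K n -> L}) :
    (forall k, s (rfC K n k) = t (rfC K n k)) ->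
    (forall i, s (rfX K i) = t (rfX K i)) -> s =1 t.
Proof.
move=> eqC eqX f; rewrite (frac_repr f) !fmorph_div.
pose tf := [the {rmorphism P -> ratfun K n} of @FracField.tofrac P].
have eq p : s (FracField.tofrac p) = t (FracField.tofrac p).
  apply: (mpoly_rmorph_ext (f := [the {rmorphism P -> L} of s \o tf])
    (g := [the {rmorphism P -> L} of t \o tf])).
    exact: eqC.
  exact: eqX.
by rewrite !eq.
Qed.

End RatfunMorphisms.

Section RatfunThree.

Variable K : fieldType.
Local Notation Om := (ratfun K 3).
Local Notation C := (rfC K 3).

Lemma ratfun_sev p : sev C 3 [:: x1 K; x2 K; x3 K] p = FracField.tofrac p.
Proof.
rewrite -rf_eval_id; apply: eq_mev; apply: forall_ord3 => //.
Qed.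

Lemma ratfun_mindep : mindep C 3 [:: x1 K; x2 K; x3 K].
Proof. by move=> p; rewrite ratfun_sev => /eqP; rewrite tofrac_eq0 => /eqP. Qed.

Lemma ratfun_gen x : adj C [:: x1 K; x2 K; x3 K] x.
Proof.
rewrite (frac_repr x) -!ratfun_sev.
by apply: (sf_div (adj_sf _ _)); apply: adj_sev.
Qed.

Lemma ratfun_subst (L : fieldType) (iota : {rmorphism K -> L}) (u z v : L) :
    mindep iota 3 [:: u; z; v] ->
  exists phi : {rmorphism Om -> L}, [/\ forall k, phi (C k) = iota k,
    phi (x1 K) = u, phi (x2 K) = z & phi (x3 K) = v].
Proof.
move=> ind; have [phi phiE] := ratfun_extend ind; exists phi.
split=> [k|||]; first by rewrite [LHS]phiE mevC.
all: by rewrite [LHS]phiE mevX.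
Qed.

Lemma adj_quadratic (phi : {rmorphism Om -> Om}) u z v W (D : Om) x :
    (forall k, phi (C k) = C k) -> phi (x1 K) = u -> phi (x2 K) = z ->
    phi (x3 K) = v -> W ^+ 2 = phi D ->
  adj C [:: u; z; v; W] x <-> exists A B, x = phi A + phi B * W.
Proof.
move=> phiC pu pz pv WD; set s := [:: _; _; _; _]; have A_sf := adj_sf C s.
have Au : adj C s u by apply: adj_mem; rewrite mem_head.
have Az : adj C s z by apply: adj_mem; rewrite !inE eqxx orbT.
have Av : adj C s v by apply: adj_mem; rewrite !inE eqxx !orbT.
have AW : adj C s W by apply: adj_mem; rewrite !inE eqxx !orbT.
have im_sf : is_subfield (fun y => exists A, y = phi A).
  split; first by exists 1; rewrite rmorph1.
    by move=> _ _ [A ->] [B ->]; exists (A - B); rewrite rmorphB.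
  by move=> _ _ [A ->] [B ->]; exists (A / B); rewrite fmorph_div.
have imW : (fun y => exists A, y = phi A) (W ^+ 2) by exists D.
have Q_sf := quad_sf im_sf imW.
have Qin y := @quad_in _ _ W im_sf (phi y) (ex_intro _ y erefl).
split.
  move=> Ax; have [_ [_ [[A ->] [B ->] ->]]] : quad (fun y => exists A, y = phi A) W x.
    apply: (adj_sub (s := s)) Ax => //; first by move=> k; rewrite -phiC; apply: Qin.
    apply: forall_in_seq; split; first by rewrite -pu; apply: Qin.
    split; first by rewrite -pz; apply: Qin.
    split; first by rewrite -pv; apply: Qin.
    by split=> //; apply: quad_root.
  by exists A, B.
have im y : adj C s (phi y).
  apply: (adj_sub (M := fun y => adj C s (phi y)) _ _ _ (ratfun_gen y)).
  - split; first by rewrite rmorph1; apply: sf1.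
      by move=> f g Af Ag; rewrite rmorphB; apply: (sfB A_sf).
    by move=> f g Af Ag; rewrite fmorph_div; apply: (sf_div A_sf).
  - by move=> k; rewrite phiC; apply: adjC.
  - by apply: forall_in_seq; rewrite /= pu pz pv.
move=> [A [B ->]]; have [AA AB] := (im A, im B); sf_tac A_sf.
Qed.

Lemma threefold_transfer (a c : K) u z v W u' z' v' W' :
    (2%:R : Om) != 0 -> c != 0 ->
    mindep C 3 [:: u; z; v] -> mindep C 3 [:: u'; z'; v'] ->
    W ^+ 2 + C c * v ^+ 2 = (u ^+ 2 - C a) * (z ^+ 2 + C a) ->
    W' ^+ 2 + C c * v' ^+ 2 = (u' ^+ 2 - C a) * (z' ^+ 2 + C a) ->
  purely_transcendental C (adj C [:: u; z; v; W]) ->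
  purely_transcendental C (adj C [:: u'; z'; v'; W']).
Proof.
move=> two c0 ind ind' rel rel'.
have [phi [phiC pu pz pv]] := ratfun_subst ind.
have [phi' [phiC' pu' pz' pv']] := ratfun_subst ind'.
pose D := (x1 K ^+ 2 - C a) * (x2 K ^+ 2 + C a) - C c * x3 K ^+ 2.
have D_nsqr g : g ^+ 2 != D.
  exact: (threefold_disc_nsqr (@ratfun_mindep) (@ratfun_gen) two a c0).
have phiD (f : {rmorphism Om -> Om}) : (forall k, f (C k) = C k) -> f D =
    (f (x1 K) ^+ 2 - C a) * (f (x2 K) ^+ 2 + C a) - C c * f (x3 K) ^+ 2.
  move=> fC; rewrite /D rmorphB (rmorphM f (_ - _)) (rmorphM f (C c)) rmorphB rmorphD.
  by rewrite !(rmorphXn f) !fC.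
have WD : W ^+ 2 = phi D by rewrite phiD // pu pz pv -rel addrK.
have WD' : W' ^+ 2 = phi' D by rewrite phiD // pu' pz' pv' -rel' addrK.
apply: (transfer_purely D_nsqr phiC phiC' WD WD') => x.
  exact: (adj_quadratic x phiC pu pz pv WD).
exact: (adj_quadratic x phiC' pu' pz' pv' WD').
Qed.

End RatfunThree.

(** * Base change to K(sqrt c) *)

Lemma sqrt_extension (K : fieldType) (c : K) : (forall x : K, x ^+ 2 != c) ->
  exists (L : fieldType) (j : {rmorphism K -> L}) (s : L),
    s ^+ 2 = j c /\ forall l, exists k0 k1, l = j k0 + j k1 * s.
Proof.
move=> nc.
have irr : irreducible_poly ('X^2 - c%:P).
  apply: cubic_irreducible; first by rewrite size_XnsubC.
  by move=> x; rewrite rootE !hornerE subr_eq0 nc.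
have [E _ [z zc _]] := irredp_FAdjoin irr.
pose i := [the {rmorphism K -> E} of in_alg E].
have z2 : z ^+ 2 = i c.
  move/rootP: zc; rewrite rmorphB /= map_polyXn map_polyC hornerD hornerN hornerXn hornerC.
  by move/eqP; rewrite subr_eq0 => /eqP.
pose N (y : E) := exists k, y = i k.
have N_sf : is_subfield N.
  split; first by exists 1; rewrite rmorph1.
    by move=> _ _ [k ->] [l ->]; exists (k - l); rewrite rmorphB.
  by move=> _ _ [k ->] [l ->]; exists (k / l); rewrite fmorph_div.
have Nz : N (z ^+ 2) by rewrite z2; exists c.
(* The field is cut down to [quad N z], whose elements have the form k0 + k1 s by construction. *)
have [L [e eM]] := subfield_type (quad_sf N_sf Nz).
have [s sE] : exists s, z = e s by apply/eM; apply: quad_root.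
have ex k : exists l, i k = e l by apply/eM; apply: quad_in => //; exists k.
pose j k := proj1_sig (constructive_indefinite_description _ (ex k)).
have jE k : i k = e (j k) by apply: (proj2_sig (constructive_indefinite_description _ (ex k))).
have addj : zmod_morphism j.
  by move=> k l; apply: (fmorph_inj e); rewrite rmorphB -!jE rmorphB.
have mulj : monoid_morphism j.
  split; first by apply: (fmorph_inj e); rewrite -jE !rmorph1.
  by move=> k l; apply: (fmorph_inj e); rewrite rmorphM -!jE rmorphM.
pose za := GRing.isZmodMorphism.Build _ _ j addj.
pose ma := GRing.isMonoidMorphism.Build _ _ j mulj.
pose j' : {rmorphism K -> L} := HB.pack j za ma.
exists L, j', s; split; first by apply: (fmorph_inj e); rewrite rmorphXn -sE z2 -jE.
move=> l; have /eM[_ [_ [[k0 ->] [k1 ->] lE]]] : exists l', e l = e l' by exists l.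
by exists k0, k1; apply: (fmorph_inj e); rewrite rmorphD rmorphM -!jE -sE.
Qed.

Lemma adjoin_finite (K L : fieldType) (iota : {rmorphism K -> L}) B x :
  adjoin iota B x -> exists2 t, {in t, forall z, B z} & adj iota t x.
Proof.
move=> Ax; apply: (Ax (fun x => exists2 t, {in t, forall z, B z} & adj iota t x)).
- have cat t1 t2 y : adj iota t1 y \/ adj iota t2 y -> adj iota (t1 ++ t2) y.
    by case; apply: adj_trans => z zt; apply: adj_mem; rewrite mem_cat zt ?orbT.
  have catB t1 t2 : {in t1, forall z, B z} -> {in t2, forall z, B z} ->
      {in t1 ++ t2, forall z, B z}.
    by move=> B1 B2 z; rewrite mem_cat => /orP[/B1|/B2].
  split; first by exists [::] => //; apply: sf1 (adj_sf _ _).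
    move=> y z [t1 B1 A1] [t2 B2 A2]; exists (t1 ++ t2); first exact: catB.
    by apply: (sfB (adj_sf _ _)); apply: cat; [left | right].
  move=> y z [t1 B1 A1] [t2 B2 A2]; exists (t1 ++ t2); first exact: catB.
  by apply: (sf_div (adj_sf _ _)); apply: cat; [left | right].
- by move=> k; exists [::] => //; apply: adjC.
- move=> b Bb; exists [:: b]; first by move=> z; rewrite inE => /eqP->.
  by apply: adj_mem; rewrite mem_head.
Qed.

(** Each of the finitely many elements of s involves finitely many generators; those lists are
    concatenated and freed of repetitions. *)
Lemma purely_finite (K L : fieldType) (iota : {rmorphism K -> L}) (M : L -> Prop)
    (s : seq L) :
    purely_transcendental iota M -> {in s, forall x, M x} ->
  exists t, [/\ mindep iota (size t) t, {in t, forall z, M z}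
    & {in s, forall x, adj iota t x}].
Proof.
move=> [B [indB MB]] sM.
have [t tB tA] : exists2 t, {in t, forall z, B z} & {in s, forall x, adj iota t x}.
  elim: s sM => [|x s IH] sM; first by exists [::].
  have [|t tB tA] := IH; first by move=> z zs; apply: sM; rewrite inE zs orbT.
  have /MB/adjoin_finite[t' tB' tA'] : M x by apply: sM; rewrite mem_head.
  exists (t' ++ t) => [z|z]; first by rewrite mem_cat => /orP[/tB'|/tB].
  rewrite inE => /orP[/eqP->|/tA]; [move: tA' | ]; apply: adj_trans => w wt;
    by apply: adj_mem; rewrite mem_cat wt ?orbT.
have uB : {in undup t, forall z, B z} by move=> z; rewrite mem_undup; apply: tB.
exists (undup t); split.
- exact: (alg_independent_mindep indB erefl (undup_uniq t) uB).
- by move=> z /uB Bz; apply/MB; apply: adjoin_in.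
- by move=> x /tA; apply: adj_trans => w wt; apply: adj_mem; rewrite mem_undup.
Qed.

Section BaseChange.

Variables (K L : fieldType) (j : {rmorphism K -> L}).

Definition jC : {rmorphism K -> ratfun L 3} :=
  [the {rmorphism K -> ratfun L 3} of rfC L 3 \o j].

Lemma mev_coef n (p : {mpoly K[n]}) m :
  (mev [the {rmorphism K -> {mpoly L[n]}} of @mpolyC n L \o j] (fun i => 'X_i) p)@_m
    = j p@_m.
Proof.
set f := mev _ _; elim/mpolyind: p => [|k m' p _ _ IH]; first by rewrite !rmorph0 !mcoeff0 rmorph0.
rewrite rmorphD !mcoeffD IH rmorphD; congr (_ + _).
rewrite -mul_mpolyC rmorphM mevC mpolyXE_id rmorph_prod.
rewrite (eq_bigr (fun i => 'X_i ^+ m' i)); last by move=> i _; rewrite rmorphXn mevX.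
rewrite -!mpolyXE_id /= !mcoeffCM !mcoeffX.
by rewrite rmorphM rmorph_nat.
Qed.

Lemma ratfun_map : exists J : {rmorphism ratfun K 3 -> ratfun L 3},
  [/\ forall k, J (rfC K 3 k) = rfC L 3 (j k),
      J (x1 K) = x1 L, J (x2 K) = x2 L & J (x3 K) = x3 L].
Proof.
apply: (@ratfun_subst K _ jC) => p.
set f := mev [the {rmorphism K -> {mpoly L[3]}} of @mpolyC 3 L \o j] (fun i => 'X_i).
have -> : sev jC 3 [:: x1 L; x2 L; x3 L] p = FracField.tofrac (f p).
  rewrite /f (mev_rmorph (g := [the {rmorphism _ -> _} of @FracField.tofrac {mpoly L[3]}]) (f' :=
    jC)) //.
  by apply: eq_mev; apply: forall_ord3.
move=> /eqP; rewrite tofrac_eq0 => /eqP fp; apply/mpolyP => m.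
by apply: (fmorph_inj j); rewrite -mev_coef -/f fp !mcoeff0 rmorph0.
Qed.

Variables (J : {rmorphism ratfun K 3 -> ratfun L 3}) (s : L).
Hypothesis JC : forall k, J (rfC K 3 k) = rfC L 3 (j k).
Hypothesis span_s : forall l, exists k0 k1, l = j k0 + j k1 * s.
Hypothesis s_notin : forall f, J f <> rfC L 3 s.

(** Split the relation as p0 + s p1 with p0, p1 over K. If p1 does not vanish at t, then s is the
    image under J of -p0(t) / p1(t), which [s_notin] forbids; otherwise p1 = 0 and then p0 = 0 by
    independence over K. *)
Lemma mindep_base_change n t : size t = n -> mindep (rfC K 3) n t ->
  mindep (rfC L 3) n (map J t).
Proof.
move=> sz ind p.
pose f := mev [the {rmorphism K -> {mpoly L[n]}} of @mpolyC n L \o j] (fun i => 'X_i).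
have [p0 [p1 ->]] : exists p0 p1, p = f p0 + s%:MP * f p1.
  elim/mpolyind: p => [|l m p _ _ [p0 [p1 ->]]].
    by exists 0, 0; rewrite !rmorph0 mulr0 addr0.
  have [k0 [k1 ->]] := span_s l.
  exists (k0 *: 'X_[m] + p0), (k1 *: 'X_[m] + p1).
  have fX k : f (k *: 'X_[m]) = (j k)%:MP * 'X_[m].
    rewrite -mul_mpolyC rmorphM mevC; congr (_ * _); rewrite mpolyXE_id rmorph_prod [RHS]mpolyXE_id.
    by apply: eq_bigr => i _; rewrite rmorphXn mevX.
  rewrite !rmorphD !fX -mul_mpolyC mpolyCD mpolyCM; ring.
have ev q : sev (rfC L 3) n (map J t) (f q) = J (sev (rfC K 3) n t q).
  rewrite /sev /f (mev_rmorph (f' := jC)) => [|k]; last exact: mevC.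
  rewrite (mev_rmorph (g := J) (f' := jC)) //; apply: eq_mev => i.
  by rewrite mevX (nth_map 0) ?sz.
rewrite rmorphD rmorphM !ev mevC => e.
have [q1|q1] := eqVneq (sev (rfC K 3) n t p1) 0.
  move: e; rewrite q1 rmorph0 mulr0 addr0 => /eqP; rewrite fmorph_eq0 => /eqP/ind ->.
  by rewrite (ind _ q1) !rmorph0 mulr0 addr0.
case: (s_notin (f := - sev (rfC K 3) n t p0 / sev (rfC K 3) n t p1)).
have q1' : J (sev (rfC K 3) n t p1) != 0 by rewrite fmorph_eq0.
rewrite fmorph_div rmorphN; apply: (mulIf q1'); rewrite divfK //.
by apply/eqP; rewrite eq_sym -addr_eq0 addrC e.
Qed.

End BaseChange.

Lemma fixed_group_gen (L : fieldType) (S : (L -> L) -> Prop) x :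
  fixed_field (group_gen S) x <-> forall s, S s -> s x = x.
Proof.
split=> [fx s Ss|fx s]; first by apply: fx; apply: group_gen_in.
elim=> [t /fx //|//|t t' _ tx _ t'x|t t' _ tx tK _] /=.
  by rewrite t'x tx.
by rewrite -{1}tx tK.
Qed.

Lemma purely_ext (K L : fieldType) (iota : {rmorphism K -> L}) (M M' : L -> Prop) :
  (forall x, M x <-> M' x) ->
  purely_transcendental iota M -> purely_transcendental iota M'.
Proof.
move=> MM' [B [indB MB]]; exists B; split=> // x.
by rewrite -MB; split=> /MM'.
Qed.

(** Squaring l = k0 + k1 s gives 2 k0 k1 = 0, as s is not in K. Then e = k0^2, or e = k1^2 c and e c
    is a square. Taken at e = -1, a, -a, this is where -c, ac, -ac enter. *)
Lemma sqrt_ext_nsqr (K L : fieldType) (j : {rmorphism K -> L}) (s : L) (c e : K) :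
    (2%:R : K) != 0 -> (forall x : K, x ^+ 2 != c) -> s ^+ 2 = j c ->
    (forall l, exists k0 k1, l = j k0 + j k1 * s) ->
    (forall x : K, x ^+ 2 != e) -> (forall x : K, x ^+ 2 != e * c) ->
  forall l : L, l ^+ 2 != j e.
Proof.
move=> two nc sc span ne nec l; apply/eqP=> le.
have [k0 [k1 lE]] := span l.
have eq : j (2%:R * (k0 * k1)) * s = j (e - k0 ^+ 2 - k1 ^+ 2 * c).
  by rewrite !rmorphB rmorphXn !rmorphM rmorph_nat -le -sc lE; ring.
have [z|nz] := eqVneq (k0 * k1) 0; last first.
  have n2 : 2%:R * (k0 * k1) != 0 by rewrite mulf_neq0.
  have /eqP := nc ((e - k0 ^+ 2 - k1 ^+ 2 * c) / (2%:R * (k0 * k1))); apply.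
  apply: (fmorph_inj j); rewrite -sc rmorphXn fmorph_div -eq mulrAC mulfV ?mul1r //.
  by rewrite fmorph_eq0.
move/esym/eqP: eq; rewrite z mulr0 rmorph0 mul0r fmorph_eq0 => /eqP eq.
move/eqP: z; rewrite mulf_eq0 => /orP[]/eqP z.
  have /eqP := nec (k1 * c); apply; rewrite exprMn expr2 mulrA; congr (_ * _).
  by move/eqP: eq; rewrite z expr0n subr0 subr_eq0 => /eqP.
have /eqP := ne k0; apply.
by move/eqP: eq; rewrite z expr0n mul0r subr0 subr_eq0 => /eqP.
Qed.

Lemma in_seq4 (L : eqType) (Q : L -> Prop) (p q r w : L) :
  {in [:: p; q; r; w], forall x, Q x} -> [/\ Q p, Q q, Q r & Q w].
Proof. by move=> h; split; apply: h; rewrite !inE eqxx ?orbT. Qed.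

Section TauIrrational.

Variables (K : fieldType) (a c : K).
Hypotheses (two : (2%:R : K) != 0) (a0 : a != 0) (c0 : c != 0).
Variable tau : {rmorphism ratfun K 3 -> ratfun K 3}.
Hypothesis tauP : tau_spec a c tau.

Local Notation C := (rfC K 3).
Local Notation u := (tau_u C (x2 K) a).
Local Notation z := (tau_z C (x1 K) (x3 K) a c).
Local Notation v := (tau_v C (x1 K) (x2 K) a).
Local Notation W := (tau_W C (x1 K) (x2 K) (x3 K) a c).

Let twoOm (F : fieldType) (j : {rmorphism K -> F}) : (2%:R : F) != 0.
Proof. by rewrite -(rmorph_nat j) fmorph_eq0. Qed.

Lemma tau_irrational :
    (forall x : K, x ^+ 2 != -1) -> (forall x : K, x ^+ 2 != a) ->
    (forall x : K, x ^+ 2 != - a) -> (forall x : K, x ^+ 2 != a * c) ->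
    (forall x : K, x ^+ 2 != - (a * c)) -> (forall x : K, x ^+ 2 != - c) ->
  ~ purely_transcendental C (fun x => tau x = x).
Proof.
move=> n1 na nNa nac nNac nNc pt; have [[_ tauC] t1 t2 t3] := tauP.
have indK := @ratfun_mindep K; have genK := @ratfun_gen K; have twoC := twoOm C.
have [Fu Fz Fv FW] := tau_fixed_gens indK twoC a0 tauC t1 t2 t3.
have [|t [ind tF tA]] := purely_finite (s := [:: u; z; v; W]) pt.
  exact: forall_in_seq.
have [tAu tAz tAv tAW] := in_seq4 tA.
have [[sg cE]|nc'] := excluded_middle_informative (exists sg, c = sg ^+ 2).
  exact: (threefold_irrational indK genK twoC a0 c0 cE n1 na nNa tauC t1 t2 t3 ind tF).
have nc (x : K) : x ^+ 2 != c by apply/eqP=> e; apply: nc'; exists x.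
have [L [j [s [sc span]]]] := sqrt_extension nc.
have [J [JC J1 J2 J3]] := ratfun_map j.
have ext e (h1 : forall x : K, x ^+ 2 != e) (h2 : forall x : K, x ^+ 2 != e * c) :=
  sqrt_ext_nsqr two nc sc span h1 h2.
have m1 (x : L) : x ^+ 2 != -1.
  by rewrite -(rmorphN1 j); apply: ext => // y; rewrite mulN1r.
have ma (x : L) : x ^+ 2 != j a by apply: ext.
have mNa (x : L) : x ^+ 2 != - j a.
  by rewrite -rmorphN; apply: ext => // y; rewrite mulNr.
have ja0 : j a != 0 by rewrite fmorph_eq0.
have jc0 : j c != 0 by rewrite fmorph_eq0.
have [tauL [[_ tLC] tL1 tL2 tL3]] := tau_exists ja0 jc0.
have twoL : (2%:R : ratfun L 3) != 0 by rewrite -(rmorph_nat J) fmorph_eq0.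
(* Its preimage would be a square root of c in K(x1, x2, x3), hence one in K by [sqr_ratfun]. *)
have s_notin f : J f <> rfC L 3 s.
  move=> Jf; have f2 : f ^+ 2 = C c.
    by apply: (fmorph_inj J); rewrite rmorphXn Jf JC -rmorphXn sc.
  by have [y /eqP] := sqr_ratfun indK genK f2; rewrite (negPf (nc y)).
(* J intertwines the two involutions, so the images of the tau-fixed generators are fixed by
   [tauL]. *)
have Jtau f : tauL (J f) = J (tau f).
  apply: (ratfun_rmorph_ext (s := [the {rmorphism _ -> _} of tauL \o J])
    (t := [the {rmorphism _ -> _} of J \o tau])) => [k|] /=.
    by rewrite JC tLC tauC JC.
  apply: forall_ord3.
  - by rewrite -/(x1 K) J1 tL1 t1 rmorphN J1.
  - by rewrite -/(x2 K) J2 tL2 t2 fmorph_div JC J2.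
  - by rewrite -/(x3 K) J3 tL3 t3 fmorph_div rmorphB rmorphM rmorphXn !JC J1 J3.
have indL := mindep_base_change JC span s_notin erefl ind.
have Jadj y : adj C t y -> adj (rfC L 3) (map J t) (J y).
  have A_sf := adj_sf (rfC L 3) (map J t).
  apply: (adj_sub (M := fun y => adj (rfC L 3) (map J t) (J y))).
  - split; first by rewrite rmorph1; apply: sf1.
      by move=> f g Af Ag; rewrite rmorphB; apply: (sfB A_sf).
    by move=> f g Af Ag; rewrite fmorph_div; apply: (sf_div A_sf).
  - by move=> k; rewrite JC; apply: adjC.
  - by move=> w wt; apply: adj_mem; apply: map_f.
have n2 : J 2%:R = 2%:R by rewrite rmorph_nat.
have Ja := JC a; have Jc := JC c.
have Jf : J (C a * x1 K ^+ 2 - C c) = rfC L 3 (j a) * x1 L ^+ 2 - rfC L 3 (j c).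
  by rewrite rmorphB rmorphM rmorphXn Ja Jc J1.
have Jv : J v = tau_v (rfC L 3) (x1 L) (x2 L) (j a).
  by rewrite /tau_v fmorph_div rmorphM rmorphB fmorph_div Ja J1 J2 n2.
apply: (threefold_irrational (@ratfun_mindep L) (@ratfun_gen L) twoL ja0 jc0
  (esym sc) m1 ma mNa tLC tL1 tL2 tL3 (s := map J t)).
- by rewrite size_map.
- by move=> w /mapP[y yt ->]; rewrite Jtau tF.
- have -> : tau_u (rfC L 3) (x2 L) (j a) = J u; last exact: Jadj.
  by rewrite /tau_u fmorph_div rmorphD fmorph_div Ja J2 n2.
- have -> : tau_z (rfC L 3) (x1 L) (x3 L) (j a) (j c) = J z; last exact: Jadj.
  by rewrite /tau_z fmorph_div rmorphM rmorphB fmorph_div Jf J1 J3 n2.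
- by rewrite -Jv; apply: Jadj.
- have -> : tau_W (rfC L 3) (x1 L) (x2 L) (x3 L) (j a) (j c) = J W; last exact: Jadj.
  rewrite /tau_W rmorphM Jv; congr (_ * _).
  by rewrite /tau_w fmorph_div rmorphD fmorph_div Jf J3 n2.
Qed.

End TauIrrational.

Theorem theorem6 (K : fieldType) (char_neq2 : 2%N \notin [pchar K])
    (a c : K) (a_neq0 : a != 0) (c_neq0 : c != 0)
    (e1 e2 : K) (e1_sign : e1 = 1 \/ e1 = -1) (e2_sign : e2 = 1 \/ e2 = -1)
    (sigma1 sigma2 tau : {rmorphism ratfun K 3 -> ratfun K 3})
    (sigma1P : sigma1_spec a c sigma1) (sigma2P : sigma2_spec c e1 e2 sigma2)
    (tauP : tau_spec a c tau) :
  let G := group_gen (fun s : ratfun K 3 -> ratfun K 3 =>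
             s = sigma1 \/ s = sigma2) in
  let T := group_gen (fun s : ratfun K 3 -> ratfun K 3 => s = tau) in
  (e1 = 1 \/ e2 = 1 -> purely_transcendental (rfC K 3) (fixed_field G)) /\
  (e1 = -1 /\ e2 = -1 ->
     (purely_transcendental (rfC K 3) (fixed_field G) <->
      purely_transcendental (rfC K 3) (fixed_field T)) /\
     (purely_transcendental (rfC K 3) (fixed_field T) <->
      nonzero_square (-1 : K) \/ nonzero_square a \/ nonzero_square (- a) \/
      nonzero_square (a * c) \/ nonzero_square (- (a * c)) \/
      nonzero_square (- c))).
Proof.
move=> G T.
have indX := @ratfun_mindep K; have genX := @ratfun_gen K.
have two : (2%:R : K) != 0 by apply: contraNneq char_neq2 => t; rewrite inE /= t eqxx.
have twoC : (2%:R : ratfun K 3) != 0 by rewrite -(rmorph_nat (rfC K 3)) fmorph_eq0.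
have [[_ s1C] s11 s12 s13] := sigma1P.
have [[_ s2C] s21 s22 s23] := sigma2P.
have [[_ tauC] t1 t2 t3] := tauP.
have GE x : fixed_field G x <-> (sigma1 x = x /\ sigma2 x = x).
  rewrite fixed_group_gen; split=> [fx|[f1 f2] s [] ->] //.
  by split; apply: fx; [left | right].
have TE x : fixed_field T x <-> tau x = x.
  by rewrite fixed_group_gen; split=> [|fx s ->] //; apply.
have GS x : (sigma1 x = x /\ sigma2 x = x) <-> fixed_field G x by split=> /GE.
have TS x : tau x = x <-> fixed_field T x by split=> /TE.
have C1 (x : ratfun K 3) : rfC K 3 1 * x = x by rewrite rmorph1 mul1r.
have CN1 (x : ratfun K 3) : rfC K 3 (-1) * x = - x by rewrite rmorphN1 mulN1r.
split.
  case=> eE; rewrite eE ?C1 ?mul1r in s21 s22 s23.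
    case: e2_sign => e2E; rewrite e2E ?mul1r ?mulN1r ?rmorphN in s23.
      exact: purely_ext GS (purely_positive_positive indX genX twoC a_neq0 c_neq0
        s1C s2C s11 s12 s13 s21 s22 s23).
    exact: purely_ext GS (purely_positive_negative indX genX twoC a_neq0 c_neq0
      s1C s2C s11 s12 s13 s21 s22 s23).
  case: e1_sign => e1E; rewrite e1E ?C1 ?CN1 in s21 s22.
    exact: purely_ext GS (purely_positive_positive indX genX twoC a_neq0 c_neq0
      s1C s2C s11 s12 s13 s21 s22 s23).
  exact: purely_ext GS (purely_negative_positive indX genX twoC a_neq0 c_neq0
    s1C s2C s11 s12 s13 s21 s22 s23).
move=> [e1E e2E]; rewrite e1E !CN1 in s21 s22.
rewrite e2E mulN1r rmorphN in s23.
have G4 x := sg_fixedP indX genX twoC a_neq0 c_neq0 s1C s2C s11 s12 s13 s21 s22 s23 x.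
have T4 x := tau_fixedP indX genX twoC a_neq0 tauC t1 t2 t3 x.
have fullG := sg_full indX twoC c a_neq0; have relG := sg_rel indX twoC c a_neq0.
have fullT := tau_full indX twoC a c; have relT := tau_rel indX twoC a c.
have indG := acl_full_mindep indX fullG; have indT := acl_full_mindep indX fullT.
have GX x : fixed_field G x <-> adj (rfC K 3) _ x := iff_trans (GE x) (G4 x).
have TX x : fixed_field T x <-> adj (rfC K 3) _ x := iff_trans (TE x) (T4 x).
have XG x := iff_sym (GX x); have XT x := iff_sym (TX x).
split; split.
- move=> /(purely_ext GX) ptG; apply: (purely_ext XT).
  exact: threefold_transfer twoC c_neq0 indG indT relG relT ptG.
- move=> /(purely_ext TX) ptT; apply: (purely_ext XG).
  exact: threefold_transfer twoC c_neq0 indT indG relT relG ptT.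
- move=> /(purely_ext TE) ptT; apply: NNPP => nsq.
  have sq (k x : K) : x ^+ 2 = k -> k != 0 -> nonzero_square k.
    by move=> xk k0; exists x => //; apply: contraNneq k0 => x0; rewrite -xk x0 expr0n.
  apply: (tau_irrational two a_neq0 c_neq0 tauP _ _ _ _ _ _ ptT) => x;
    apply/eqP => xk; apply: nsq; have := sq _ _ xk;
    rewrite ?oppr_eq0 ?mulf_eq0 ?oner_eq0 ?(negPf a_neq0) ?(negPf c_neq0) /=;
    move=> /(_ isT); tauto.
move=> sqr; apply: (purely_ext XT).
case: sqr => [[i _ iE]|[[b _ bE]|[[b _ bE]|[[e _ eE]|[[e _ eE]|[d _ dE]]]]]].
- exact: (threefold_sqr_N1 indX twoC a_neq0 c_neq0 fullT relT iE).
- exact: (threefold_sqr_a indX twoC a_neq0 fullT relT bE).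
- exact: (threefold_sqr_Na indX twoC a_neq0 fullT relT bE).
- exact: (threefold_sqr_ac indX twoC a_neq0 c_neq0 fullT relT eE).
- exact: (threefold_sqr_Nac indX twoC a_neq0 c_neq0 fullT relT eE).
- exact: (threefold_sqr_Nc indX twoC c_neq0 fullT relT dE).
Qed.
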